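(* Let $q\geq 1$ be an integer. (a) Let $G$ be a finite simple graph and $e$ an edge of $G$. If $G$ is $q$-secant chordal, then so is its edge contraction $G/e$. (b) More generally, let $\Delta$ be a finite simplicial complex. If $S(\sigma_q\Delta)$ satisfies property $N_{q+1,p}$ for an integer $p\geq 1$, then $S(\sigma_q(\Delta/e))$ satisfies property $N_{q+1,p-1}$ for every edge $e$ of $\Delta$.
   Context: A simplicial complex $\Delta$ on a finite set $V=V(\Delta)$ is a collection of subsets of $V$ (faces) closed under taking subsets and with $\{v\}\in\Delta$ for every $v\in V$. An edge is a face with exactly two vertices. For $q\geq1$, $\sigma_q\Delta=\{F_1\cup\cdots\cup F_q : F_1,\dots,F_q\in\Delta\}$, a simplicial complex on $V$. For an edge $e$ of $\Delta$ and a new vertex $v$, the edge contraction $\Delta/e$ is the simplicial complex on $(V\setminus e)\cup\{v\}$ given by $\Delta/e=\{(F\setminus e)\cup\{v\}: F\in\Delta,\ F\cap e\neq\emptyset\}\cup\{F\in\Delta: F\cap e=\emptyset\}$. For a graph $G$, $G/e$ is the simple graph obtained by the same construction: the two endpoints of $e$ are replaced by one vertex $v$ adjacent to every other vertex that was adjacent to at least one endpoint of $e$. Let $\Bbbk$ be a field. With $V=\{0,\dots,r\}$ and $S=\Bbbk[x_0,\dots,x_r]$ standard graded, $I(\Delta)=(\prod_{i\in W}x_i : W\subseteq V,\ W\notin\Delta)$ and $S(\Delta)=S/I(\Delta)$ (for a complex on any finite vertex set, use a polynomial ring with one variable per vertex). $\beta_{i,j}(M)=\dim_\Bbbk \mathrm{Tor}^S_i(M,\Bbbk)_{i+j}$.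 $M$ satisfies property $N_{d,p}$ if $\beta_{i,j}(M)=0$ whenever $i\leq p$ and $j\geq d$. For a graph $H$, $G$ is $H$-free if no induced subgraph of $G$ is isomorphic to $H$; for a family $\mathcal F$, $G$ is $\mathcal F$-free if it is $H$-free for all $H\in\mathcal F$. $C_n$ is the cycle on $n$ vertices; $\overline{K_s}$ is the graph on $s$ vertices with no edges. A bipartite graph with bipartition $U\sqcup W$ is elementary if $|U|=|W|$ and every subset $\emptyset\subsetneq U'\subsetneq U$ has more than $|U'|$ vertices adjacent to some vertex of $U'$. $\mathcal F_{q,1}$ is the collection of graphs $H\neq\overline{K_{q+1}}$ such that $V(H)$ is not a union of $q$ cliques of $H$, but every proper subset of $V(H)$ is a union of $q$ cliques. $\mathcal F_{q,2}$ consists of all disjoint unions $H\sqcup\overline{K_{q-j}}$ with $1\leq j\leq q$ and $H$ an elementary bipartite graph on $2j+2$ vertices. $G$ is $q$-secant chordal if it is $\mathcal F_{q,1}$-free, $\mathcal F_{q,2}$-free, and $C_{2q+p}$-free for all $p\geq3$. *)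

(* Defs.v *)
(* [mpoly] comes first because it also defines [symmetric]. *)
From mathcomp Require Import mpoly.
From mathcomp Require Import all_boot all_order all_algebra.

Set Implicit Arguments.
Unset Strict Implicit.
Unset Printing Implicit Defensive.

Import GRing.Theory.

Local Open Scope ring_scope.

(** * Simple graphs *)

Record sgraph := SGraph {
  svertex :> finType;
  adj : rel svertex;
  adj_sym : symmetric adj;
  adj_irr : irreflexive adj
}.

Definition iso (G H : sgraph) : Prop :=
  exists f : G -> H, bijective f /\ forall x y, adj (f x) (f y) = adj x y.

Section InducedSubgraph.
Variables (G : sgraph) (A : {set G}).
Let ind_adj : rel {x : G | x \in A} := fun x y => adj (val x) (val y).
Lemma ind_sym : symmetric ind_adj. Proof. by move=> x y; apply: adj_sym. Qed.
Lemma ind_irr : irreflexive ind_adj. Proof. by move=> x; apply: adj_irr. Qed.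
Definition induced : sgraph := SGraph ind_sym ind_irr.
End InducedSubgraph.

Definition graph_free (H G : sgraph) : Prop :=
  forall A : {set G}, ~ iso (induced A) H.

Definition family_free (F : sgraph -> Prop) (G : sgraph) : Prop :=
  forall H, F H -> graph_free H G.

Section Edgeless.
Variable s : nat.
Let e_adj : rel 'I_s := fun _ _ => false.
Lemma edgeless_sym : symmetric e_adj. Proof. by []. Qed.
Lemma edgeless_irr : irreflexive e_adj. Proof. by []. Qed.
Definition edgeless : sgraph := SGraph edgeless_sym edgeless_irr.
End Edgeless.

(* [ordS] is the successor modulo [n]; the condition [i != j] only matters for
   [n = 1]. *)
Section Cycle.
Variable n : nat.
Let c_adj : rel 'I_n :=
  fun i j => (i != j) && ((j == ordS i) || (i == ordS j)).
Lemma cycle_sym : symmetric c_adj.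
Proof. by move=> i j; rewrite /c_adj eq_sym orbC. Qed.
Lemma cycle_irr : irreflexive c_adj.
Proof. by move=> i; rewrite /c_adj eqxx. Qed.
Definition cycle_graph : sgraph := SGraph cycle_sym cycle_irr.
End Cycle.

Section DisjointUnion.
Variables G H : sgraph.
Let u_adj : rel (G + H)%type := fun x y =>
  match x, y with
  | inl a, inl b => adj a b
  | inr a, inr b => adj a b
  | _, _ => false
  end.
Lemma gunion_sym : symmetric u_adj.
Proof. by move=> [a|a] [b|b] //=; apply: adj_sym. Qed.
Lemma gunion_irr : irreflexive u_adj.
Proof. by move=> [a|a] /=; apply: adj_irr. Qed.
Definition gunion : sgraph := SGraph gunion_sym gunion_irr.
End DisjointUnion.

(* Vertices of a contraction: [None] is the new vertex, and the other vertices
   are those outside [e]. *)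
Definition contr_vertex (V : finType) (e : {set V}) : finType :=
  option {x : V | x \notin e}.

Section GraphContraction.
Variables (G : sgraph) (e : {set G}).
Let k_adj : rel (contr_vertex e) := fun x y =>
  match x, y with
  | Some a, Some b => adj (val a) (val b)
  | Some a, None | None, Some a => [exists c in e, adj (val a) c]
  | None, None => false
  end.
Lemma gcontract_sym : symmetric k_adj.
Proof. by move=> [a|] [b|] //=; apply: adj_sym. Qed.
Lemma gcontract_irr : irreflexive k_adj.
Proof. by move=> [a|] //=; apply: adj_irr. Qed.
Definition gcontract : sgraph := SGraph gcontract_sym gcontract_irr.
End GraphContraction.

Definition graph_edge (G : sgraph) (e : {set G}) : Prop :=
  exists a b : G, adj a b /\ e = [set a; b].

(** * q-secant chordal graphs *)

Definition clique (G : sgraph) (C : {set G}) : Prop :=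
  {in C &, forall x y, x != y -> adj x y}.

(* The empty set counts as a clique, so this means "at most [q] cliques". *)
Definition union_of_cliques (q : nat) (G : sgraph) (A : {set G}) : Prop :=
  exists C : 'I_q -> {set G},
    (forall i, clique (C i)) /\ A = \bigcup_(i < q) C i.

Definition elementary_bipartite (G : sgraph) : Prop :=
  exists U W : {set G},
    [/\ U :|: W = [set: G] /\ [disjoint U & W],
        {in U &, forall x y, ~~ adj x y} /\ {in W &, forall x y, ~~ adj x y},
        #|U| = #|W| &
        forall U' : {set G}, U' != set0 -> U' \proper U ->
          (#|U'| < #|[set w | [exists u in U', adj u w]]|)%N].

Definition family1 (q : nat) (H : sgraph) : Prop :=
  [/\ ~ iso H (edgeless q.+1),
      ~ union_of_cliques q [set: H] &
      forall A : {set H}, A \proper [set: H] -> union_of_cliques q A].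

Definition family2 (q : nat) (K : sgraph) : Prop :=
  exists (j : nat) (H : sgraph),
    [/\ (1 <= j <= q)%N, elementary_bipartite H, #|H| = (2 * j + 2)%N &
        iso K (gunion H (edgeless (q - j)%N))].

Definition secant_chordal (q : nat) (G : sgraph) : Prop :=
  [/\ family_free (family1 q) G, family_free (family2 q) G &
      forall p : nat, (3 <= p)%N -> graph_free (cycle_graph (2 * q + p)%N) G].

(** * Simplicial complexes, given by their set of faces *)

Definition simplicial_complex (V : finType) (D : {set {set V}}) : Prop :=
  (forall F F' : {set V}, F \in D -> F' \subset F -> F' \in D) /\
  (forall v : V, [set v] \in D).

Definition complex_edge (V : finType) (D : {set {set V}}) (e : {set V}) : Prop :=
  e \in D /\ #|e| = 2%N.

Definition secant (q : nat) (V : finType) (D : {set {set V}}) : {set {set V}} :=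
  [set \bigcup_(i < q) (f : {ffun 'I_q -> {set V}}) i
    | f in [set f : {ffun 'I_q -> {set V}} | [forall i, f i \in D]]].

(* [F :\: e], seen as a set of vertices of the contraction. *)
Definition outside (V : finType) (e F : {set V}) : {set contr_vertex e} :=
  [set Some x | x in [set x : {x : V | x \notin e} | val x \in F]].

Definition contract (V : finType) (D : {set {set V}}) (e : {set V}) :
    {set {set contr_vertex e}} :=
  [set None |: outside e F | F in [set F in D | F :&: e != set0]] :|:
  [set outside e F | F in [set F in D | F :&: e == set0]].

Lemma secant_complex (q : nat) (V : finType) (D : {set {set V}}) :
  (1 <= q)%N -> simplicial_complex D -> simplicial_complex (secant q D).
Proof.
move=> q1 [Dsub Dv]; split=> [F F' /imsetP[f] | v].
  rewrite inE => /forallP fD -> F'F; apply/imsetP.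
  exists [ffun i => f i :&: F'].
    by rewrite inE; apply/forallP=> i; rewrite ffunE (Dsub (f i)) ?subsetIl.
  apply/setP=> x; apply/idP/bigcupP=> [xF' | [i _]]; last first.
    by rewrite ffunE inE => /andP[].
  have /bigcupP[i _ xi] := subsetP F'F x xF'.
  by exists i => //; rewrite ffunE inE xi.
apply/imsetP; exists [ffun => [set v]].
  by rewrite inE; apply/forallP=> i; rewrite ffunE.
apply/setP=> x; apply/idP/bigcupP=> [xv | [i _]]; last by rewrite ffunE.
by exists (Ordinal q1) => //; rewrite ffunE.
Qed.

Lemma contract_complex (V : finType) (D : {set {set V}}) (e : {set V}) :
  simplicial_complex D -> complex_edge D e -> simplicial_complex (contract D e).
Proof.
move=> [Dsub Dv] [eD e2].
have Some_out F x : (Some x \in outside e F) = (val x \in F).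
  by rewrite mem_imset ?inE //; apply: Some_inj.
have None_out F : (None \in outside e F) = false.
  by apply/negP=> /imsetP[].
pose back (A : {set contr_vertex e}) :=
  [set val x | x in [set x : {x | x \notin e} | Some x \in A]].
have in_back A (x : {x | x \notin e}) : (val x \in back A) = (Some x \in A).
  by rewrite mem_imset ?inE //; apply: val_inj.
have backP (A : {set contr_vertex e}) F : A \subset None |: outside e F -> back A \subset F.
  move=> /subsetP AF; apply/subsetP=> _ /imsetP[x + ->]; rewrite inE.
  by move=> /AF; rewrite in_setU1 Some_out.
have back_e (A : {set contr_vertex e}) : back A :&: e = set0.
  apply/setP=> y; rewrite !inE; apply/negP=> /andP[/imsetP[x _ ->]].
  by apply/negP/(valP x).
have noNone (A : {set contr_vertex e}) F : F \in D -> A \subset None |: outside e F -> None \notin A ->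
    A \in contract D e.
  move=> FD AF nA; apply/setUP; right; apply/imsetP; exists (back A).
    by rewrite inE back_e eqxx (Dsub F) ?backP.
  by apply/setP=> -[x|]; rewrite ?Some_out ?in_back // None_out (negPf nA).
split=> [F F' | [x|]].
- case/setUP=> /imsetP[E]; rewrite inE => /andP[ED Ee] -> F'F; last first.
    apply: (noNone _ E) => //; first exact: subset_trans F'F (subsetUr _ _).
    by apply/negP=> /(subsetP F'F); rewrite None_out.
  have [NF'|NF'] := boolP (None \in F'); last exact: (noNone _ E).
  apply/setUP; left; apply/imsetP; exists (back F' :|: (E :&: e)).
    rewrite inE (Dsub E) //= ?subUset ?backP ?subsetIl //.
    by rewrite setIUl back_e set0U -setIA setIid.
  apply/setP=> -[x|]; rewrite in_setU1 ?NF' // Some_out in_setU in_back.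
  by rewrite inE (negPf (valP x)) andbF orbF.
- apply: (noNone _ [set val x]) => //; last by rewrite inE.
  by rewrite sub1set in_setU1 Some_out inE eqxx.
- have [y ye] : exists y, y \in e by apply/set0Pn; rewrite -card_gt0 e2.
  apply/setUP; left; apply/imsetP; exists [set y].
    by rewrite inE Dv; apply/set0Pn; exists y; rewrite !inE eqxx.
  apply/setP=> -[x|]; rewrite in_set1 in_setU1 //= Some_out inE.
  by apply/esym/negP=> /eqP xy; move: (valP x); rewrite xy ye.
Qed.

(** * Stanley-Reisner ideals *)

Section StanleyReisner.
Variables (k : fieldType) (V : finType).

Definition vertex_monomial (W : {set V}) : {mpoly k[#|V|]} :=
  \prod_(v in W) 'X_(enum_rank v).

(* [I(D)]: the ideal generated by the monomials of the nonfaces of [D]. *)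
Definition SR_ideal (D : {set {set V}}) (f : {mpoly k[#|V|]}) : Prop :=
  exists c : {set V} -> {mpoly k[#|V|]},
    f = \sum_(W : {set V} | W \notin D) c W * vertex_monomial W.

End StanleyReisner.

(** * Graded Betti numbers of S/I *)

Section Betti.
Variables (k : fieldType) (n : nat).
Local Notation S := {mpoly k[n]}.

(* A graded free resolution  ... -> F_2 -> F_1 -> F_0 -> S/I -> 0  of the
   S-module S/I for a homogeneous ideal I.  Here
   F_i = \bigoplus_(a < rk i) S(- dg i a), so the a-th basis vector of F_i has
   degree [dg i a]; elements of F_i are row vectors and matrices act on the
   right.  As F_0 is free, F_0 -> S/I is given by lifting to S the images of
   the basis vectors: these are the entries of [aug]. *)
Record graded_free_resolution (I : S -> Prop) := GradedFreeResolution {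
  rk : nat -> nat;
  dg : forall i, 'I_(rk i) -> int;
  aug : 'cV[S]_(rk 0);
  diff : forall i, 'M[S]_(rk i.+1, rk i);
  aug_homog : forall a m, m \in msupp (aug a 0) -> dg a = (mdeg m)%:Z;
  diff_homog : forall i (a : 'I_(rk i.+1)) (b : 'I_(rk i)) m,
    m \in msupp (diff i a b) -> dg a = dg b + (mdeg m)%:Z;
  aug_surj : forall f : S, exists v : 'rV[S]_(rk 0), I ((v *m aug) 0 0 - f);
  aug_exact : forall v : 'rV[S]_(rk 0),
    I ((v *m aug) 0 0) <-> exists w : 'rV[S]_(rk 1), v = w *m diff 0;
  diff_exact : forall i (v : 'rV[S]_(rk i.+1)),
    v *m diff i = 0 <-> exists w : 'rV[S]_(rk i.+2), v = w *m diff i.+1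
}.

Section Tor.
Variables (I : S -> Prop) (F : graded_free_resolution I).

(* F_{i+1} (x)_S k -> F_i (x)_S k, where k = S/(x_0, ..., x_(n-1)) *)
Definition diff_k (i : nat) : 'M[k]_(rk F i.+1, rk F i) :=
  map_mx (mcoeff 0%MM) (diff F i).

(* A matrix whose row space is the degree-t component of F_i (x)_S k. *)
Definition comp_k (i : nat) (t : int) : 'M[k]_(rk F i) :=
  diag_mx (\row_a (dg a == t)%:R).

Definition cycles_k (i : nat) : 'M[k]_(rk F i) :=
  if i is i'.+1 then kermx (diff_k i') else 1%:M.

(* dim_k Tor_i^S(S/I, k)_t = dim_k H_i(F (x)_S k)_t *)
Definition tor_dim (i : nat) (t : int) : nat :=
  (\rank (cycles_k i :&: comp_k i t)%MS - \rank (comp_k i.+1 t *m diff_k i))%N.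

End Tor.

(* [is_betti I i j b] means beta_{i,j}(S/I) = b.  As usual for Tor, any graded
   free resolution may be used to compute it. *)
Definition is_betti (I : S -> Prop) (i j b : nat) : Prop :=
  exists F : graded_free_resolution I, tor_dim F i (i + j)%N%:Z = b.

Definition property_N (d p : nat) (I : S -> Prop) : Prop :=
  forall i j : nat, (i <= p)%N -> (d <= j)%N -> is_betti I i j 0.

End Betti.

(* Main.v *)
From mathcomp Require Import mpoly.
Require Import Defs.
From mathcomp Require Import all_boot all_order all_algebra.
From mathcomp Require Import ring zify.
From Stdlib Require Import ClassicalEpsilon.

(** Part (b).  Contracting an edge [e = ab] takes the images of the faces under
    the quotient map [V -> V/e], and images commute with unions; so the secant
    complex of the contraction is the contraction of the secant complex
    ([secant_contract]).  Write [D] for the [q]-th secant complex.  By Hochster's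
    formula ([is_betti_eq0]), N_{d,p} says that the induced subcomplexes [D_W]
    have no reduced cohomology in degree [j - 1] whenever [#|W| = i + j],
    [i <= p] and [d <= j].  In particular N_{q+1,1} says that minimal nonfaces of
    [D] have at most [q + 1] elements ([min_nonface_card]).  But a set of at most
    [q + 1] vertices that contains [e] is a union of [q] faces, namely [e] and
    [q - 1] vertices ([secant_edge]).  So no minimal nonface contains [e], which
    means that the links of [a] and [b] meet exactly in the link of [e].  Under
    this condition the quotient map is a homotopy equivalence, and cohomology
    that vanishes on the preimage of a set of vertices of [V/e] vanishes on the
    set itself ([contract_cohom]).  The preimage of a set of vertices of [V/e] has at most
    one element more, and this is the homological degree lost from [p] to
    [p - 1].

    Hochster's formula rests on a finite free resolution of [S/I(D)].  Its basis
    consists of the pairs [(F, U)] of disjoint sets with [F] in [D], in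
    homological degree [#|U|]; this is the squarefree part of the Koszul complex
    of the elements [x (x) 1 - 1 (x) x] on [S (x) S/I(D)].  In a fixed multidegree
    it is the cellular chain complex of a cube modulo the cells all of whose
    vertices are nonfaces, and pushing cells towards the top vertex of the cube
    contracts it ([khom_homotopy]).  Modulo the variables it splits into the
    cochain complexes of the [D_W].  Since Betti numbers may be computed from any
    resolution, one also needs the comparison theorem ([tor_vanishes_indep]).

    Part (a) is combinatorial.  Being [q]-secant chordal amounts to three
    conditions on vertex sets: a set without stable subsets of size [q + 1] is
    covered by [q] cliques ([family1_freeP]); no elementary bipartite graph with
    [2j + 2] vertices occurs next to [q - j] isolated vertices
    ([family2_freeP]); and there are no long induced cycles.

    The first condition passes to [G/e] because a minimal set violating it there
    gives two stable sets of size [q + 1] in [G], one through [a] and one through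
    [b], whose symmetric difference would be elementary bipartite ([tight_pair]).

    For the second, let the contracted vertex belong to an elementary bipartite
    subgraph of [G/e], and let [T] be the subgraph of [G] over it.  A minimal
    nonexpanding set through [a] would span a smaller forbidden graph in [G]
    unless it is [a] alone, so [a] and likewise [b] keep just one neighbour on
    the other side ([nbr1_le1], [split_nbr]).  If there is an isolated vertex to
    spare, counting excludes [T] by the first condition ([split_lt]).  If not,
    the edge from [b] to its other neighbour has the same properties as [e]
    ([split_next]); following these edges around shows that [T] is an induced
    cycle with [2q + 3] vertices ([split_cycle]).

    Finally an induced cycle of [G/e] through the new vertex opens up to a cycle
    of the same length or one longer in [G] ([cycle_contract]). *)

Set Implicit Arguments.
Unset Strict Implicit.
Unset Printing Implicit Defensive.

Import GRing.Theory.

(** * Polynomials: homogeneous components and division by a variable *)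

Section MonomialOperators.
Local Open Scope ring_scope.
Variables (k : fieldType) (n : nat).
Local Notation S := {mpoly k[n]}.

Lemma mcoeff_sumX (r : seq 'X_{1..n}) (P : pred 'X_{1..n}) (c : 'X_{1..n} -> k)
    (g : 'X_{1..n} -> 'X_{1..n}) m0 m :
    uniq r -> (m0 \notin r -> c m0 = 0) -> P m0 ->
    (forall m', P m' -> (g m' == m) = (m' == m0)) ->
  (\sum_(m' <- r | P m') c m' *: 'X_[g m'] : S)@_m = c m0.
Proof.
move=> ur c0 P0 gP; rewrite raddf_sum /= big_mkcond /=.
rewrite (eq_bigr (fun m' => if m' == m0 then c m0 else 0)); last first.
  move=> m' _; case: ifP => [Pm' | Pm'].
    by rewrite mcoeffZ mcoeffX gP //; case: eqP => [->|_]; rewrite ?mulr1 ?mulr0.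
  by case: eqP => // mm'; rewrite mm' P0 in Pm'.
have [m0r | m0r] := boolP (m0 \in r).
  by rewrite (bigD1_seq m0) //= eqxx big1 ?addr0 // => i /negPf->.
rewrite c0 // big1_seq // => i /andP[_ ir].
by case: eqP.
Qed.

(** Degrees are integers because the generators of a graded free module may
    have any degree. *)
Definition hcomp (z : int) (p : S) : S :=
  \sum_(m <- msupp p | (mdeg m)%:Z == z) p@_m *: 'X_[m].

Lemma mcoeff_hcomp z p m :
  (hcomp z p)@_m = if (mdeg m)%:Z == z then p@_m else 0.
Proof.
case: ifP => [zm | zm].
  by apply: (@mcoeff_sumX _ _ (fun m => p@_m) id); rewrite ?msupp_uniq //; exact: memN_msupp_eq0.
rewrite raddf_sum big1 //= => m' /eqP zm'; rewrite mcoeffZ mcoeffX.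
by case: eqP => [mm'|]; rewrite ?mulr0 //; case/eqP: zm; rewrite -mm' zm'.
Qed.

Lemma hcomp_supp z p m : m \in msupp (hcomp z p) -> (mdeg m)%:Z = z.
Proof. by rewrite mcoeff_msupp mcoeff_hcomp; case: ifP => [/eqP|]; rewrite ?eqxx. Qed.

Lemma hcomp_id z p :
  (forall m, m \in msupp p -> (mdeg m)%:Z = z) -> hcomp z p = p.
Proof.
move=> hp; apply/mpolyP=> m; rewrite mcoeff_hcomp; case: eqP => // zm.
by apply/esym/memN_msupp_eq0/negP=> /hp.
Qed.

Lemma hcompB z p q : hcomp z (p - q) = hcomp z p - hcomp z q.
Proof.
apply/mpolyP=> m; rewrite mcoeffB !mcoeff_hcomp mcoeffB.
by case: ifP; rewrite ?subr0.
Qed.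

Lemma hcomp_sum z (I : Type) (r : seq I) (F : I -> S) :
  hcomp z (\sum_(i <- r) F i) = \sum_(i <- r) hcomp z (F i).
Proof.
apply: (big_morph (hcomp z)) => [p q|]; apply/mpolyP=> m.
  by rewrite mcoeffD !mcoeff_hcomp mcoeffD; case: ifP; rewrite ?addr0.
by rewrite mcoeff_hcomp mcoeff0 if_same.
Qed.

(** A homogeneous factor only shifts the degrees, so no other component of [p]
    contributes. *)
Lemma hcompM z e p h :
    (forall m, m \in msupp h -> e = (mdeg m)%:Z) ->
  hcomp (z + e) (p * h) = hcomp z p * h.
Proof.
move=> hh; apply/mpolyP=> m; rewrite mcoeff_hcomp.
have suppM (q : S) : m \in msupp (q * h) ->
    exists2 m1, m1 \in msupp q & (mdeg m)%:Z = (mdeg m1)%:Z + e.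
  case/msuppM_le/allpairsP=> [[m1 m2] /= [q1 h2 ->]]; exists m1 => //.
  by rewrite (hh _ h2) mdegD PoszD.
case: eqP => [zm | zm]; last first.
  apply/esym/memN_msupp_eq0/negP=> /suppM[m1 /hcomp_supp m1z mm].
  by apply: zm; rewrite mm m1z.
rewrite -{1}(subrK (hcomp z p) p) mulrDl mcoeffD [X in X + _]memN_msupp_eq0 ?add0r //.
apply/negP=> /suppM[m1 + mm]; rewrite mcoeff_msupp mcoeffB mcoeff_hcomp.
have -> : (mdeg m1)%:Z = z by apply: (addIr e); rewrite -mm zm.
by rewrite eqxx subrr eqxx.
Qed.

(** The quotient of [p] by the variable, where monomials that it does not
    divide are dropped.  It is the only part of the contracting homotopy that is
    not linear over the polynomial ring. *)
Definition divX (i : 'I_n) (p : S) : S :=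
  \sum_(m <- msupp p | m i != 0%N) p@_m *: 'X_[m - U_(i)].

Lemma mcoeff_divX i p m : (divX i p)@_m = p@_(m + U_(i))%MM.
Proof.
apply: (@mcoeff_sumX _ _ (fun m => p@_m) (fun m => (m - U_(i))%MM)).
- exact: msupp_uniq.
- exact: memN_msupp_eq0.
- by rewrite mnmDE mnm1E eqxx addn1.
move=> m'; rewrite -lep1mP => im'; apply/eqP/eqP => [<-|->].
  by rewrite submK.
by rewrite addmK.
Qed.

Lemma divXD i p q : divX i (p + q) = divX i p + divX i q.
Proof. by apply/mpolyP=> m; rewrite mcoeffD !mcoeff_divX mcoeffD. Qed.

Lemma divXN i p : divX i (- p) = - divX i p.
Proof. by apply/mpolyP=> m; rewrite mcoeffN !mcoeff_divX mcoeffN. Qed.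

Lemma divXZ i c p : divX i (c *: p) = c *: divX i p.
Proof. by apply/mpolyP=> m; rewrite mcoeffZ !mcoeff_divX mcoeffZ. Qed.

Lemma divX0 i : divX i 0 = 0.
Proof. by apply/mpolyP=> m; rewrite mcoeff_divX !mcoeff0. Qed.

Lemma divX_sum i (I : Type) (r : seq I) (P : pred I) (F : I -> S) :
  divX i (\sum_(j <- r | P j) F j) = \sum_(j <- r | P j) divX i (F j).
Proof. exact: (big_morph _ (divXD i) (divX0 i)). Qed.

Lemma mcoeffXM m (p : S) q : ('X_[m] * p)@_(m + q)%MM = p@_q.
Proof. by rewrite mulrC mcoeffMX. Qed.

Lemma mcoeffXM0 i (p : S) (m : 'X_{1..n}) : m i = 0%N -> ('X_i * p)@_m = 0.
Proof.
move=> mi; apply/memN_msupp_eq0/negP; rewrite mulrC.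
move/msuppM_le/allpairsP=> [[m1 m2] /= [_ ]].
by rewrite msuppX inE => /eqP-> mm; move: mi; rewrite mm mnmDE mnm1E eqxx addn1.
Qed.

Lemma divXK i p : divX i ('X_i * p) = p.
Proof. by apply/mpolyP=> m; rewrite mcoeff_divX addmC mcoeffXM. Qed.

Lemma divX_mulX i j p : i != j -> divX i ('X_j * p) = 'X_j * divX i p.
Proof.
move=> ij; apply/mpolyP=> m; rewrite mcoeff_divX.
have [mj | mj] := eqVneq (m j) 0%N.
  by rewrite !mcoeffXM0 // mnmDE mnm1E mj (negPf ij).
rewrite -(submK (m := U_(j)) (m' := m)) ?lep1mP // -addmA (addmC U_(j)%MM) addmA.
by rewrite ![(_ + U_(j))%MM]addmC !mcoeffXM mcoeff_divX.
Qed.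

End MonomialOperators.

(** * Signs *)

Section Signs.
Local Open Scope ring_scope.
Variables (V : finType) (r : V -> nat).
Hypothesis r_inj : injective r.

(** The order [r] is a parameter: the endpoints of a contracted edge will have
    to come last. *)
Definition sg (x : V) (U : {set V}) : nat := #|[set y in U | (r y < r x)%N]|.

Lemma sgU1 x y (U : {set V}) :
  y \notin U -> sg x (y |: U) = ((r y < r x) + sg x U)%N.
Proof.
move=> yU; have [yx | yx] := boolP (r y < r x)%N; last first.
  congr #|pred_of_set _|; apply/setP=> z; rewrite !inE.
  by case: (eqVneq z y) => // ->; rewrite (negPf yx) !andbF.
rewrite /sg; have -> : [set z in y |: U | (r z < r x)%N] = y |: [set z in U | (r z < r x)%N].
  by apply/setP=> z; rewrite !inE; case: (eqVneq z y) => // ->; rewrite yx.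
by rewrite cardsU1 inE (negPf yU).
Qed.

Lemma sg_anticomm (R : comPzRingType) x y (U : {set V}) :
    x != y -> x \notin U -> y \notin U ->
  (-1) ^+ sg x U * (-1) ^+ sg y (x |: U)
  = - ((-1) ^+ sg y U * (-1) ^+ sg x (y |: U)) :> R.
Proof.
move=> xy xU yU; rewrite !sgU1 // !exprD mulrCA [_ ^+ sg y U * _]mulrCA.
rewrite [_ ^+ sg x U * _]mulrC.
have := contra_neq (@r_inj x y) xy.
by case: ltngtP => // _ _; rewrite expr0 expr1 mulN1r mul1r ?opprK.
Qed.

Lemma sign_sq (R : pzRingType) i : (-1) ^+ i * (-1) ^+ i = 1 :> R.
Proof. by rewrite -expr2 sqrr_sign. Qed.

(** The order pairs off the terms, so this holds in characteristic 2 as well. *)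
Lemma antisym_sum (R : zmodType) (P : pred V) (a : V -> V -> R) :
    (forall x y, P x -> P y -> x != y -> a x y = - a y x) ->
  \sum_(x | P x) \sum_(y | P y && (y != x)) a x y = 0.
Proof.
move=> anti.
have split x : P x -> \sum_(y | P y && (y != x)) a x y =
    \sum_(y | P y && (r y < r x)%N) a x y
    + \sum_(y | P y && (r x < r y)%N) a x y.
  move=> Px; rewrite (bigID (fun y => r y < r x)%N) /=; congr (_ + _).
    apply: eq_bigl => y; case: (P y) => //=.
    by case: (eqVneq y x) => [->|]; rewrite ?ltnn.
  apply: eq_bigl => y; case: (P y) => //=.
  case: (eqVneq y x) => [->|/(contra_neq (@r_inj y x))]; rewrite ?ltnn //.
  by case: ltngtP.
rewrite (eq_bigr _ split) big_split /=.
rewrite [X in _ + X](exchange_big_dep P) /=; last by move=> x y _ /andP[].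
rewrite -big_split big1 //= => x Px.
rewrite [X in X + _](eq_bigr (fun y => - a y x)) => [|y /andP[Py yx]].
  rewrite sumrN addrC; apply/eqP; rewrite subr_eq0; apply/eqP/eq_bigl => y.
  by rewrite Px.
by apply: anti => //; apply: contraTneq yx => ->; rewrite ltnn.
Qed.

End Signs.

(** * The differential on pairs of sets, and its contraction *)

Section Koszul.
Local Open Scope ring_scope.
Variables (V : finType) (r : V -> nat).
Hypothesis r_inj : injective r.

Section Differential.
Variables (R : comPzRingType) (X : V -> R).

(** The function [f F U] stands for the chain with these coefficients on the
    pairs [(F, U)].  The boundary of [(F, U)] is the alternating sum over [x] in
    [U] of [X x] times [(F, U :\ x)] minus [(x |: F, U :\ x)]; [kstep] and
    [kdiff] collect the contributions to one coefficient.  The weight [X x] is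
    the variable, or zero once the variables have been killed. *)
Definition kstep (x : V) (g : {set V} -> R) (F : {set V}) : R :=
  if x \in F then - g (F :\ x) else X x * g F.

Definition kdiff (f : {set V} -> {set V} -> R) (F U : {set V}) : R :=
  \sum_(x | x \notin U) (-1) ^+ sg r x U * kstep x (f^~ (x |: U)) F.

Lemma kstep_sum x (I : finType) (P : pred I) (a : I -> R)
    (g : I -> {set V} -> R) F :
  kstep x (fun F => \sum_(i | P i) a i * g i F) F
  = \sum_(i | P i) a i * kstep x (g i) F.
Proof.
rewrite /kstep; case: ifP => _; first by rewrite -sumrN; apply: eq_bigr => i _; rewrite mulrN.
by rewrite mulr_sumr; apply: eq_bigr => i _; rewrite mulrCA.
Qed.

Lemma kstepC x y g F : x != y -> kstep x (kstep y g) F = kstep y (kstep x g) F.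
Proof.
move=> xy; rewrite /kstep !inE xy eq_sym xy /=.
by case: (x \in F); case: (y \in F); rewrite ?opprK ?mulrN // ?[_ :\ _ :\ _]setDDl 1?setUC -?setDDl // mulrCA.
Qed.

Lemma kdiffK f F U : kdiff (kdiff f) F U = 0.
Proof.
have -> : kdiff (kdiff f) F U =
    \sum_(x | x \notin U) \sum_(y | (y \notin U) && (y != x))
      (-1) ^+ sg r x U * (-1) ^+ sg r y (x |: U) *
      kstep x (kstep y (f^~ (y |: (x |: U)))) F.
  apply: eq_bigr => x xU; rewrite kstep_sum mulr_sumr.
  apply: eq_big => [y|y _]; first by rewrite in_setU1 negb_or andbC.
  by rewrite mulrA.
apply: (antisym_sum r_inj) => x y xU yU xy.
by rewrite (sg_anticomm r_inj) // mulNr kstepC // setUCA.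
Qed.

(** Only the coefficients at [F' \subset F] matter, hence only faces if [F] is
    a face. *)
Lemma eq_kdiff (f g : {set V} -> {set V} -> R) (F U : {set V}) :
    (forall x, x \notin U -> forall F' : {set V}, F' \subset F ->
       (x \in F -> x \notin F') -> f F' (x |: U) = g F' (x |: U)) ->
  kdiff f F U = kdiff g F U.
Proof.
move=> fg; apply: eq_bigr => x xU; congr (_ * _); rewrite /kstep.
case: ifP => xF; last by rewrite (fg x) // xF.
by rewrite (fg x) ?subsetDl // !inE eqxx.
Qed.

Lemma kdiff_sum (I : finType) (a : I -> R) (g : I -> {set V} -> {set V} -> R) F U :
  kdiff (fun F U => \sum_i a i * g i F U) F U = \sum_i a i * kdiff (g i) F U.
Proof.
rewrite /kdiff (eq_bigr (fun x => \sum_i a i * ((-1) ^+ sg r x U * kstep x ((g i)^~ (x |: U)) F))).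
  by rewrite exchange_big; apply: eq_bigr => i _; rewrite mulr_sumr.
by move=> x _; rewrite kstep_sum mulr_sumr; apply: eq_bigr => i _; rewrite mulrCA.
Qed.

Lemma kdiffD f g F U :
  kdiff (fun F U => f F U + g F U) F U = kdiff f F U + kdiff g F U.
Proof.
rewrite -big_split /=; apply: eq_bigr => x _; rewrite -mulrDr /kstep.
by case: ifP => _; rewrite ?opprD ?mulrDr.
Qed.

Lemma kdiffN f F U : kdiff (fun F U => - f F U) F U = - kdiff f F U.
Proof.
rewrite -sumrN; apply: eq_bigr => x _; rewrite -mulrN /kstep.
by case: ifP => _; rewrite ?mulrN.
Qed.

End Differential.

Lemma rmorph_kdiff (R R' : comPzRingType) (phi : {rmorphism R -> R'}) X f F U :
  phi (kdiff X f F U) = kdiff (phi \o X) (fun F U => phi (f F U)) F U.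
Proof.
rewrite rmorph_sum; apply: eq_bigr => x _; rewrite rmorphM rmorph_sign.
by congr (_ * _); rewrite /kstep; case: ifP => _; rewrite ?rmorphN ?rmorphM.
Qed.

End Koszul.

Section Homotopy.
Local Open Scope ring_scope.
Variables (V : finType) (r : V -> nat) (k : fieldType).
Hypothesis r_inj : injective r.
Local Notation S := {mpoly k[#|V|]}.

Definition var (x : V) : S := 'X_(enum_rank x).
Definition dvar (x : V) (p : S) : S := divX (enum_rank x) p.
Local Notation kd := (kdiff r var).

(** In the direction of [x] each cell of the cube is a vertex below, a vertex
    above or an edge.  The homotopy turns the vertex below into the edge, and
    [kpush] moves it to the vertex above. *)
Definition khom (x : V) (f : {set V} -> {set V} -> S) (F U : {set V}) : S :=
  if x \in U then (-1) ^+ sg r x (U :\ x) * dvar x (f F (U :\ x)) else 0.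

Definition kpush (x : V) (f : {set V} -> {set V} -> S) (F U : {set V}) : S :=
  if x \in U then 0
  else if x \in F then f F U + dvar x (f (F :\ x) U)
  else f F U - var x * dvar x (f F U).

Lemma dvar_sgn x i (p : S) : dvar x ((-1) ^+ i * p) = (-1) ^+ i * dvar x p.
Proof.
have -> : (-1) ^+ i = ((-1) ^+ i)%:MP :> S by rewrite rmorph_sign.
by rewrite !mul_mpolyC /dvar divXZ.
Qed.

Lemma dvar_var x y p : x != y -> dvar x (var y * p) = var y * dvar x p.
Proof. by move=> xy; apply: divX_mulX; rewrite (inj_eq enum_rank_inj). Qed.

Lemma khom_homotopy x f (F U : {set V}) : [disjoint F & U] ->
  kd (khom x f) F U + khom x (kd f) F U = f F U - kpush x f F U.
Proof.
move=> FU; rewrite {2}/khom /kpush.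
have [xU | xU] := boolP (x \in U); last first.
  have -> : kd (khom x f) F U = (-1) ^+ sg r x U * kstep var x ((khom x f)^~ (x |: U)) F.
    rewrite /kdiff (bigD1 x) //= big1 ?addr0 // => y /andP[yU yx].
    by rewrite /kstep /khom in_setU1 eq_sym (negPf yx) (negPf xU) oppr0 mulr0 if_same mulr0.
  rewrite addr0 /kstep /khom in_setU1 eqxx /= setU1K //.
  case: ifP => xF; first by rewrite mulrN mulrA sign_sq mul1r opprD addrA subrr add0r.
  by rewrite mulrCA [(-1) ^+ _ * (_ * _)]mulrA sign_sq mul1r opprB addrCA subrr addr0.
have xF : x \notin F by rewrite (disjointFl FU).
rewrite subr0 {2}/kdiff (bigD1 x) ?setD11 //=.
rewrite {1}/kstep (negPf xF) setD1K // /dvar divXD mulrDr addrCA -/(dvar _ _).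
rewrite dvar_sgn mulrA sign_sq mul1r /dvar divXK.
rewrite -[RHS]addr0; congr (_ + _); rewrite divX_sum mulr_sumr /kdiff.
rewrite [X in _ + X](eq_bigl (fun y => y \notin U)); last first.
  by move=> y; rewrite !inE; case: (eqVneq y x) => [->|]; rewrite ?xU ?andbT //= andbF.
rewrite -big_split big1 //= => y yU.
have yx : x != y by apply: contraNneq yU => <-.
rewrite -/(dvar _ _) dvar_sgn mulrA.
have UE : (y |: U) :\ x = y |: (U :\ x).
  by apply/setP=> z; rewrite !inE; case: (eqVneq z y) => // ->; rewrite eq_sym yx.
have sE : (-1) ^+ sg r x (U :\ x) * (-1) ^+ sg r y (U :\ x)
         = - ((-1) ^+ sg r y U * (-1) ^+ sg r x (y |: U :\ x)) :> S.
  have := @sg_anticomm _ _ r_inj S x y (U :\ x) yx.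
  rewrite setD11 in_setD1 (negPf yU) andbF setD1K // => /(_ isT isT) anti.
  have flip (a b c d : S) : a * b = - (c * d) -> b * b = 1 -> c * c = 1 ->
      a * c = - (b * d).
    move=> ab bb cc; rewrite -[LHS]mulr1 -bb mulrACA ab mulNr mulrACA cc.
    by rewrite mul1r mulrC.
  by apply: flip; rewrite ?sign_sq.
rewrite sE /khom in_setU1 xU orbT UE /kstep; case: ifP => yF.
  by rewrite /dvar divXN; ring.
by rewrite dvar_var //; ring.
Qed.

End Homotopy.

(** * Exactness, and membership in the Stanley-Reisner ideal *)

Section Acyclicity.
Local Open Scope ring_scope.
Variables (V : finType) (r : V -> nat) (k : fieldType).
Hypothesis r_inj : injective r.
Local Notation S := {mpoly k[#|V|]}.
Local Notation var := (@var V k).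
Local Notation dvar := (@dvar V k).
Local Notation kd := (kdiff r var).
Variable D : {set {set V}}.
Hypothesis Dsub : forall F F' : {set V}, F \in D -> F' \subset F -> F' \in D.

Definition cell (i : nat) : {set {set V} * {set V}} :=
  [set p : {set V} * {set V} | [&& p.1 \in D, [disjoint p.1 & p.2] & #|p.2| == i]].

Lemma eq_kd_cell (R : comPzRingType) (X : V -> R)
    (f g : {set V} -> {set V} -> R) i (F U : {set V}) :
    (F, U) \in cell i ->
    (forall F' U', (F', U') \in cell i.+1 -> f F' U' = g F' U') ->
  kdiff r X f F U = kdiff r X g F U.
Proof.
rewrite inE /= => /and3P[FD FU /eqP Ui] fg; apply: eq_kdiff => x xU F' F'F xF'.
apply: fg.
rewrite inE /= (Dsub FD F'F) cardsU1 xU Ui eqxx andbT /= disjoints_subset.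
apply/subsetP=> y yF'; rewrite !inE negb_or.
have yF := subsetP F'F y yF'.
rewrite (disjointFr FU yF) andbT; apply: contraL yF' => /eqP yx.
by rewrite yx xF' // -yx.
Qed.

(** Each push replaces a cycle by a homologous one.  After pushing along every
    vertex no cell with a nonempty edge part is left. *)
Lemma kd_exact i (f : {set V} -> {set V} -> S) :
    (forall F U, (F, U) \in cell i -> kd f F U = 0) ->
  exists g, forall F U, (F, U) \in cell i.+1 -> f F U = kd g F U.
Proof.
move=> cyc.
have push (s : seq V) : exists g, forall F U, (F, U) \in cell i.+1 ->
    has (mem U) s -> f F U = kd g F U.
  elim: s => [|x s [g IH]]; first by exists (fun _ _ => 0).
  pose f' F U := f F U - kd g F U.
  exists (fun F U => g F U + khom r x f' F U) => F U FU.
  have FdU : [disjoint F & U] by move: FU; rewrite inE => /and3P[].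
  have cyc' : khom r x (kd f') F U = 0.
    rewrite /khom; case: ifP => // xU; rewrite /f' kdiffD kdiffN kdiffK // subr0.
    rewrite cyc ?/dvar ?divX0 ?mulr0 //; move: FU; rewrite !inE /= => /and3P[-> FU' /eqP Ui].
    rewrite (disjointWr (subsetDl U [set x]) FU').
    by move: (cardsD1 x U); rewrite xU Ui add1n => -[<-]; rewrite eqxx.
  have := khom_homotopy r_inj x f' FdU; rewrite cyc' addr0 kdiffD => ->.
  case/orP => [xU | sU].
    have -> : kpush x f' F U = 0 by rewrite /kpush (xU : x \in U).
    by rewrite subr0 addrC subrK.
  have f'0 (F' : {set V}) : F' \subset F -> f' F' U = 0.
    move=> F'F; apply/eqP; rewrite subr_eq0 -IH //.
    move: FU; rewrite !inE /= => /and3P[FD FU' ->].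
    by rewrite (Dsub FD) // (disjointWl F'F FU').
  have -> : kpush x f' F U = 0.
    rewrite /kpush f'0 // f'0 ?subsetDl // /dvar divX0 mulr0 addr0 subr0.
    by rewrite !if_same.
  by rewrite subr0 addrC subrK.
have [g gP] := push (enum V); exists g => F U FU; apply: gP => //.
have /card_gt0P[x xU] : (0 < #|U|)%N by move: FU; rewrite inE => /and3P[_ _ /eqP->].
by apply/hasP; exists x; rewrite ?mem_enum.
Qed.

(** In homological degree 0 the same pushes leave, at each face, a polynomial
    in the variables of that face alone. *)
Lemma kd_reduce (f : {set V} -> S) :
  exists g, forall (F : {set V}) x, x \notin F -> dvar x (f F - kd g F set0) = 0.
Proof.
have push (s : seq V) : exists g, forall (F : {set V}) x, x \in s -> x \notin F ->
    dvar x (f F - kd g F set0) = 0.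
  elim: s => [|x s [g IH]]; first by exists (fun _ _ => 0).
  pose f' F (U : {set V}) := f F - kd g F U.
  exists (fun F U => g F U + khom r x f' F U) => F y.
  have -> : f F - kd (fun F U => g F U + khom r x f' F U) F set0
            = kpush x f' F set0.
    have := @khom_homotopy _ _ k r_inj x f' F set0.
    rewrite -setI_eq0 setI0 => /(_ (eqxx _)); rewrite {2}/khom inE addr0 kdiffD => ->.
    by rewrite /f'; ring.
  rewrite /kpush !inE => ys yF.
  have divC a b p : dvar a (dvar b p) = dvar b (dvar a p).
    apply/mpolyP=> m; rewrite /dvar !mcoeff_divX -!addmA.
    by rewrite (addmC (mnm1 _)).
  have IH' (F' : {set V}) : y \in s -> y \notin F' -> dvar y (f' F' set0) = 0 by apply: IH.
  have dvarB a p q : dvar a (p - q) = dvar a p - dvar a q.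
    by rewrite /dvar divXD divXN.
  have dvar0 a : dvar a 0 = 0 by apply: divX0.
  case: ifP => xF.
    have yx : y != x by apply: contraNneq yF => ->.
    rewrite (negPf yx) /= in ys; rewrite /dvar divXD -!/(dvar _ _) divC !IH' //.
      by rewrite dvar0 addr0.
    by rewrite !inE negb_and yF orbT.
  rewrite dvarB; have [->|yx] := eqVneq y x; first by rewrite /dvar divXK subrr.
  by rewrite dvar_var // divC IH' ?dvar0 ?mulr0 ?subrr //; move: ys; rewrite (negPf yx).
have [g gP] := push (enum V); exists g => F x xF; apply: gP => //.
by rewrite mem_enum.
Qed.

Definition msup (m : 'X_{1..#|V|}) : {set V} := [set v | m (enum_rank v) != 0%N].

Definition mset (W : {set V}) : 'X_{1..#|V|} := (\sum_(v in W) U_(enum_rank v))%MM.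

Lemma msetE W v : mset W (enum_rank v) = (v \in W).
Proof.
rewrite mnm_sumE big_mkcond (bigD1 v) //= mnm1E eqxx big1 => [|u uv].
  by rewrite addn0; case: (v \in W).
by rewrite mnm1E (inj_eq enum_rank_inj) (negPf uv) if_same.
Qed.

Lemma vertex_monomialE W : vertex_monomial k W = 'X_[mset W].
Proof. exact: mprodXE. Qed.

Lemma mdeg_mset W : mdeg (mset W) = #|W|.
Proof. by rewrite /mset mdeg_sum -[RHS]sum1_card; apply: eq_bigr => v _; rewrite mdeg1. Qed.

Lemma mset_le W m : (mset W <= m)%MM = (W \subset msup m).
Proof.
apply/mnm_lepP/subsetP => [le v vW | sub i].
  have := le (enum_rank v); rewrite msetE vW inE; by case: (m _).
rewrite -(enum_valK i) msetE; case vW: (_ \in W) => //.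
by have := sub _ vW; rewrite inE lt0n.
Qed.

Lemma msupD m1 m2 : msup (m1 + m2)%MM = msup m1 :|: msup m2.
Proof. by apply/setP=> v; rewrite !inE mnmDE addn_eq0 negb_and. Qed.

Lemma msup_mset W : msup (mset W) = W.
Proof. by apply/setP=> v; rewrite inE msetE; case: (v \in W). Qed.

Lemma SR_idealP (f : S) :
  SR_ideal D f <-> forall m, m \in msupp f -> msup m \notin D.
Proof.
split=> [[c ->] m | supp].
  move/msupp_sum_le/flatten_mapP => [W]; rewrite mem_filter => /andP[WD _].
  move/msuppM_le/allpairsP => [[m1 m2] /= [_ + ->]].
  rewrite vertex_monomialE msuppX inE => /eqP->; rewrite msupD msup_mset.
  by apply: contra WD => /Dsub; apply; apply: subsetUr.
exists (fun W => \sum_(m <- msupp f | msup m == W) f@_m *: 'X_[m - mset W]).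
transitivity (\sum_(m <- msupp f) f@_m *: ('X_[m] : S)); first exact: mpolyE.
rewrite (eq_bigr (fun W => \sum_(m <- msupp f | msup m == W) f@_m *: 'X_[m])).
  rewrite (exchange_big_dep predT) //= big_seq [RHS]big_seq.
  apply: eq_bigr => m mf; rewrite (big_pred1 (msup m)) // => W /=.
  by rewrite eq_sym; case: eqP => [->|]; rewrite ?andbF ?andbT // supp.
move=> W _; rewrite mulr_suml; apply: eq_bigr => m /eqP mW.
by rewrite -scalerAl vertex_monomialE -mpolyXD submK // mset_le mW.
Qed.

Lemma msupp_dvar0 (F : {set V}) (p : S) m :
    (forall x, x \notin F -> dvar x p = 0) -> m \in msupp p ->
  msup m \subset F.
Proof.
move=> pF mp; apply/subsetP=> x; rewrite inE => mx; apply: contraTT mp => xF.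
have := congr1 (mcoeff (m - U_(enum_rank x))%MM) (pF x xF).
by rewrite mcoeff_divX submK ?lep1mP // mcoeff0 mcoeff_msupp => ->; rewrite eqxx.
Qed.

(** The summand of a face [F] consists of monomials with support exactly [F],
    so the summands cannot cancel each other. *)
Lemma reduced_aug (f : {set V} -> S) :
    (forall (F : {set V}) x, x \notin F -> dvar x (f F) = 0) ->
    SR_ideal D (\sum_(F in D) f F * 'X_[mset F]) ->
  forall F, F \in D -> f F = 0.
Proof.
move=> red /SR_idealP suppI F FD; apply/eqP; rewrite -msupp_eq0.
case Ef: (msupp (f F)) => [//|m s]; exfalso.
have mf : m \in msupp (f F) by rewrite Ef inE eqxx.
have supE F' m' : m' \in msupp (f F') -> msup (m' + mset F')%MM = F'.
  move=> m'f; rewrite msupD msup_mset; apply/setUidPr.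
  by apply: msupp_dvar0 m'f; apply: red.
have : (m + mset F)%MM \in msupp (\sum_(F in D) f F * 'X_[mset F]).
  rewrite mcoeff_msupp raddf_sum (bigD1 F) //= [(m + _)%MM]addmC mcoeffMX.
  rewrite big1 ?addr0 -?mcoeff_msupp // => F' /andP[_ F'F].
  apply/memN_msupp_eq0/negP=> /msuppM_le/allpairsP[[m1 m2] /= [m1f]].
  rewrite msuppX inE => /eqP-> mE; move/eqP: F'F; apply.
  by rewrite -(supE _ _ m1f) -mE addmC (supE _ _ mf).
by move/suppI; rewrite (supE _ _ mf) FD.
Qed.

End Acyclicity.

(** * The resolution as matrices *)

Section KoszulResolution.
Local Open Scope ring_scope.
Variables (V : finType) (r : V -> nat) (k : fieldType).
Hypothesis r_inj : injective r.
Variable D : {set {set V}}.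
Hypothesis Dsub : forall F F' : {set V}, F \in D -> F' \subset F -> F' \in D.
Hypothesis D0 : set0 \in D.
Local Notation S := {mpoly k[#|V|]}.
Local Notation var := (@var V k).
Local Notation dvar := (@dvar V k).
Local Notation kd := (kdiff r var).

Section CellVectors.
Variables (R : comPzRingType) (X : V -> R).

Definition cellv i (f : {set V} -> {set V} -> R) : 'rV[R]_#|cell D i| :=
  \row_a f (enum_val a).1 (enum_val a).2.

Definition cell_diff i : 'M[R]_(#|cell D i.+1|, #|cell D i|) :=
  \matrix_(a, b) kdiff r X (fun F U => ((F, U) == enum_val a)%:R)
                       (enum_val b).1 (enum_val b).2.

Lemma eq_cellv i f g :
    (forall F U, (F, U) \in cell D i -> f F U = g F U) <->
  cellv i f = cellv i g.
Proof.
split=> [fg | /rowP fg F U FU].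
  by apply/rowP=> a; rewrite !mxE; apply: fg; rewrite -surjective_pairing enum_valP.
by have := fg (enum_rank_in FU (F, U)); rewrite !mxE enum_rankK_in.
Qed.

Lemma cell_delta i (f : {set V} -> {set V} -> R) F U : (F, U) \in cell D i ->
  f F U = \sum_(a < #|cell D i|) cellv i f 0 a * ((F, U) == enum_val a)%:R.
Proof.
move=> FU; rewrite (bigD1 (enum_rank_in FU (F, U))) //= mxE !enum_rankK_in //.
rewrite eqxx mulr1 big1 ?addr0 // => a /eqP ane; case: eqP => [FUa | _]; rewrite ?mulr0 //.
by case: ane; apply: enum_val_inj; rewrite enum_rankK_in.
Qed.

Lemma cellvP i (v : 'rV[R]_#|cell D i|) : exists f, v = cellv i f.
Proof.
exists (fun F U => \sum_(a < #|cell D i|) v 0 a * ((F, U) == enum_val a)%:R).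
apply/rowP=> b; rewrite mxE -surjective_pairing (bigD1 b) //= eqxx mulr1.
by rewrite big1 ?addr0 // => a ab; rewrite (inj_eq enum_val_inj) eq_sym (negPf ab) mulr0.
Qed.

Lemma cellv_diff i f : cellv i.+1 f *m cell_diff i = cellv i (kdiff r X f).
Proof.
apply/rowP=> b; rewrite !mxE.
have FU : ((enum_val b).1, (enum_val b).2) \in cell D i.
  by rewrite -surjective_pairing enum_valP.
rewrite (eq_kd_cell _ Dsub _ FU (@cell_delta i.+1 f)) kdiff_sum.
by apply: eq_bigr => a _; rewrite !mxE.
Qed.

End CellVectors.

Definition cell_deg i (a : 'I_#|cell D i|) : int :=
  (#|(enum_val a).1| + #|(enum_val a).2|)%:Z.

Definition cell_aug : 'cV[S]_#|cell D 0| := \col_a 'X_[mset (enum_val a).1].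

Lemma cellv_aug f :
  (cellv 0 f *m cell_aug) 0 0 = \sum_(F in D) f F set0 * 'X_[mset F].
Proof.
pose g (p : {set V} * {set V}) : S := f p.1 p.2 * 'X_[mset p.1].
rewrite mxE (eq_bigr (fun a => g (enum_val a))); last by move=> a _; rewrite !mxE.
rewrite -(big_enum_val g) (reindex_onto (fun F => (F, set0)) fst) /=.
  by apply: eq_bigl => F; rewrite !inE /= cards0 -setI_eq0 setI0 !eqxx !andbT.
by case=> F U; rewrite inE /= => /and3P[_ _ /eqP/cards0_eq->].
Qed.

Lemma SR_idealD (f g : S) : SR_ideal D f -> SR_ideal D g -> SR_ideal D (f + g).
Proof.
move=> /(SR_idealP Dsub) f0 /(SR_idealP Dsub) g0; apply/(SR_idealP Dsub) => m.
by move/msuppD_le; rewrite mem_cat => /orP[/f0|/g0].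
Qed.

Lemma SR_idealM (f g : S) : SR_ideal D g -> SR_ideal D (f * g).
Proof.
move=> /(SR_idealP Dsub) g0; apply/(SR_idealP Dsub) => m.
move/msuppM_le/allpairsP => [[m1 m2] /= [_ /g0 m2D ->]]; apply: contra m2D.
by move/Dsub; apply; rewrite msupD subsetUr.
Qed.

Lemma SR_ideal0 : SR_ideal D (0 : S).
Proof. by apply/(SR_idealP Dsub) => m; rewrite msupp0. Qed.

Lemma SR_idealB (f g : S) : SR_ideal D f -> SR_ideal D g -> SR_ideal D (f - g).
Proof. by move=> f0 g0; apply: SR_idealD => //; rewrite -mulN1r; apply: SR_idealM. Qed.

Lemma SR_ideal_sum (I : finType) (P : pred I) (f : I -> S) :
  (forall i, P i -> SR_ideal D (f i)) -> SR_ideal D (\sum_(i | P i) f i).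
Proof. by move=> fI; apply: big_ind => //; [exact: SR_ideal0 | exact: SR_idealD]. Qed.

Lemma SR_ideal_mset (W : {set V}) : W \notin D -> SR_ideal D ('X_[mset W] : S).
Proof.
by move=> WD; apply/(SR_idealP Dsub) => m; rewrite msuppX inE => /eqP->; rewrite msup_mset.
Qed.

Lemma msetU1 x (G : {set V}) : x \notin G -> mset (x |: G) = (U_(enum_rank x) + mset G)%MM.
Proof. by move=> xG; rewrite /mset big_setU1. Qed.

(** The boundary of [(F, [set x])] is mapped to zero if [x |: F] is a face, and
    to the monomial of that nonface otherwise. *)
Lemma aug_kd f : SR_ideal D (\sum_(F in D) kd f F set0 * 'X_[mset F]).
Proof.
rewrite (eq_bigr (fun F => \sum_x kstep var x (f^~ [set x]) F * 'X_[mset F])); last first.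
  move=> F _; rewrite mulr_suml; apply: eq_big => [x|x _]; first by rewrite inE.
  rewrite setU0; congr (_ * _); rewrite [sg _ _ _](_ : _ = 0%N) ?mul1r //.
  by apply/eqP; rewrite cards_eq0; apply/eqP/setP=> y; rewrite !inE.
rewrite exchange_big /=; apply: SR_ideal_sum => x _.
rewrite (bigID (fun F : {set V} => x \in F)) /=.
rewrite (reindex_onto (fun G : {set V} => x |: G) (fun F : {set V} => F :\ x)) /=; last first.
  by move=> F /andP[_ xF]; rewrite setD1K.
rewrite addrC [X in X + _]big_mkcond [X in _ + X]big_mkcond -big_split /=.
apply: SR_ideal_sum => G _; rewrite !inE eqxx /= andbT.
have -> : (((x |: G) :\ x) == G) = (x \notin G).
  by apply/eqP/idP => [<-|/setU1K //]; rewrite !inE eqxx.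
have [xG | xG] := boolP (x \in G); first by rewrite !andbF addr0; exact: SR_ideal0.
rewrite !andbT /kstep (negPf xG) in_setU1 eqxx /= setU1K // msetU1 // mpolyXD.
have [xGD | xGD] := boolP (x |: G \in D).
  rewrite (Dsub xGD (subsetUr _ _)).
  rewrite [X in SR_ideal _ X](_ : _ = 0); first exact: SR_ideal0.
  by rewrite /var; ring.
rewrite addr0; case: ifP => _; last exact: SR_ideal0.
rewrite mulrAC -/(var x) mulrC mulrA; rewrite -/(var x) /var -mulrA -mpolyXD -msetU1 //.
by apply: SR_idealM; exact: SR_ideal_mset.
Qed.

End KoszulResolution.

(** * Comparison of resolutions *)

Lemma dependent_choice (T : nat -> Type) (Q : forall i, T i -> Prop)
    (R : forall i, T i -> T i.+1 -> Prop) (x0 : T 0) :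
    Q 0 x0 -> (forall i x, Q i x -> exists y, Q i.+1 y /\ R i x y) ->
  exists f : forall i, T i, f 0 = x0 /\ forall i, R i (f i) (f i.+1).
Proof.
move=> Q0 step.
pose next i (x : {x : T i | Q i x}) : {y : T i.+1 | Q i.+1 y} :=
  let s := constructive_indefinite_description _ (step i _ (proj2_sig x)) in
  exist _ (proj1_sig s) (proj1 (proj2_sig s)).
pose g := nat_rect (fun i => {x : T i | Q i x}) (exist _ x0 Q0) next.
exists (fun i => proj1_sig (g i)); split=> // i; rewrite /= /next /=.
by case: constructive_indefinite_description => y [].
Qed.

Section Comparison.
Local Open Scope ring_scope.
Variables (k : fieldType) (n : nat).
Local Notation S := {mpoly k[n]}.
Variable I : S -> Prop.

Local Notation aug0 := (mcoeff 0%MM).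

Definition is_cycle (F : graded_free_resolution I) (i : nat) : 'rV[k]_(rk F i) -> Prop :=
  match i with 0 => fun _ => True | i'.+1 => fun z => z *m diff_k F i' = 0 end.

(** This is the meaning of [tor_dim F i t = 0]: see [tor_dim_eq0]. *)
Definition tor_vanishes (F : graded_free_resolution I) (i : nat) (t : int) : Prop :=
  forall z : 'rV[k]_(rk F i), (forall a, z 0 a != 0 -> dg a = t) ->
  is_cycle z -> exists w, z = w *m diff_k F i.

Lemma diff_k_homog (F : graded_free_resolution I) i a b :
  diff_k F i a b != 0 -> dg a = dg b.
Proof.
rewrite mxE -mcoeff_msupp => /(diff_homog (g := F)) ->.
by rewrite mdeg0 addr0.
Qed.

Lemma comp_diff_k (F : graded_free_resolution I) i t :
  comp_k F i.+1 t *m diff_k F i = diff_k F i *m comp_k F i t.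
Proof.
apply/matrixP=> a b; rewrite mul_diag_mx mul_mx_diag [LHS]mxE [RHS]mxE mulrC.
have [->|/diff_k_homog E] := eqVneq (diff_k F i a b) 0; first by rewrite !mul0r.
by congr (_ * _); rewrite !mxE E.
Qed.

Lemma diff_k_diff_k (F : graded_free_resolution I) i :
  diff_k F i.+1 *m diff_k F i = 0.
Proof.
rewrite -map_mxM (_ : _ *m _ = 0) ?map_mx0 //; apply/row_matrixP=> a.
by rewrite row0 rowE mulmxA; apply/diff_exact; exists (delta_mx 0 a).
Qed.

Lemma comp_kP (F : graded_free_resolution I) i t (z : 'rV[k]_(rk F i)) :
  (forall a, z 0 a != 0 -> dg a = t) <-> z *m comp_k F i t = z.
Proof.
split=> [zt | <- a].
  apply/rowP=> a; rewrite mul_mx_diag !mxE.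
  have [->|/zt ->] := eqVneq (z 0 a) 0; first by rewrite mul0r.
  by rewrite eqxx mulr1.
by rewrite mul_mx_diag !mxE mulf_eq0 negb_or => /andP[_]; case: (dg a =P t); rewrite ?eqxx.
Qed.

Lemma sub_comp_k (F : graded_free_resolution I) i t (z : 'rV[k]_(rk F i)) :
  (z <= comp_k F i t)%MS -> z *m comp_k F i t = z.
Proof.
move=> /submxP[w ->]; rewrite -mulmxA; congr (_ *m _); apply/row_matrixP=> a.
rewrite row_mul; apply/comp_kP => b.
rewrite !mxE; have [<-|] := eqVneq a b; last by rewrite mulr0n eqxx.
by rewrite mulr1n; case: (dg a =P t); rewrite ?eqxx.
Qed.

Lemma sub_cycles_k (F : graded_free_resolution I) i (z : 'rV[k]_(rk F i)) :
  (z <= cycles_k F i)%MS <-> is_cycle z.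
Proof.
case: i z => [|i] z /=; first by split=> // _; apply: submx1.
by split=> [/sub_kermxP|/sub_kermxP].
Qed.

Lemma tor_dim_eq0 (F : graded_free_resolution I) i t :
  tor_dim F i t = 0%N <-> tor_vanishes F i t.
Proof.
pose A := (cycles_k F i :&: comp_k F i t)%MS.
pose B := comp_k F i.+1 t *m diff_k F i.
have BA : (B <= A)%MS.
  rewrite sub_capmx /B {2}comp_diff_k submxMl andbT.
  case: i @A @B => [|i] A B /=; first exact: submx1.
  by apply/sub_kermxP; rewrite -mulmxA diff_k_diff_k mulmx0.
have -> : tor_dim F i t = 0%N <-> (A <= B)%MS.
  rewrite /tor_dim -/A -/B; split=> [/eqP | AB].
    by rewrite subn_eq0 (geq_leqif (mxrank_leqif_sup BA)).
  by apply/eqP; rewrite subn_eq0 (geq_leqif (mxrank_leqif_sup BA)).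
split=> [AB z zt zc | vanish].
  have /submxP[w ->] : (z <= B)%MS.
    apply: submx_trans AB; rewrite sub_capmx; apply/andP.
    split; first exact/sub_cycles_k.
    by move/comp_kP: zt => <-; apply: submxMl.
  by exists (w *m comp_k F i.+1 t); rewrite mulmxA.
apply/rV_subP=> z; rewrite sub_capmx => /andP[/sub_cycles_k zc /sub_comp_k zt].
have [w zw] := vanish z (proj2 (comp_kP _ _) zt) zc.
by rewrite -zt zw -mulmxA -comp_diff_k submxMl.
Qed.


Definition homog_mx p q (dr : 'I_p -> int) (dc : 'I_q -> int) (M : 'M[S]_(p, q)) :=
  forall a b m, m \in msupp (M a b) -> dr a = dc b + (mdeg m)%:Z.

(** Taking in each entry the component of the expected degree commutes with
    multiplication by a homogeneous matrix; so lifts through homogeneous maps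
    may be chosen homogeneous. *)
Lemma homog_part p q s (dr : 'I_p -> int) (dq : 'I_q -> int) (ds : 'I_s -> int)
    (Q : 'M[S]_(p, q)) (M : 'M[S]_(q, s)) : homog_mx dq ds M ->
  exists2 Q' : 'M[S]_(p, q), homog_mx dr dq Q' &
    forall a c, (Q' *m M) a c = hcomp (dr a - ds c) ((Q *m M) a c).
Proof.
move=> homM; exists (\matrix_(a, b) hcomp (dr a - dq b) (Q a b)) => [a b m|a c].
  by rewrite mxE => /hcomp_supp->; rewrite addrC subrK.
rewrite !mxE hcomp_sum; apply: eq_bigr => b _; rewrite mxE.
rewrite -(@hcompM _ _ _ (dq b - ds c)) ?addrA ?subrK // => m /homM->.
by rewrite addrAC subrr add0r.
Qed.

Lemma homog_lift p q s (dr : 'I_p -> int) (dq : 'I_q -> int) (ds : 'I_s -> int)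
    (P : 'M[S]_(p, s)) (Q : 'M[S]_(p, q)) (M : 'M[S]_(q, s)) :
    homog_mx dq ds M -> homog_mx dr ds P -> P = Q *m M ->
  exists2 Q' : 'M[S]_(p, q), homog_mx dr dq Q' & P = Q' *m M.
Proof.
move=> homM homP PE; have [Q' homQ' Q'E] := homog_part dr Q homM.
exists Q' => //; apply/matrixP=> a c; rewrite Q'E -PE hcomp_id // => m /homP->.
by rewrite addrAC subrr add0r.
Qed.

Lemma homog_mulmx p q s (dr : 'I_p -> int) (dq : 'I_q -> int) (ds : 'I_s -> int)
    (P : 'M[S]_(p, q)) (Q : 'M[S]_(q, s)) :
  homog_mx dr dq P -> homog_mx dq ds Q -> homog_mx dr ds (P *m Q).
Proof.
move=> homP homQ a c m; rewrite mxE => /msupp_sum_le/flatten_mapP[b _].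
move/msuppM_le/allpairsP => [[m1 m2] /= [/homP-> /homQ-> ->]].
by rewrite mdegD PoszD addrA addrAC.
Qed.

Lemma rows_exist p q (P : 'I_p -> 'rV[S]_q -> Prop) :
  (forall a, exists v, P a v) -> exists M : 'M[S]_(p, q), forall a, P a (row a M).
Proof.
case/fin_all_exists => v vP; exists (\matrix_a v a) => a; by rewrite rowK.
Qed.

Lemma lift_diff (F : graded_free_resolution I) p i (M : 'M[S]_(p, rk F i.+1)) :
  M *m diff F i = 0 -> exists Q, M = Q *m diff F i.+1.
Proof.
move=> M0; have [|Q QE] := @rows_exist p (rk F i.+2) (fun a v => row a M = v *m diff F i.+1).
  by move=> a; apply/diff_exact; rewrite -row_mul M0 row0.
by exists Q; apply/row_matrixP=> a; rewrite row_mul QE.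
Qed.

Lemma diff_diff (F : graded_free_resolution I) i : diff F i.+1 *m diff F i = 0.
Proof.
apply/row_matrixP=> a; rewrite row0 rowE mulmxA.
by apply/diff_exact; exists (delta_mx 0 a).
Qed.

Hypothesis ID : forall f g, I f -> I g -> I (f + g).
Hypothesis IM : forall f g, I g -> I (f * g).
Hypothesis IH : forall z f, I f -> I (hcomp z f).

Lemma lift_aug (F : graded_free_resolution I) p (M : 'M[S]_(p, rk F 0)) :
  (forall a, I ((M *m aug F) a 0)) -> exists Q, M = Q *m diff F 0.
Proof.
move=> M0; have [|Q QE] := @rows_exist p (rk F 1) (fun a v => row a M = v *m diff F 0).
  by move=> a; apply/aug_exact; rewrite -row_mul mxE.
by exists Q; apply/row_matrixP=> a; rewrite row_mul QE.
Qed.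

Lemma ideal_mulmx p q (M : 'M[S]_(p, q)) (v : 'cV[S]_q) :
  (forall b, I (v b 0)) -> I 0 -> forall a, I ((M *m v) a 0).
Proof.
by move=> vI I0 a; rewrite mxE; apply: big_ind => // b _; exact: IM.
Qed.

(** Each step lifts along the exactness of [F], starting with the augmentation.
    The invariant says that the next lift exists. *)
Lemma comparison_map (G F : graded_free_resolution I) :
  exists phi : forall i, 'M[S]_(rk G i, rk F i),
    [/\ forall i, homog_mx (@dg _ _ _ G i) (@dg _ _ _ F i) (phi i),
        forall a, I ((phi 0%N *m aug F - aug G) a 0) &
        forall i, diff G i *m phi i = phi i.+1 *m diff F i].
Proof.
have I0 : I 0.
  have -> : 0 = ((0 : 'rV[S]_(rk F 0)) *m aug F) 0 0 by rewrite mul0mx mxE.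
  by apply/aug_exact; exists 0; rewrite mul0mx.
have homaug (H : graded_free_resolution I) : homog_mx (@dg _ _ _ H 0) (fun _ => 0) (aug H).
  by move=> a b m; rewrite ord1 => /aug_homog->; rewrite add0r.
have homdiff (H : graded_free_resolution I) i :
    homog_mx (@dg _ _ _ H i.+1) (@dg _ _ _ H i) (diff H i).
  by move=> a b m; apply: diff_homog.
have [|Q QI] := @rows_exist (rk G 0) (rk F 0) (fun a v => I ((v *m aug F) 0 0 - aug G a 0)).
  by move=> a; apply: aug_surj.
have [phi0 hom0 phi0E] := homog_part (@dg _ _ _ G 0) Q (homaug F).
have phi0I a : I ((phi0 *m aug F - aug G) a 0).
  rewrite mxE phi0E [X in _ + X]mxE -[aug G a 0](@hcomp_id _ _ (dg a - 0)) -?hcompB.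
    by apply: IH; have := QI a; rewrite -row_mul mxE.
  by move=> m /aug_homog->; rewrite subr0.
have [||phi [phi_0 phiE]] := @dependent_choice (fun i => 'M[S]_(rk G i, rk F i))
  (fun i f => homog_mx (@dg _ _ _ G i) (@dg _ _ _ F i) f /\
     exists Q, diff G i *m f = Q *m diff F i)
  (fun i f g => homog_mx (@dg _ _ _ G i.+1) (@dg _ _ _ F i.+1) g /\
     diff G i *m f = g *m diff F i) phi0.
- split=> //; apply: lift_aug => a; rewrite -mulmxA.
  rewrite -[phi0 *m _](subrK (aug G)) mulmxDr mxE; apply: ID.
    exact: ideal_mulmx.
  have := proj2 (aug_exact (g := G) (row a (diff G 0))).
  by rewrite -row_mul mxE; apply; exists (delta_mx 0 a); rewrite rowE.
- move=> i f [homf [Q' fE]].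
  have [g homg gE] := homog_lift (homdiff F i) (homog_mulmx (homdiff G i) homf) fE.
  exists g; do !split=> //; apply: lift_diff.
  by rewrite -mulmxA -gE mulmxA diff_diff mul0mx.
exists phi; split=> [[|i]|a|i]; rewrite ?phi_0 //; by case: (phiE i).
Qed.

(** The composite of comparison maps [phi : G -> F] and [psi : F -> G] is
    homotopic to the identity of [G], so a cycle of [G] bounds as soon as its
    image in [F] does.  Only [phi] has to preserve degrees, because the vanishing
    for [F] is known in one degree only. *)
Lemma tor_vanishes_indep (F G : graded_free_resolution I) i t :
  tor_vanishes F i t -> tor_vanishes G i t.
Proof.
move=> vanF; have [phi [homphi phi0 phiE]] := comparison_map G F.
have [psi [_ psi0 psiE]] := comparison_map F G.
have I0 : I 0.
  have -> : 0 = ((0 : 'rV[S]_(rk F 0)) *m aug F) 0 0 by rewrite mul0mx mxE.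
  by apply/aug_exact; exists 0; rewrite mul0mx.
pose th i := phi i *m psi i - 1%:M.
have thE j : diff G j *m th j = th j.+1 *m diff G j.
  by rewrite mulmxBr mulmxBl mulmx1 mul1mx mulmxA phiE -mulmxA psiE mulmxA.
have [h0 h0E] : exists h0, th 0%N = h0 *m diff G 0.
  apply: lift_aug => a.
  have -> : th 0%N *m aug G = phi 0%N *m (psi 0%N *m aug G - aug F) + (phi 0%N *m aug F - aug G).
    by rewrite mulmxBl mul1mx mulmxBr mulmxA addrA subrK.
  by rewrite mxE; apply: ID => //; apply: ideal_mulmx.
(* The homotopy; the invariant makes the next lift possible. *)
have [||h [h_0 hE]] := @dependent_choice (fun i => 'M[S]_(rk G i, rk G i.+1))
  (fun i h => diff G i *m (th i - h *m diff G i) = 0)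
  (fun i h h' => th i.+1 = h' *m diff G i.+1 + diff G i *m h) h0.
- by rewrite h0E subrr mulmx0.
- move=> j h hj; have [|h' h'E] := @lift_diff G _ j (th j.+1 - diff G j *m h).
    by rewrite mulmxBl -thE -mulmxA -mulmxBr.
  exists h'; split; last by rewrite -h'E subrK.
  by rewrite -h'E opprB addrCA subrr addr0 mulmxA diff_diff mul0mx.
pose phik : 'M[k]_(rk G i, rk F i) := map_mx aug0 (phi i).
pose psik : 'M[k]_(rk F i, rk G i) := map_mx aug0 (psi i).
have psikE : diff_k F i *m psik = map_mx aug0 (psi i.+1) *m diff_k G i.
  by rewrite -!map_mxM psiE.
move=> z zt zc.
have [w wE] : exists w, z *m phik = w *m diff_k F i.
  apply: vanF => [b|].
    rewrite mxE => zphi; have [a] : exists a, z 0 a * phik a b != 0.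
      apply/existsP; apply: contraNT zphi => /existsPn z0.
      by rewrite big1 // => a _; apply/eqP/negPn.
    rewrite mulf_eq0 negb_or => /andP[/zt <-]; rewrite mxE -mcoeff_msupp => /homphi->.
    by rewrite mdeg0 addr0.
  case: (i) @phik z {zt} zc => [//|j] phik z /= zc.
  by rewrite -mulmxA -map_mxM -phiE map_mxM mulmxA zc mul0mx.
have [u uE] : exists u, z *m map_mx aug0 (th i) = u *m diff_k G i.
  case: (i) z {zt w wE phik psik psikE} zc => [|j] z /= zc.
    by exists (z *m map_mx aug0 (h 0%N)); rewrite -mulmxA -map_mxM h_0 -h0E.
  exists (z *m map_mx aug0 (h j.+1)); rewrite hE map_mxD mulmxDr.
  by rewrite !map_mxM !mulmxA zc mul0mx addr0.
exists (w *m map_mx aug0 (psi i.+1) - u); rewrite mulmxBl -mulmxA -psikE mulmxA -wE -uE.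
by rewrite map_mxB map_mxM map_mx1 mulmxBr mulmx1 mulmxA opprB addrCA subrr addr0.
Qed.

End Comparison.

(** * Hochster's formula *)

Section Hochster.
Local Open Scope ring_scope.
Variables (V : finType) (r : V -> nat) (k : fieldType).
Hypothesis r_inj : injective r.
Variable D : {set {set V}}.
Hypothesis Dsub : forall F F' : {set V}, F \in D -> F' \subset F -> F' \in D.
Hypothesis D0 : set0 \in D.
Local Notation S := {mpoly k[#|V|]}.
Local Notation var := (@var V k).

(** The signs count vertices of [W] outside [F] rather than vertices of [F], as
    they do in the resolution, where [W :\: F] is the second component. *)
Definition cobd (W : {set V}) (c : {set V} -> k) (F : {set V}) : k :=
  \sum_(x in F) (-1) ^+ sg r x (W :\: F) * c (F :\ x).

(** Reduced cohomology in degree [j - 1] of the induced subcomplex on [W]. *)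
Definition cohom_vanishes (W : {set V}) (j : nat) : Prop :=
  forall c : {set V} -> k,
    (forall F, F \in D -> F \subset W -> #|F| = j.+1 -> cobd W c F = 0) ->
  exists c' : {set V} -> k,
    forall F, F \in D -> F \subset W -> #|F| = j -> c F = cobd W c' F.

Lemma cobdK (W : {set V}) (c : {set V} -> k) (F : {set V}) : F \subset W -> cobd W (cobd W c) F = 0.
Proof.
move=> FW.
have -> : cobd W (cobd W c) F = \sum_(x in F) \sum_(y | (y \in F) && (y != x))
    (-1) ^+ sg r x (W :\: F) * (-1) ^+ sg r y (x |: (W :\: F)) * c (F :\ x :\ y).
  apply: eq_bigr => x xF; rewrite mulr_sumr; apply: eq_big => [y|y _].
    by rewrite !inE andbC.
  rewrite mulrA; congr (_ * _ ^+ sg r _ _ * _); apply/setP=> z; rewrite !inE.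
  by case: eqP => [->|] //=; rewrite (subsetP FW).
apply: (antisym_sum r_inj) => x y xF yF xy.
rewrite (sg_anticomm r_inj) // ?inE ?xF ?yF //.
by rewrite mulNr; congr (- (_ * c _)); rewrite !setDDl setUC.
Qed.

Lemma cell_aug_surj (f : S) :
  exists v : 'rV[S]_#|cell D 0|, SR_ideal D ((v *m cell_aug k D) 0 0 - f).
Proof.
exists (cellv D 0 (fun F _ => if F == set0 then f else 0)).
rewrite cellv_aug (bigD1 set0) //= eqxx big1 => [|F /andP[_ /negPf->]]; last first.
  by rewrite mul0r.
rewrite addr0 (_ : mset set0 = 0%MM) ?mpolyX0 ?mulr1 ?subrr; first exact: SR_ideal0.
by rewrite /mset big_set0.
Qed.

Lemma cell_aug_exact (v : 'rV[S]_#|cell D 0|) :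
  SR_ideal D ((v *m cell_aug k D) 0 0) <->
  exists w : 'rV[S]_#|cell D 1|, v = w *m cell_diff r D var 0.
Proof.
split=> [|[w ->]]; last first.
  by have [f ->] := cellvP w; rewrite cellv_diff // cellv_aug; apply: aug_kd.
have [f ->] := cellvP v; rewrite cellv_aug => fI.
have [g gP] := kd_reduce r_inj (f^~ set0); exists (cellv D 1 g).
rewrite cellv_diff //; apply/eq_cellv => F U; rewrite inE /= => /and3P[FD _ /eqP/cards0_eq->].
apply/eqP; rewrite -subr_eq0; apply/eqP; move: F FD.
apply: (@reduced_aug _ _ D Dsub (fun F => f F set0 - kdiff r var g F set0)) => //.
rewrite (eq_bigr (fun F => f F set0 * 'X_[mset F] - kdiff r var g F set0 * 'X_[mset F])).
  by rewrite sumrB; apply: SR_idealB => //; apply: aug_kd.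
by move=> F _; rewrite mulrBl.
Qed.

Lemma cell_diff_exact i (v : 'rV[S]_#|cell D i.+1|) :
  v *m cell_diff r D var i = 0 <->
  exists w : 'rV[S]_#|cell D i.+2|, v = w *m cell_diff r D var i.+1.
Proof.
have z0 j : 0 = cellv D j (fun _ _ => 0 : S) by apply/rowP=> a; rewrite !mxE.
split=> [|[w ->]].
  have [f ->] := cellvP v; rewrite cellv_diff // z0 => /eq_cellv/(kd_exact r_inj Dsub)[g gP].
  by exists (cellv D i.+2 g); rewrite cellv_diff //; apply/eq_cellv.
have [f ->] := cellvP w; rewrite !cellv_diff // z0; apply/eq_cellv => F U _.
exact: kdiffK.
Qed.

Lemma cell_aug_homog (a : 'I_#|cell D 0|) m :
  m \in msupp (cell_aug k D a 0) -> cell_deg a = (mdeg m)%:Z.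
Proof.
rewrite mxE msuppX inE => /eqP->; rewrite mdeg_mset /cell_deg.
have := enum_valP a; rewrite inE => /and3P[_ _ /eqP->].
by rewrite addn0.
Qed.

Lemma cell_diff_homog i (a : 'I_#|cell D i.+1|) (b : 'I_#|cell D i|) m :
  m \in msupp (cell_diff r D var i a b) -> cell_deg a = cell_deg b + (mdeg m)%:Z.
Proof.
rewrite mxE => /msupp_sum_le/flatten_mapP[x]; rewrite mem_filter => /andP[xU _].
have -> : (-1) ^+ sg r x (enum_val b).2 = ((-1) ^+ sg r x (enum_val b).2)%:MP :> S.
  by rewrite rmorph_sign.
rewrite mul_mpolyC => /msuppZ_le; rewrite /kstep /cell_deg.
case: (enum_val b) xU => F U /= xU; case: ifP => xF.
  rewrite (perm_mem (msuppN _)); case: eqP => [<-|] /=; last by rewrite msupp0.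
  rewrite msupp1 inE => /eqP->; rewrite mdeg0 addr0 cardsU1 xU.
  by rewrite (cardsD1 x F) xF; congr Posz; lia.
case: eqP => [<-|] /=; last by rewrite mulr0 msupp0.
rewrite mulr1 msuppX inE => /eqP->; rewrite mdeg1 cardsU1 xU.
by rewrite -PoszD; congr Posz; lia.
Qed.

Definition cell_resolution : graded_free_resolution (@SR_ideal k V D) :=
  GradedFreeResolution cell_aug_homog cell_diff_homog cell_aug_surj
    cell_aug_exact cell_diff_exact.

Lemma diff_k_cell i : diff_k cell_resolution i = cell_diff r D (fun _ => 0 : k) i.
Proof.
apply/matrixP=> a b; rewrite !mxE /=.
rewrite (rmorph_kdiff r (mcoeff 0%MM)) /kdiff.
apply: eq_bigr => x _; congr (_ * _); rewrite /kstep /=.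
case: ifP => _; first by rewrite rmorph_nat.
by rewrite mcoeffX mnm1_eq0 !mul0r.
Qed.

Lemma kdiff_cobd (f : {set V} -> {set V} -> k) (F U : {set V}) :
    [disjoint F & U] ->
  kdiff r (fun _ => 0) f F U
  = - cobd (F :|: U) (fun G => f G ((F :|: U) :\: G)) F.
Proof.
move=> FU; rewrite /kdiff /cobd -sumrN big_mkcond [RHS]big_mkcond /=.
have UE : (F :|: U) :\: F = U.
  by rewrite setDUl setDv set0U; apply/setDidPl; rewrite disjoint_sym.
apply: eq_bigr => x _; rewrite /kstep.
have [xF | xF] := boolP (x \in F); last by rewrite mul0r mulr0 if_same.
rewrite (disjointFr FU xF) /= mulrN UE; congr (- (_ * f _ _)).
apply/setP=> y; rewrite !inE; case: eqP => [->|_] /=; first by rewrite xF.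
by case yF: (y \in F); rewrite ?(disjointFr FU yF).
Qed.

Lemma setUDl_sub (G W : {set V}) : G \subset W -> G :|: W :\: G = W.
Proof.
move=> GW; apply/setP=> y; rewrite !inE; case yG: (y \in G) => //=.
by rewrite (subsetP GW).
Qed.

(** Modulo the variables the differential preserves [F :|: U], so the
    resolution is the direct sum over [W] of cochain complexes with [U = W :\: F].
    Cochains on faces of size [j] sit in homological degree [#|W| - j]. *)
Lemma tor_cell_vanishes i j :
  tor_vanishes cell_resolution i (i + j)%N%:Z <->
  forall W : {set V}, #|W| = (i + j)%N -> cohom_vanishes W j.
Proof.
have cycleE f : is_cycle (F := cell_resolution) (i := i) (cellv D i f) <->
    forall i', i = i'.+1 -> forall F U, (F, U) \in cell D i' -> kdiff r (fun _ => 0) f F U = 0.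
  case: (i) => [|i'] /=; first by split.
  have z0 : 0 = cellv D i' (fun _ _ => 0 : k) by apply/rowP=> a; rewrite !mxE.
  rewrite diff_k_cell cellv_diff // z0; split=> [/eq_cellv E _ [<-] //|E].
  by apply/eq_cellv => F U; apply: E.
split=> [van W cW c cyc | van z zt].
  have fE (F U : {set V}) : [disjoint F & U] ->
      kdiff r (fun _ => 0) (fun F U => if F :|: U == W then c F else 0) F U
      = if F :|: U == W then - cobd W c F else 0.
    move=> FU; rewrite kdiff_cobd //.
    rewrite (_ : cobd _ _ _ = cobd (F :|: U) (fun G => if F :|: U == W then c G else 0) F).
      case: eqP => [-> //|_]; rewrite /cobd big1 ?oppr0 // => x _; exact: mulr0.
    apply: eq_bigr => x xF; congr (_ * _); rewrite setUDl_sub //.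
    by apply: subset_trans (subsetUl _ _); apply: subsetDl.
  have [||w wE] := van (cellv D i (fun F U => if F :|: U == W then c F else 0)).
  - move=> a; rewrite mxE; case: ifP => [/eqP aW _|]; rewrite ?eqxx // /cell_deg /= -cW -aW.
    have := enum_valP a; rewrite inE => /and3P[_ FU _].
    by rewrite cardsU disjoint_setI0 // cards0 subn0.
  - apply/cycleE => i' ii' F U; rewrite inE /= => /and3P[FD FU /eqP cU].
    rewrite fE //; case: eqP => // FUW; rewrite cyc ?oppr0 -?FUW ?subsetUl //.
    have := cW; rewrite -FUW cardsU disjoint_setI0 // cards0 subn0 cU ii'. lia.
  have [g gE] := cellvP w; exists (fun F => - g F (W :\: F)) => F FD FW cF.
  have FWD : [disjoint F & W :\: F] by rewrite -setI_eq0 setIDA setDIl setDv set0I.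
  have FUi : (F, W :\: F) \in cell D i.
    by rewrite inE /= FD FWD /= cardsD (setIidPr FW) cW cF addnK.
  have := wE; rewrite gE diff_k_cell cellv_diff // => /eq_cellv/(_ F _ FUi).
  rewrite setUDl_sub // eqxx kdiff_cobd // setUDl_sub // => ->.
  by rewrite /cobd -sumrN; apply: eq_bigr => x _; rewrite mulrN.
have [f zf] := cellvP z; rewrite {}zf in zt *; rewrite cycleE => cyc.
have f0 (G U' : {set V}) : (G, U') \in cell D i -> #|G| != j -> f G U' = 0.
  move=> GU ncG; apply/eqP; apply: contraNT ncG => fGU.
  have := zt (enum_rank_in GU (G, U')); rewrite mxE enum_rankK_in //= => /(_ fGU).
  rewrite /cell_deg enum_rankK_in //= => -[].
  by move: GU; rewrite inE => /and3P[_ _ /eqP/= ->]; lia.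
have [h hE] : exists h : {set V} -> {set V} -> k, forall W F : {set V},
    F \in D -> F \subset W -> #|W :\: F| = i -> f F (W :\: F) = cobd W (h W) F.
  have /fin_all_exists[h hP] : forall W : {set V}, exists hW : {set V} -> k,
      forall F : {set V}, F \in D -> F \subset W -> #|W :\: F| = i ->
      f F (W :\: F) = cobd W hW F.
    move=> W; have [cW | ncW] := eqVneq #|W| (i + j)%N; last first.
      exists (fun _ => 0) => F FD FW cWF; rewrite /cobd big1 => [|x _]; last exact: mulr0.
      apply: f0; first by rewrite inE /= FD cWF eqxx -setI_eq0 setIDA setDIl setDv set0I eqxx.
      by apply: contraNneq ncW => cF; rewrite -(cardsID F W) (setIidPr FW) cWF cF addnC.
    have [|hW hP] := van W cW (fun F => f F (W :\: F)); last first.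
      exists hW => F FD FW cWF; apply: hP => //.
      by have := cardsID F W; rewrite (setIidPr FW) cWF cW addnC => /addnI.
    move=> F FD FW cF.
    have FWD : [disjoint F & W :\: F] by rewrite -setI_eq0 setIDA setDIl setDv set0I.
    have cWF : #|W :\: F| = (i - 1)%N by rewrite cardsD (setIidPr FW) cW cF; lia.
    have i0 : i = (i - 1).+1.
      by have := subset_leq_card FW; rewrite cW cF; lia.
    have := cyc _ i0 F (W :\: F); rewrite kdiff_cobd // setUDl_sub //.
    by rewrite inE /= FD FWD cWF eqxx => /(_ isT)/eqP; rewrite oppr_eq0 => /eqP.
  by exists h.
exists (cellv D i.+1 (fun F U => - h (F :|: U) F)).
rewrite diff_k_cell cellv_diff //; apply/eq_cellv => F U FUi.
have := FUi; rewrite inE /= => /and3P[FD FU /eqP cU].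
have UE : (F :|: U) :\: F = U.
  by rewrite setDUl setDv set0U; apply/setDidPl; rewrite disjoint_sym.
rewrite kdiff_cobd //.
rewrite (_ : cobd _ _ F = - cobd (F :|: U) (h (F :|: U)) F); last first.
  rewrite /cobd -sumrN; apply: eq_bigr => x xF; rewrite setUDl_sub ?mulrN //.
  by apply: subset_trans (subsetUl _ _); apply: subsetDl.
by rewrite opprK -{1}UE; apply: hE; rewrite ?subsetUl ?UE.
Qed.

Lemma SR_ideal_hcomp z (f : S) : SR_ideal D f -> SR_ideal D (hcomp z f).
Proof.
move=> /(SR_idealP Dsub) fI; apply/(SR_idealP Dsub) => m.
rewrite mcoeff_msupp mcoeff_hcomp; case: ifP => _; rewrite ?eqxx // -mcoeff_msupp.
exact: fI.
Qed.

Theorem is_betti_eq0 i j :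
  is_betti (@SR_ideal k V D) i j 0 <->
  forall W : {set V}, #|W| = (i + j)%N -> cohom_vanishes W j.
Proof.
split=> [[F /tor_dim_eq0 van] | /tor_cell_vanishes van]; last first.
  by exists cell_resolution; apply/tor_dim_eq0.
apply/tor_cell_vanishes; apply: tor_vanishes_indep van.
- by move=> f g; apply: SR_idealD.
- by move=> f g; apply: SR_idealM.
- exact: SR_ideal_hcomp.
Qed.

End Hochster.

(** * Contraction as an image under the quotient map *)

Section ContractionMap.
Variables (V : finType) (e : {set V}).

(** The quotient map; [insub] is [None] exactly on [e]. *)
Definition cproj (v : V) : contr_vertex e := insub v.

Lemma cproj_None v : (cproj v == None) = (v \in e).
Proof. by rewrite /cproj; case: insubP => [u /negPf-> _|/negPn->]. Qed.

Lemma cproj_Some (x : {x : V | x \notin e}) : cproj (val x) = Some x.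
Proof. exact: valK. Qed.

Lemma cproj_eq v w : v \notin e -> (cproj v == cproj w) = (v == w).
Proof.
move=> ve; have [we | we] := boolP (w \in e).
  have /eqP-> : cproj w == None by rewrite cproj_None.
  by rewrite cproj_None (negPf ve); apply/esym/negbTE; apply: contraNneq ve => ->.
have pv := cproj_Some (exist (fun x => x \notin e) v ve).
have pw := cproj_Some (exist (fun x => x \notin e) w we).
by rewrite /= in pv pw; rewrite pv pw.
Qed.

Lemma mem_cproj (F : {set V}) v : v \notin e -> (cproj v \in cproj @: F) = (v \in F).
Proof.
move=> ve; apply/imsetP/idP => [[w wF /eqP]|vF]; last by exists v.
by rewrite cproj_eq // => /eqP->.
Qed.

Lemma None_cproj (F : {set V}) : (None \in cproj @: F) = (F :&: e != set0).
Proof.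
apply/imsetP/set0Pn => [[v vF /esym/eqP]|[v]].
  by rewrite cproj_None => ve; exists v; rewrite inE vF.
by rewrite inE => /andP[vF]; rewrite -cproj_None => /eqP <-; exists v.
Qed.

Lemma contractE (D : {set {set V}}) :
  contract D e = [set cproj @: F | F : {set V} in D].
Proof.
have imE (F : {set V}) :
    cproj @: F = if F :&: e != set0 then None |: outside e F else outside e F.
  have Some_out x : (Some x \in outside e F) = (val x \in F).
    by rewrite mem_imset ?inE //; apply: Some_inj.
  have None_out : (None \in outside e F) = false by apply/negP=> /imsetP[].
  apply/setP=> -[x|].
    rewrite -cproj_Some mem_cproj ?(valP x) // cproj_Some.
    by case: ifP; rewrite ?in_setU1 Some_out.
  by rewrite None_cproj; case: ifP; rewrite ?in_setU1 ?None_out.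
apply/setP=> A; apply/setUP/imsetP => [[|]/imsetP[F]|[F FD ->]].
- by rewrite inE => /andP[FD Fe] ->; exists F; rewrite // imE Fe.
- by rewrite inE => /andP[FD Fe] ->; exists F; rewrite // imE Fe.
- rewrite imE; case: ifP => Fe; [left | right]; apply/imsetP; exists F => //.
    by rewrite inE FD.
  by rewrite inE FD -[_ == _]negbK Fe.
Qed.

(** Both operations take images of faces, and images commute with unions. *)
Lemma secant_contract q (D : {set {set V}}) :
  secant q (contract D e) = contract (secant q D) e.
Proof.
rewrite !contractE; apply/setP=> A; apply/imsetP/imsetP => [[f]|[F /imsetP[f]]].
  rewrite inE => /forallP fD ->.
  have /fin_all_exists[g gP] : forall i, exists F : {set V}, F \in D /\ f i = cproj @: F.
    by move=> i; have /imsetP[F FD ->] := fD i; exists F.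
  exists (\bigcup_(i < q) [ffun i => g i] i).
    apply/imsetP; exists [ffun i => g i] => //.
    by rewrite inE; apply/forallP=> i; rewrite ffunE; case: (gP i).
  apply/setP=> y; apply/bigcupP/imsetP => [[i _]|[v /bigcupP[i _]]].
    case: (gP i) => _ -> /imsetP[v vg ->]; exists v => //.
    by apply/bigcupP; exists i; rewrite ?ffunE.
  by rewrite ffunE => vg ->; exists i; rewrite // (gP i).2 imset_f.
rewrite inE => /forallP fD -> ->; exists [ffun i => cproj @: f i].
  by rewrite inE; apply/forallP=> i; rewrite ffunE imset_f.
apply/setP=> y; apply/imsetP/bigcupP => [[v /bigcupP[i _ vf] ->]|[i _]].
  by exists i; rewrite // ffunE imset_f.
by rewrite ffunE => /imsetP[v vf ->]; exists v => //; apply/bigcupP; exists i.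
Qed.

End ContractionMap.

(** * Cohomology of a contraction under the link condition *)

Section ContractionCohomology.
Local Open Scope ring_scope.
Variables (k : fieldType) (V : finType) (a b : V).
Hypothesis ab : a != b.
Local Notation e := [set a; b].
Local Notation p := (cproj e).

(** The endpoints of the edge come last, so that they do not influence the
    signs attached to the other vertices. *)
Definition edge_rank (v : V) : nat :=
  if v == a then #|V| else if v == b then #|V|.+1 else enum_rank v.

Definition contr_rank (y : contr_vertex e) : nat :=
  if y is Some x then enum_rank (val x) else #|V|.

Local Notation r := edge_rank.
Local Notation r' := contr_rank.

Lemma edge_rank_inj : injective r.
Proof.
move=> u v; rewrite /r.
have un : (enum_rank u < #|V|)%N := ltn_ord _.
have vn : (enum_rank v < #|V|)%N := ltn_ord _.
case: (u =P a) => ua; case: (v =P a) => va; case: (u =P b) => ub;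
  case: (v =P b) => vb E; try congruence; try lia.
by apply/enum_rank_inj/val_inj.
Qed.

Lemma contr_rank_inj : injective r'.
Proof.
move=> [x|] [y|] //= rxy.
- by congr Some; apply/val_inj/enum_rank_inj/val_inj.
- by have := ltn_ord (enum_rank (val x)); rewrite rxy ltnn.
- by have := ltn_ord (enum_rank (val y)); rewrite -rxy ltnn.
Qed.

Lemma edge_rankE v : v != b -> r v = r' (p v).
Proof.
rewrite /r => vb; case: (eqVneq v a) => [->|va].
  by have /eqP-> : p a == None by rewrite cproj_None set21.
have ve : v \notin e by rewrite !inE negb_or va vb.
by have /= -> := cproj_Some (exist (fun x => x \notin e) v ve); rewrite (negPf vb).
Qed.

Lemma edge_rank_e v : (v \in e) = (#|V| <= r v)%N.
Proof.
rewrite !inE /r; case: (v == a); rewrite ?leqnn //; case: (v == b); rewrite ?leqnSn //=.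
by rewrite leqNgt ltn_ord.
Qed.

Lemma contr_rank_le y : (r' y <= #|V|)%N.
Proof. by case: y => //= x; apply/ltnW/ltn_ord. Qed.

Section OneSet.
Variable W' : {set contr_vertex e}.
Definition cpre : {set V} := p @^-1: W'.
Local Notation W := cpre.

Lemma cpre_ab : (a \in W) = (b \in W).
Proof.
have /eqP pa : p a == None by rewrite cproj_None set21.
have /eqP pb : p b == None by rewrite cproj_None set22.
by rewrite !inE pa pb.
Qed.

Lemma sg_cproj x (F : {set V}) : x != b ->
  sg r x (W :\: F) = sg r' (p x) (W' :\: p @: F).
Proof.
move=> xb; rewrite /sg.
have outP y : (r y < r x)%N -> y \notin e.
  rewrite (edge_rankE xb) edge_rank_e -ltnNge => yx.
  exact: leq_trans yx (contr_rank_le _).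
rewrite -(card_in_imset (f := p)) => [|y z]; last first.
  by rewrite !inE => /andP[_ /outP ye] _ /eqP; rewrite cproj_eq // => /eqP.
congr #|pred_of_set _|; apply/setP=> z; apply/imsetP/idP => [[y]|].
  rewrite !inE => /andP[/andP[yF yW] yx] ->.
  have ye := outP _ yx.
  rewrite mem_cproj // yF yW -(edge_rankE xb) -edge_rankE //.
  by apply: contraNneq ye => ->; rewrite set22.
case: z => [y|]; last by rewrite inE ltnNge contr_rank_le andbF.
rewrite -(cproj_Some y); have ye := valP y; rewrite inE in_setD mem_cproj // => /andP[/andP[yF yW] yx].
exists (val y); rewrite // !inE yF yW.
rewrite (edge_rankE xb) edge_rankE //.
by apply: contraNneq ye => ->; rewrite set22.
Qed.

Lemma sg_b (F : {set V}) : b \in F -> F \subset W ->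
  sg r b (W :\: F) = ((a \notin F) + sg r' (p b) (W' :\: p @: F))%N.
Proof.
move=> bF FW; have aW : a \in W by rewrite cpre_ab (subsetP FW).
have /eqP pa : p a == None by rewrite cproj_None set21.
have /eqP pb : p b == None by rewrite cproj_None set22.
have ra : r a = #|V| by rewrite /r eqxx.
have rb : r b = #|V|.+1 by rewrite /r eq_sym (negPf ab) eqxx.
rewrite pb -pa -sg_cproj // /sg (cardsD1 a) in_set in_setD ra rb leqnn aW !andbT.
congr (_ + #|pred_of_set _|)%N; apply/setP=> y; rewrite in_setD1 !in_set.
have [->|ya] := eqVneq y a; first by rewrite ra ltnn !andbF.
have [->|yb] := eqVneq y b; first by rewrite bF.
have := edge_rank_e y; rewrite !inE (negPf ya) (negPf yb) => /esym/negbT.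
by rewrite -ltnNge => ry; rewrite ry ltnS (ltnW ry).
Qed.

(** The vertex [b] comes one place after [a], which costs a sign when it stands
    for the new vertex. *)
Definition twist (F : {set V}) : k := if b \in F then -1 else 1.

Lemma cproj_inj_in (F : {set V}) : ~~ (e \subset F) -> {in F &, injective p}.
Proof.
move=> eF x y xF yF /eqP; have [xe | xe] := boolP (x \in e); last first.
  by rewrite cproj_eq // => /eqP.
have [ye _ | ye] := boolP (y \in e); last by rewrite eq_sym cproj_eq // => /eqP.
move: xe ye eF; rewrite !inE subUset !sub1set.
by case/orP=> /eqP Ex; case/orP=> /eqP Ey; rewrite -?Ex -?Ey ?xF ?yF ?Ex ?Ey.
Qed.

(** Away from the faces containing [e], pulling back along the quotient map
    commutes with the coboundary up to the twist. *)
Lemma cobd_twist (c : {set contr_vertex e} -> k) (c1 : {set V} -> k) (F : {set V}) :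
    F \subset W -> ~~ (e \subset F) ->
    (forall x, x \in F -> c1 (F :\ x) = twist (F :\ x) * c (p @: (F :\ x))) ->
  cobd r W c1 F = twist F * cobd r' W' c (p @: F).
Proof.
move=> FW eF c1E; have pinj := cproj_inj_in eF.
rewrite /cobd big_imset //= mulr_sumr; apply: eq_bigr => x xF.
have -> : (p @: F) :\ p x = p @: (F :\ x).
  apply/setP=> y; rewrite in_setD1; apply/andP/imsetP => [[yx /imsetP[z zF yz]]|[z]].
    by exists z => //; rewrite in_setD1 zF andbT; apply: contraNneq yx => <-; rewrite yz.
  rewrite in_setD1 => /andP[zx zF] ->; split; last exact: imset_f.
  by apply: contraNneq zx => /pinj->.
rewrite c1E // !mulrA; congr (_ * _); have [xb | xb] := eqVneq x b; last first.
  by rewrite sg_cproj // /twist in_setD1 eq_sym xb /= mulrC.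
rewrite {}xb in xF *; have aF : a \notin F by move: eF; rewrite subUset !sub1set xF andbT.
by rewrite sg_b // aF /twist setD11 xF mulr1 exprS.
Qed.

Lemma imset_cpre (F : {set V}) : (p @: F \subset W') = (F \subset W).
Proof. exact: sub_imset_pre. Qed.

Variable D : {set {set V}}.
Hypothesis Dsub : forall F F' : {set V}, F \in D -> F' \subset F -> F' \in D.
Hypothesis link : forall G : {set V}, a |: G \in D -> b |: G \in D -> a |: (b |: G) \in D.

(** Pull a cocycle [c] back to a cocycle [c1] that vanishes on the faces
    containing [e], and write it as the coboundary of [y].  Subtracting the
    coboundary of a suitable [u] makes [y] vanish on these faces too; the cocycle
    condition there then says that the values at [a |: G] and [b |: G] agree up
    to sign, so [y'] descends to a cochain [y''] of the contraction.  The link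
    condition makes the values comparable whenever both [a |: G] and [b |: G] are
    faces. *)
Lemma contract_cohom j :
  cohom_vanishes r k D W j -> cohom_vanishes r' k (contract D e) W' j.
Proof.
move=> van c cyc.
have contr F : F \in D -> p @: F \in contract D e.
  by move=> FD; rewrite contractE imset_f.
pose c1 (F : {set V}) := if e \subset F then 0 else twist F * c (p @: F).
have e_abs (F : {set V}) x : x \notin e -> (e \subset F :\ x) = (e \subset F).
  by move=> xe; rewrite subsetD1 xe andbT.
have eE (F : {set V}) : (e \subset F) = (a \in F) && (b \in F).
  by rewrite subUset !sub1set.
have Da x : x != a -> x != b -> x \notin e by rewrite !inE negb_or => -> ->.
(* On a face containing the edge only the removals of [a] and [b] can leave
   a face without the edge. *)
have cobd_edge (c2 : {set V} -> k) (F : {set V}) : F \subset W -> e \subset F ->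
    (forall x, x \in F -> x != a -> x != b -> c2 (F :\ x) = 0) ->
    cobd r W c2 F = (-1) ^+ sg r a (W :\: F) * (c2 (F :\ a) + c2 (F :\ b)).
  move=> FW eF c20; have /andP[aF bF] : (a \in F) && (b \in F) by rewrite -eE.
  rewrite /cobd (bigD1 a) //= (bigD1 b) /= ?bF ?(eq_sym b) // big1 ?addr0; last first.
    by move=> x /andP[/andP[xF xa] xb]; rewrite c20 ?mulr0.
  rewrite sg_b // aF add0n mulrDr; congr (_ + _ ^+ _ * _).
  have /eqP pb : p b == None by rewrite cproj_None set22.
  have /eqP pa : p a == None by rewrite cproj_None set21.
  by rewrite sg_cproj // pa pb.
have [y yE] : exists y, forall F, F \in D -> F \subset W -> #|F| = j -> c1 F = cobd r W y F.
  apply: van => F FD FW cF; have [eF | eF] := boolP (e \subset F).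
    rewrite cobd_edge //; last by move=> x xF xa xb; rewrite /c1 e_abs ?Da // eF.
    have /andP[aF bF] : (a \in F) && (b \in F) by rewrite -eE.
    have /eqP pb : p b == None by rewrite cproj_None set22.
    have /eqP pa : p a == None by rewrite cproj_None set21.
    have pE : p @: (F :\ a) = p @: (F :\ b).
      transitivity (p @: (b |: (F :\ a :\ b))); first by rewrite setD1K // !inE eq_sym ab.
      have -> : F :\ a :\ b = F :\ b :\ a by rewrite setDDl setUC -setDDl.
      by rewrite imsetU1 pb -pa -imsetU1 setD1K // !inE ab aF.
    by rewrite /c1 !eE !inE !eqxx /= andbF pE /twist !inE bF eq_sym ab eqxx mul1r mulN1r addNr mulr0.
  rewrite (@cobd_twist c) //.
    rewrite cyc ?mulr0 ?contr ?imset_cpre //.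
    by rewrite card_in_imset //; apply: cproj_inj_in.
  move=> x xF; rewrite /c1 ifN //; apply: contra eF => /subset_trans; apply.
  exact: subsetDl.
(* Among the sets obtained from a face containing [e] by removing one vertex,
   [u] is nonzero only where [a] has been removed. *)
pose u (G : {set V}) := if (b \in G) && (a \notin G)
  then (-1) ^+ sg r a (W :\: (a |: G)) * y (a |: G) else 0.
pose y' G := y G - cobd r W u G.
have y'0 (F : {set V}) : F \subset W -> e \subset F -> y' F = 0.
  move=> FW eF; have /andP[aF bF] : (a \in F) && (b \in F) by rewrite -eE.
  rewrite /y' cobd_edge //; last first.
    move=> x xF xa xb; rewrite /u (_ : a \in F :\ x) ?andbF //.
    by rewrite !inE aF eq_sym xa.
  rewrite /u !inE bF eq_sym ab eqxx /= !eqxx /= setD1K // addr0.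
  by rewrite mulrA sign_sq mul1r subrr.
have y'E (F : {set V}) : F \in D -> F \subset W -> #|F| = j -> c1 F = cobd r W y' F.
  move=> FD FW cF; rewrite yE // -[LHS]subr0 -(cobdK edge_rank_inj u FW).
  by rewrite /cobd -sumrB; apply: eq_bigr => x _; rewrite -mulrBr.
have swap (F : {set V}) : F \in D -> F \subset W -> #|F| = j -> e \subset F -> y' (F :\ a) = - y' (F :\ b).
  move=> FD FW cF eF; have := y'E F FD FW cF; rewrite /c1 eF cobd_edge //; last first.
    move=> x xF xa xb; apply: y'0; last by rewrite e_abs ?Da.
    exact: subset_trans (subsetDl _ _) FW.
  move/esym/eqP; rewrite mulf_eq0 signr_eq0 /= addr_eq0 => /eqP //.
pose lift (G' : {set contr_vertex e}) : {set V} := [set v | (v \notin e) && (p v \in G')].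
(* The new vertex is represented by [a] if possible, and otherwise by [b]. *)
pose y'' (G' : {set contr_vertex e}) :=
  if None \in G' then if a |: lift G' \in D then y' (a |: lift G') else - y' (b |: lift G')
  else y' (lift G').
have liftE (H : {set V}) : lift (p @: H) = H :\: e.
  apply/setP=> v; rewrite !inE -in_set2; case ve: (v \in e) => //=.
  by rewrite mem_cproj ?ve.
have y''E (H : {set V}) : H \in D -> H \subset W -> (#|H|.+1 = j)%N -> ~~ (e \subset H) ->
    y' H = twist H * y'' (p @: H).
  move=> HD HW cH; rewrite eE negb_and /y'' liftE None_cproj => eH.
  have [aH | aH] := boolP (a \in H).
    have bH : b \notin H by move: eH; rewrite aH.
    have -> : H :&: e != set0 by apply/set0Pn; exists a; rewrite inE aH set21.
    have -> : a |: H :\: e = H.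
      apply/setP=> v; rewrite !inE; case: (eqVneq v a) => [->|_] /=; first by rewrite aH.
      by case: (eqVneq v b) => [->|_] //=; rewrite (negPf bH).
    by rewrite HD /twist (negPf bH) mul1r.
  have [bH | bH] := boolP (b \in H); last first.
    have -> : H :&: e = set0.
      apply/setP=> v; rewrite !inE; apply/negP=> /andP[vH /orP[]/eqP vE].
        by rewrite vE (negPf aH) in vH.
      by rewrite vE (negPf bH) in vH.
    rewrite eqxx /= /twist (negPf bH) mul1r; congr y'.
    apply/setP=> v; rewrite !inE; case: eqP => [->|_] /=; first exact: negbTE.
    by case: eqP => [->|_] //=; apply: negbTE.
  have -> : H :&: e != set0 by apply/set0Pn; exists b; rewrite inE bH set22.
  have HE : H :\: e = H :\ b.
    apply/setP=> v; rewrite !inE negb_or; case: (eqVneq v a) => [->|_] //=.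
    by rewrite (negPf aH) andbF.
  rewrite HE setD1K // /twist bH; case: ifP => aHD; last by rewrite mulrNN mul1r.
  have aHD' : a |: H \in D by rewrite -(setD1K bH); apply: link; rewrite ?setD1K.
  have := swap _ aHD'; rewrite setU1K // mulN1r => ->.
  - congr (- y' _); apply/setP=> v; rewrite !inE.
    by case: (eqVneq v a) => [->|_] //=; rewrite ab.
  - by rewrite subUset HW sub1set cpre_ab (subsetP HW).
  - by rewrite cardsU1 aH.
  - by rewrite eE !inE eqxx bH orbT.
exists y'' => F' + F'W cF'; rewrite contractE => /imsetP[F0 F0D F'E].
have [F [FD FE eF]] : exists F : {set V}, [/\ F \in D, F' = p @: F & ~~ (e \subset F)].
  have [eF | eF] := boolP (e \subset F0); last by exists F0.
  exists (F0 :\ b); split; first exact: Dsub F0D (subsetDl _ _).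
    have /andP[aF bF] : (a \in F0) && (b \in F0) by rewrite -eE.
    have /eqP pb : p b == None by rewrite cproj_None set22.
    have /eqP pa : p a == None by rewrite cproj_None set21.
    rewrite F'E -{1}(setD1K bF) imsetU1 pb -pa; apply/setUidPr.
    by rewrite sub1set imset_f // !inE ab.
  by rewrite eE !inE eqxx andbF.
have FW : F \subset W by rewrite -imset_cpre -FE.
have cF : #|F| = j by rewrite -cF' FE card_in_imset //; apply: cproj_inj_in.
have := y'E F FD FW cF; rewrite (@cobd_twist y'') //.
  rewrite /c1 (negPf eF) -FE; apply: mulfI.
  by rewrite /twist; case: ifP; rewrite ?oppr_eq0 oner_eq0.
move=> x xF; apply: y''E.
- exact: Dsub FD (subsetDl _ _).
- exact: subset_trans (subsetDl _ _) FW.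
- by rewrite -cF (cardsD1 x F) xF.
- by apply: contra eF => /subset_trans; apply; apply: subsetDl.
Qed.

End OneSet.
End ContractionCohomology.

(** * Property N under contraction *)

Lemma card_cpre (V : finType) (a b : V) (W' : {set contr_vertex [set a; b]}) :
  a != b -> #|cpre W'| = ((None \in W') + #|W'|)%N.
Proof.
move=> ab; pose p := cproj [set a; b].
have /eqP pb : p b == None by rewrite cproj_None set22.
have /eqP pa : p a == None by rewrite cproj_None set21.
rewrite (cardsD1 b) !inE -/(p b) pb; congr (_ + _)%N.
rewrite -(card_in_imset (f := p)); last first.
  by apply: cproj_inj_in; rewrite subUset !sub1set !inE eqxx andbF.
congr #|pred_of_set _|; apply/setP=> y; apply/imsetP/idP => [[v]|].
  by rewrite !inE => /andP[_ vW ->].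
case: y => [x|] yW'; last by exists a; rewrite ?pa // !inE ab -/(p a) pa.
exists (val x); last by rewrite /p cproj_Some.
rewrite !inE cproj_Some yW' andbT; apply: contraNneq (valP x) => ->.
by rewrite set22.
Qed.

(** One of the [q] faces is [e]; each of the others is a single vertex, with a
    default value in [e] when the vertices run out. *)
Lemma secant_edge q (V : finType) (D : {set {set V}}) (e M : {set V}) :
    simplicial_complex D -> e \in D -> e != set0 -> e \subset M ->
    (#|M| < #|e| + q)%N ->
  M \in secant q D.
Proof.
move=> [_ Dv] eD /set0Pn[a ae] eM cM.
pose s := enum (M :\: e).
have ss : (size s < q)%N.
  by rewrite -cardE; move: cM; rewrite -(cardsID e M) (setIidPr eM) ltn_add2l.
have q0 : (0 < q)%N by apply: leq_trans ss.
apply/imsetP; exists [ffun i : 'I_q => if (i : nat) is i'.+1 then [set nth a s i'] else e].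
  by rewrite inE; apply/forallP=> -[[|i] ?]; rewrite ffunE /=.
apply/setP=> x; apply/idP/bigcupP => [xM | [[[|i] iq] _]]; rewrite ?ffunE /=.
- have [xe | xe] := boolP (x \in e); first by exists (Ordinal q0); rewrite ?ffunE.
  have xs : x \in s by rewrite mem_enum inE xe.
  have xq : ((index x s).+1 < q)%N by apply: leq_ltn_trans ss; rewrite index_mem.
  by exists (Ordinal xq); rewrite // ffunE /= nth_index // inE.
- exact: (subsetP eM).
rewrite inE => /eqP->; have [is_ | is_] := ltnP i (size s).
  by have := mem_nth a is_; rewrite mem_enum inE => /andP[].
by rewrite nth_default // (subsetP eM).
Qed.

Section PropertyN.
Local Open Scope ring_scope.
Variables (k : fieldType) (V : finType) (D : {set {set V}}).
Hypothesis Dc : simplicial_complex D.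
Hypothesis D0 : set0 \in D.

(** A minimal nonface spans the boundary of a simplex, which has cohomology in
    top degree; in Hochster's formula this is a generator of the size of the
    nonface. *)
Lemma min_nonface_card (d p : nat) (M : {set V}) :
    (1 <= d)%N -> (1 <= p)%N -> property_N d p (@SR_ideal k V D) ->
    M \notin D -> (forall x, x \in M -> M :\ x \in D) ->
  (#|M| <= d)%N.
Proof.
move=> d1 p1 ND MD minM; rewrite leqNgt; apply/negP=> cM.
case cME: #|M| cM => [//|j]; rewrite ltnS => dj.
pose r (v : V) : nat := enum_rank v.
have r_inj : injective r by move=> u v /val_inj/enum_rank_inj.
have [a aM] : exists a, a \in M by apply/set0Pn; rewrite -card_gt0 cME.
have [Dsub _] := Dc.
have van : cohom_vanishes r k D M j.
  by move: (ND 1%N j p1 dj) => /(is_betti_eq0 k r_inj Dsub D0); apply.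
have [|c' c'E] := van (fun F => (F == M :\ a)%:R).
  move=> F FD FM cF; case/negP: MD; suff <- : F = M by [].
  by apply/eqP; rewrite eqEcard FM cME cF leqnn.
have := cobdK r_inj c' (subxx M); rewrite {1}/cobd (bigD1 a) //= big1 => [|x /andP[xM xa]].
  rewrite addr0 -c'E ?eqxx ?mulr1 ?minM ?subsetDl //.
    by move/eqP; rewrite signr_eq0.
  by move: cME; rewrite (cardsD1 a) aM => -[].
rewrite -c'E ?minM ?subsetDl //; last by move: cME; rewrite (cardsD1 x) xM => -[].
case: eqP => [/setP/(_ x)|]; last by rewrite mulr0.
by rewrite !inE eqxx xa xM.
Qed.

End PropertyN.

Lemma property_N_contract (q : nat) (k : fieldType) (V : finType)
    (D : {set {set V}}) (p : nat) (e : {set V}) :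
    (1 <= q)%N -> simplicial_complex D -> (1 <= p)%N -> complex_edge D e ->
    property_N q.+1 p (@SR_ideal k V (secant q D)) ->
  property_N q.+1 p.-1 (@SR_ideal k (contr_vertex e) (secant q (contract D e))).
Proof.
move=> q1 Dc p1 [eD /eqP/cards2P[a [b [ab eE]]]] N; rewrite secant_contract.
have Gc := secant_complex q1 Dc; have [Gsub Gv] := Gc.
have G0 : set0 \in secant q D by apply: Gsub (Gv a) (sub0set _).
have ce : #|e| = 2%N by rewrite eE cards2 ab.
have eG : e \in secant q D.
  by apply: secant_edge Dc eD _ _ _; rewrite ?subxx -?card_gt0 ?ce //; lia.
have [Csub Cv] := contract_complex Gc (conj eG ce).
have C0 : set0 \in contract (secant q D) e by apply: Csub (Cv None) (sub0set _).
subst e.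
have link G : a |: G \in secant q D -> b |: G \in secant q D ->
    a |: (b |: G) \in secant q D.
  move=> aG bG; apply/negPn/negP=> abG.
  have [M /minsetP[MG minM] Msub] := minset_exists (P := fun M => M \notin secant q D) abG.
  have in_M x y : x |: (y |: G) = a |: (b |: G) -> y |: G \in secant q D -> x \in M.
    move=> xyE yG; apply: contraR MG => xM; apply: (Gsub _ _ yG).
    apply/subsetP=> z zM; have := subsetP Msub z zM; rewrite -xyE in_setU1.
    by case: eqP => // zx; rewrite -zx zM in xM.
  have aM := in_M a b erefl bG; have bM := in_M b a (setUCA _ _ _) aG.
  have cM : (#|M| <= q.+1)%N.
    apply: (min_nonface_card Gc G0 _ p1 N MG) => // x xM; apply/negPn/negP=> Mx.
    by have /setP/(_ x) := minM _ Mx (subsetDl _ _); rewrite !inE eqxx xM.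
  case/negP: MG; apply: secant_edge Dc eD _ _ _.
  - by apply/set0Pn; exists a; rewrite set21.
  - by rewrite subUset !sub1set aM.
  - by rewrite cards2 ab /=; lia.
move=> i j ip qj; apply/(is_betti_eq0 k (@contr_rank_inj V a b) Csub C0) => W' cW'.
apply: contract_cohom => //.
have van i' : (i' <= p)%N -> forall W : {set V}, #|W| = (i' + j)%N ->
    cohom_vanishes (edge_rank a b) k (secant q D) W j.
  move=> ip'; have := N i' j ip' qj.
  by move/(is_betti_eq0 k (@edge_rank_inj V a b ab) Gsub G0).
have cW := card_cpre W' ab; apply: (van (i + (None \in W'))%N).
  by apply: leq_trans (leq_add ip (leq_b1 _)) _; rewrite addn1 prednK.
by rewrite cW cW' addnAC addnC.
Qed.

(** * Forbidden induced subgraphs as conditions on vertex sets *)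

Definition embedding (H G : sgraph) (g : H -> G) : Prop :=
  injective g /\ forall x y, adj (g x) (g y) = adj x y.

Lemma graph_freeP (H G : sgraph) :
  graph_free H G <-> forall g : H -> G, ~ embedding g.
Proof.
split=> [free g [ginj gadj] | noemb A [f [[h fK hK] fadj]]]; last first.
  apply: (noemb (fun x => val (h x))); split=> [x y /val_inj/(can_inj hK) // | x y].
  by rewrite -{2}[x]hK -{2}[y]hK fadj.
apply: (free (g @: [set: H])).
pose g' (x : H) : induced (g @: [set: H]) := exist _ (g x) (imset_f g (in_setT x)).
have g'inj : injective g' by move=> x y /(congr1 val)/ginj.
have [h gK hK] : bijective g'.
  by apply: inj_card_bij => //; rewrite card_sig card_imset // cardsT.
exists h; split; first by exists g'.
by move=> x y; rewrite -[in RHS](hK x) -[in RHS](hK y) /= gadj.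
Qed.

Definition stable (G : sgraph) (A : {set G}) : Prop := {in A &, forall x y, ~~ adj x y}.

Lemma stableS (G : sgraph) (A B : {set G}) : A \subset B -> stable B -> stable A.
Proof. by move=> /subsetP AB sB x y /AB xB /AB; apply: sB. Qed.

(** Unions of [q] cliques are the faces of its [q]-th secant complex
    ([union_of_cliquesP]), which makes them decidable and lets contraction of
    complexes be used for graphs. *)
Definition clique_complex (G : sgraph) : {set {set G}} :=
  [set C : {set G} | [forall x in C, forall y in C, (x != y) ==> adj x y]].

Lemma clique_complexP (G : sgraph) (C : {set G}) :
  reflect (clique C) (C \in clique_complex G).
Proof.
rewrite inE; apply: (iffP forall_inP) => [cC x y xC yC xy | cC x xC].
  by have /forall_inP/(_ y yC)/implyP := cC x xC; apply.
by apply/forall_inP=> y yC; apply/implyP; apply: cC.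
Qed.

Lemma union_of_cliquesP q (G : sgraph) (A : {set G}) :
  reflect (union_of_cliques q A) (A \in secant q (clique_complex G)).
Proof.
apply: (iffP imsetP) => [[f + ->] | [C [cC ->]]].
  rewrite inE => /forallP fC; exists f; split=> // i.
  exact/clique_complexP.
exists [ffun i => C i]; last by apply: eq_bigr => i _; rewrite ffunE.
by rewrite inE; apply/forallP=> i; rewrite ffunE; apply/clique_complexP.
Qed.

Lemma union_of_cliques_imset q (G H : sgraph) (g : G -> H) (A : {set G}) :
  embedding g -> union_of_cliques q (g @: A) <-> union_of_cliques q A.
Proof.
case=> ginj gadj; split=> -[C [cC AE]].
  exists (fun i => g @^-1: C i); split.
    move=> i x y; rewrite !inE => xC yC xy; rewrite -gadj; apply: (cC i) => //.
    exact: contra_neq (@ginj x y) xy.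
  apply/setP=> x; have /setP/(_ (g x)) := AE; rewrite mem_imset // => ->.
  by apply/bigcupP/bigcupP => -[i _ xi]; exists i; rewrite // ?inE // in xi *.
exists (fun i => g @: C i); split.
  move=> i _ _ /imsetP[x xC ->] /imsetP[y yC ->] xy; rewrite gadj.
  by apply: (cC i) => //; apply: contra_neq xy => ->.
rewrite AE; apply/setP=> y; apply/imsetP/bigcupP => [[x /bigcupP[i _ xC] ->]|[i _]].
  by exists i => //; apply: imset_f.
by case/imsetP=> x xC ->; exists x => //; apply/bigcupP; exists i.
Qed.

Lemma card_clique_stable (G : sgraph) (C I : {set G}) :
  clique C -> stable I -> (#|C :&: I| <= 1)%N.
Proof.
move=> cC sI; apply/card_le1P => x; rewrite inE => /andP[xC xI] y.
rewrite !inE; apply/andP/eqP => [[yC yI]|-> //].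
by apply: contraNeq (sI _ _ yI xI) => yx; apply: cC.
Qed.

Lemma stable_union_of_cliques q (G : sgraph) (A I : {set G}) :
  union_of_cliques q A -> I \subset A -> stable I -> (#|I| <= q)%N.
Proof.
move=> [C [cC AE]] IA sI; rewrite -(setIidPl IA) AE big_distrr /=.
apply: leq_trans (_ : \sum_(i < q) 1 <= q)%N; last by rewrite sum_nat_const card_ord muln1.
apply: leq_trans (_ : \sum_(i < q) #|I :&: C i| <= _)%N.
  elim/big_rec2: _ => [|i n B _ IH]; first by rewrite cards0.
  by apply: leq_trans (leq_add (leqnn _) IH); rewrite cardsU leq_subr.
by apply: leq_sum => i _; rewrite setIC card_clique_stable.
Qed.

(** In terms of the complement: an induced subgraph without a clique of size
    [q + 1] can be coloured with [q] colours. *)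
Definition weakly_perfect q (G : sgraph) : Prop :=
  forall A : {set G}, (forall I : {set G}, I \subset A -> stable I -> (#|I| <= q)%N) ->
  union_of_cliques q A.

Lemma subset_of_card (T : finType) (A : {set T}) n : (n <= #|A|)%N ->
  exists2 B : {set T}, B \subset A & #|B| = n.
Proof.
move=> nA; exists [set x in take n (enum A)].
  by apply/subsetP=> x; rewrite inE => /mem_take; rewrite mem_enum.
by rewrite cardsE (card_uniqP _) ?take_uniq ?enum_uniq // size_takel // -cardE.
Qed.

Lemma not_stableW q (G : sgraph) (A : {set G}) : weakly_perfect q G ->
    ~ union_of_cliques q A ->
  exists I : {set G}, [/\ I \subset A, stable I & #|I| = q.+1].
Proof.
move=> wp nA.
have [/existsP[I /and3P[IA /forall_inP sI /eqP cI]] | /existsPn noI] := boolP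
  [exists I : {set G}, [&& I \subset A, [forall x in I, forall y in I, ~~ adj x y] & #|I| == q.+1]].
  exists I; split=> // x y xI yI.
  by have /forall_inP/(_ y yI) := sI x xI.
case: nA; apply: wp => I IA sI; rewrite leqNgt; apply/negP=> /subset_of_card[J JI cJ].
have /and3P[] := noI J; split; rewrite ?cJ ?(subset_trans JI IA) //.
by apply/forall_inP=> x xJ; apply/forall_inP=> y yJ; apply: (stableS JI sI).
Qed.

Lemma embedding_val (G : sgraph) (A : {set G}) : embedding (val : induced A -> G).
Proof. by split=> //; apply: val_inj. Qed.

Lemma imset_valT (G : sgraph) (A : {set G}) : val @: [set: induced A] = A.
Proof.
apply/setP=> x; apply/imsetP/idP => [[y _ ->]|xA]; first exact: valP.
by exists (exist _ x xA).
Qed.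

Lemma iso_edgeless n (G : sgraph) : #|G| = n -> stable [set: G] -> iso G (edgeless n).
Proof.
move=> cG sG; exists (fun x => cast_ord cG (enum_rank x)); split.
  apply: inj_card_bij; last by rewrite card_ord -cG.
  by move=> x y /cast_ord_inj/enum_rank_inj.
by move=> x y /=; apply/esym/negbTE/sG; rewrite inE.
Qed.

(** A minimal set that violates the covering condition induces a member of the
    first family.  Conversely, a stable set of size [q + 1] in a member of the
    family is a proper subset, so it would be covered by [q] cliques, each
    meeting it at most once. *)
Lemma family1_freeP q (G : sgraph) : family_free (family1 q) G <-> weakly_perfect q G.
Proof.
split=> [free A alpha | wp H [nE nU minH]]; last first.
  apply/graph_freeP => g gE; have [ginj gadj] := gE.
  have [] := @not_stableW q G (g @: [set: H]) wp.
    by move/(union_of_cliques_imset _ _ gE).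
  move=> I [IA sI cI]; pose J := g @^-1: I.
  have IJ : g @: J = I.
    apply/setP=> y; apply/imsetP/idP => [[x]|yI]; first by rewrite inE => xI ->.
    by have /imsetP[x _ yE] := subsetP IA y yI; exists x; rewrite // inE -yE.
  have cJ : #|J| = q.+1 by rewrite -cI -IJ card_imset.
  have sJ : stable J by move=> x y; rewrite !inE -gadj; apply: sI.
  have [JT | JT] := eqVneq J [set: H].
    by apply: nE; apply: iso_edgeless; rewrite -?JT // -cJ JT cardsT.
  have /stable_union_of_cliques/(_ (subxx _) sJ) : union_of_cliques q J.
    by apply: minH; rewrite properT.
  by rewrite cJ ltnn.
apply/union_of_cliquesP/negPn/negP => nA.
have [M /minsetP[nM minM] MA] := minset_exists
  (P := fun M => M \notin secant q (clique_complex G)) nA.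
suff /free/graph_freeP/(_ _ (embedding_val M)) : family1 q (induced M) by []; split.
- move=> [f [[h fK hK] fadj]].
  have : (#|M| <= q)%N.
    apply: alpha => // x y xM yM.
    by have := fadj (exist _ x xM) (exist _ y yM); rewrite /= => <-.
  have := bij_eq_card (Bijective fK hK); rewrite /= card_sig card_ord => ->.
  by rewrite ltnn.
- move/(union_of_cliques_imset _ _ (embedding_val M)); rewrite imset_valT.
  by move/union_of_cliquesP; apply/negP.
move=> A' /properP[_ [x _ xA']]; apply/(union_of_cliques_imset _ _ (embedding_val M)).
apply/union_of_cliquesP/negPn/negP => nA'.
have sub : val @: A' \subset M by apply/subsetP=> _ /imsetP[y _ ->]; apply: valP.
have := minM _ nA' sub => /setP/(_ (val x)); rewrite mem_imset ?(negPf xA'); last exact: val_inj.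
by rewrite (valP x).
Qed.

Definition nbr (G : sgraph) (S W : {set G}) : {set G} :=
  [set w in W | [exists u in S, adj u w]].

Lemma nbrP (G : sgraph) (S W : {set G}) w :
  reflect (w \in W /\ exists2 u, u \in S & adj u w) (w \in nbr S W).
Proof. by rewrite inE; apply: (iffP andP) => -[wW /exists_inP uS]. Qed.

Definition expands (G : sgraph) (U W : {set G}) : Prop :=
  forall S : {set G}, S != set0 -> S \proper U -> (#|S| < #|nbr S W|)%N.

Definition elementary_free q (G : sgraph) : Prop :=
  forall (j : nat) (U W Z : {set G}),
    (1 <= j <= q)%N -> #|U| = j.+1 -> #|W| = j.+1 -> #|Z| = (q - j)%N ->
    [disjoint U & W] -> [disjoint U & Z] -> [disjoint W & Z] ->
    stable (U :|: Z) -> stable (W :|: Z) -> ~ expands U W.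

Lemma family2_freeP q (G : sgraph) : family_free (family2 q) G <-> elementary_free q G.
Proof.
split=> [free j U W Z jq cU cW cZ UW UZ WZ sUZ sWZ expUW | free K [j [H [jq]]]].
  pose H := induced (U :|: W).
  have cH : #|H| = (2 * j + 2)%N.
    by rewrite card_sig cardsU disjoint_setI0 // cards0 cU cW; lia.
  have elemH : elementary_bipartite H.
    exists (val @^-1: U), (val @^-1: W).
    have valE (A : {set G}) : A \subset U :|: W -> val @: (val @^-1: A : {set H}) = A.
      move=> AUW; apply/setP=> x; apply/imsetP/idP => [[y + ->]|xA]; first by rewrite inE.
      by exists (exist _ x (subsetP AUW x xA)); rewrite ?inE.
    have card_val (A : {set H}) : #|val @: A| = #|A| by apply: card_imset; apply: val_inj.
    split.
    - split; first by apply/setP=> x; rewrite !inE; have := valP x; rewrite inE.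
      rewrite -setI_eq0 -preimsetI disjoint_setI0 //.
      by apply/eqP/setP=> x; rewrite !inE.
    - by split=> x y; rewrite !inE => xA yA; [apply: sUZ | apply: sWZ]; rewrite inE ?xA ?yA.
    - by rewrite -card_val valE ?subsetUl // -[RHS]card_val valE ?subsetUr // cU cW.
    move=> S S0 /properP[SU [x xU xS]].
    have sub : nbr (val @: S) W \subset val @: [set w | [exists u in S, adj u w]].
      apply/subsetP=> w /nbrP[wW [_ /imsetP[u uS ->] uw]].
      have wUW : w \in U :|: W by rewrite inE wW orbT.
      apply/imsetP; exists (exist _ w wUW) => //; rewrite inE.
      by apply/exists_inP; exists u.
    rewrite -(card_val S) -[X in (_ < X)%N]card_val.
    apply: leq_trans (subset_leq_card sub); apply: expUW.
      by rewrite -card_gt0 card_val card_gt0.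
    apply/properP; split.
      by apply/subsetP=> _ /imsetP[u uS ->]; have := subsetP SU u uS; rewrite inE.
    exists (val x); first by rewrite inE in xU.
    by rewrite mem_imset //; apply: val_inj.
  pose g (y : gunion H (edgeless (q - j))) : G :=
    match y with inl x => val x | inr i => enum_val (cast_ord (esym cZ) i) end.
  have gZ i : g (inr i) \in Z by apply: enum_valP.
  have gUW x : g (inl x) \notin Z.
    apply/negP=> xZ; have := valP x; rewrite inE => /orP[xU | xW].
      by rewrite (disjointFr UZ xU) in xZ.
    by rewrite (disjointFr WZ xW) in xZ.
  have nZ x i : ~~ adj (g (inl x)) (g (inr i)).
    have := valP x; rewrite inE => /orP[xU | xW]; [apply: sUZ | apply: sWZ];
      by rewrite inE ?gZ ?orbT // ?xU ?xW.
  have /free/graph_freeP/(_ g) : family2 q (gunion H (edgeless (q - j))).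
    exists j, H; split=> //; exists id; split=> //; exact: inv_bij.
  apply.
  split=> [[x|i] [y|i'] | [x|i] [y|i']] //=.
  - by move/val_inj->.
  - by move=> E; have := gUW x; rewrite /= E gZ.
  - by move=> E; have := gUW y; rewrite /= -E gZ.
  - by move=> /enum_val_inj/cast_ord_inj->.
  - by apply/negbTE/nZ.
  - by apply/negbTE; rewrite adj_sym; apply/nZ.
  by have := sUZ (g (inr i)) (g (inr i')); rewrite !inE !gZ !orbT => /(_ isT isT)/negbTE.
move=> [U [W [[UWT UW] [sU sW] cUW expU]]] cH [f [[h fK hK] fadj]].
apply/graph_freeP => g [ginj gadj].
pose g' (y : gunion H (edgeless (q - j))) := g (h y).
have g'inj : injective g' by move=> x y /ginj/(can_inj hK).
have g'adj x y : adj (g' x) (g' y) = adj x y by rewrite /g' gadj -fadj !hK.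
have lI : injective (fun x : H => g' (inl x)) by move=> x y /g'inj[].
have rI : injective (fun i : 'I_(q - j) => g' (inr i)) by move=> x y /g'inj[].
pose l (A : {set H}) := [set g' (inl x) | x in A].
pose Z := [set g' (inr i) | i : 'I_(q - j)].
have cl A : #|l A| = #|A| by apply: card_imset.
have cT : (#|U| + #|W| = 2 * j + 2)%N.
  by rewrite -cH -cardsT -UWT cardsU disjoint_setI0 // cards0 subn0.
have lE (A : {set H}) u : (g' (inl u) \in l A) = (u \in A) by apply: mem_imset.
have dl A : [disjoint l A & Z].
  rewrite -setI_eq0; apply/eqP/setP=> y; rewrite !inE; apply/negP=> /andP[].
  by move=> /imsetP[x _ ->] /imsetP[i _ /g'inj].
have st (A : {set H}) : {in A &, forall x y, ~~ adj x y} -> stable (l A :|: Z).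
  move=> sA y z; rewrite !inE.
  by move=> /orP[] /imsetP[x xA ->] /orP[] /imsetP[x' xA' ->]; rewrite g'adj //=; apply: sA.
apply: (free j (l U) (l W) Z jq); rewrite ?cl //; try lia.
- by rewrite card_imset // card_ord.
- rewrite -setI_eq0 -imsetI; last by move=> x y _ _ /lI.
  by rewrite disjoint_setI0 // imset0.
- exact: st.
- exact: st.
move=> S S0 /properP[SU [x xU xS]].
pose S' := [set x | g' (inl x) \in S].
have SE : S = l S'.
  apply/setP=> y; apply/idP/imsetP => [yS|[z]]; last by rewrite inE => zS ->.
  by have /imsetP[z zU yE] := subsetP SU y yS; exists z; rewrite // inE -yE.
have NE : l [set w | [exists u in S', adj u w]] \subset nbr S (l W).
  apply/subsetP=> _ /imsetP[w + ->]; rewrite inE => /exists_inP[u uS uw].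
  apply/nbrP; split; last by exists (g' (inl u)); rewrite ?g'adj // inE in uS *.
  have uU : u \in U by rewrite -lE (subsetP SU) //; rewrite inE in uS.
  apply: imset_f; have : w \in U :|: W by rewrite UWT.
  by rewrite inE => /orP[wU|//]; have := sU _ _ uU wU; rewrite uw.
rewrite SE cl; rewrite -SE; apply: leq_trans (subset_leq_card NE); rewrite cl; apply: expU.
  by rewrite -card_gt0 -cl -SE card_gt0.
apply/properP; split.
  by apply/subsetP=> u; rewrite inE => uS; rewrite -lE (subsetP SU).
move: xU xS => /imsetP[u uU ->] xS; exists u => //.
by rewrite inE.
Qed.

(** * Induced cycles as sequences *)

(** Only [i < j] is compared, so the edge closing the cycle is the pair of the
    first and the last index. *)
Definition cycle_seq (G : sgraph) (n : nat) (t : nat -> G) : Prop :=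
  (forall i j, (i < j < n)%N -> t i != t j) /\
  (forall i j, (i < j < n)%N -> adj (t i) (t j) = (j == i.+1) || ((i == 0) && (j.+1 == n))).

Lemma cycle_adjE n (i j : 'I_n) : (2 < n)%N -> (i < j)%N ->
  adj (i : cycle_graph n) j = (j == i.+1 :> nat) || ((i == 0 :> nat) && (j.+1 == n)).
Proof.
move=> n2 ij; have jn := ltn_ord j; rewrite /adj /= -!(inj_eq val_inj) /=.
rewrite (modn_small (_ : i.+1 < n)%N); last lia.
rewrite (_ : (i != j :> nat) = true) /=; last lia.
congr (_ || _); have [jn'|jn'] := eqVneq j.+1 n; first by rewrite jn' modnn andbT.
by rewrite modn_small; lia.
Qed.

Lemma cycle_embedding (G : sgraph) n (t : nat -> G) : (2 < n)%N ->
  cycle_seq n t -> embedding (fun i : cycle_graph n => t (i : 'I_n)).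
Proof.
move=> n2 [tinj tadj].
have adjE (i j : 'I_n) : (i < j)%N -> adj (t i) (t j) = adj (i : cycle_graph n) j.
  by move=> ij; rewrite cycle_adjE // tadj // ij ltn_ord.
split=> [i j tij | i j]; case: (ltngtP (i : 'I_n) (j : 'I_n)) => ij.
- by have := tinj i j; rewrite ij ltn_ord tij eqxx => /(_ isT).
- by have := tinj j i; rewrite ij ltn_ord tij eqxx => /(_ isT).
- exact: val_inj.
- exact: adjE.
- by rewrite adj_sym adjE // adj_sym.
- by rewrite (val_inj ij) !adj_irr.
Qed.

(** Rotations are automorphisms of the cycle. *)
Lemma embedding_cycle_seq (G : sgraph) n (g : cycle_graph n -> G) (i0 : 'I_n) :
  (2 < n)%N -> embedding g ->
  exists t, [/\ cycle_seq n t, t 0 = g i0 & forall k, exists i, t k = g i].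
Proof.
move=> n2 [ginj gadj]; have n0 : (0 < n)%N by lia.
pose h k : 'I_n := Ordinal (ltn_pmod (k + i0) n0).
exists (fun k => g (h k)).
have hE i j : (i < n)%N -> (j < n)%N -> ((i + i0) %% n == (j + i0) %% n) = (i == j).
  by move=> im jm; rewrite eqn_modDr !modn_small.
have hne i j : (i < j < n)%N -> h i != h j.
  by move=> ij; rewrite -(inj_eq val_inj) /= hE; lia.
split; last by move=> k; exists (h k).
  2: by congr g; apply: val_inj; rewrite /= add0n modn_small.
split=> i j ij; first by rewrite (inj_eq ginj) hne.
have hS k l : (k < n)%N -> (h l == ordS (h k)) = (l %% n == k.+1 %% n).
  move=> kn; rewrite -(inj_eq val_inj) /= -addn1 modnDml addnAC eqn_modDr addn1.
  by [].
rewrite gadj /adj /= hne //= !hS; try lia.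
rewrite !(@modn_small i) 1?(@modn_small j) 1?(@modn_small i.+1); try lia.
congr (_ || _); have [jn|jn] := eqVneq j.+1 n; first by rewrite jn modnn andbT.
by rewrite modn_small; lia.
Qed.

(** * Edges whose contraction is elementary bipartite *)

Section Expansion.
Variable G : sgraph.
Implicit Types (A B C I K R S T U W X Z : {set G}) (x y w : G).

Lemma nbr_sub S W : nbr S W \subset W.
Proof. by apply/subsetP=> w /nbrP[]. Qed.

Lemma nbrS S S' W : S \subset S' -> nbr S W \subset nbr S' W.
Proof.
move=> SS'; apply/subsetP=> w /nbrP[wW [u uS uw]]; apply/nbrP; split=> //.
by exists u => //; apply: (subsetP SS').
Qed.

Lemma nbrU S S' W : nbr (S :|: S') W = nbr S W :|: nbr S' W.
Proof.
apply/setP=> w; apply/nbrP/setUP => [[wW [u + uw]]|].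
  by case/setUP=> uS; [left | right]; apply/nbrP; split=> //; exists u.
case=> /nbrP[wW [u uS uw]]; split=> //; exists u => //; apply/setUP;
  by [left | right].
Qed.

(** The Hall-type condition passes to the other side by complementation: a set
    [R] with few neighbours leaves a set [S] whose neighbours avoid [R]. *)
Lemma expands_swap U W : (1 < #|U|)%N -> #|U| = #|W| -> expands U W -> expands W U.
Proof.
move=> U1 cUW expU R R0 /properP[RW [w0 w0W w0R]]; rewrite ltnNge; apply/negP=> cN.
pose S := U :\: nbr R U.
have cS : (#|S| + #|nbr R U|)%N = #|U|.
  by rewrite -(cardsID (nbr R U) U) (setIidPr (nbr_sub _ _)) addnC.
have cWR : (#|W :\: R| + #|R|)%N = #|W|.
  by rewrite -(cardsID R W) (setIidPr RW) addnC.
have NS : nbr S W \subset W :\: R.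
  apply/subsetP=> w /nbrP[wW [u]]; rewrite !inE => /andP[uN uU] uw.
  rewrite wW andbT; apply: contra uN => wR; rewrite uU /=.
  by apply/exists_inP; exists w; rewrite // adj_sym.
have R1 : (0 < #|R|)%N by rewrite card_gt0.
have WR1 : (0 < #|W :\: R|)%N.
  by rewrite card_gt0; apply/set0Pn; exists w0; rewrite inE w0R.
have [SU | SU] := eqVneq S U; last first.
  have := expU S; rewrite -card_gt0 properEneq SU subsetDl => /(_ _ isT).
  have := subset_leq_card NS; lia.
have [u uU] : exists u, u \in U by apply/set0Pn; rewrite -card_gt0; lia.
have cU := cardsD1 u U; rewrite uU in cU.
have : (#|U :\ u| < #|nbr (U :\ u) W|)%N.
  apply: expU; first by rewrite -card_gt0; lia.
  by apply/properP; split; [apply: subsetDl | exists u; rewrite // setD11].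
have := subset_leq_card (nbrS W (subsetDl U [set u])).
by have := subset_leq_card NS; rewrite SU; lia.
Qed.

(** The shape of the graph over an edge [x y] whose contraction is an
    elementary bipartite graph: [A] is the side of the contracted vertex,
    without it, and [C] is the other side. *)
Definition split_elementary (j : nat) (x y : G) (A C : {set G}) : Prop :=
  [/\ [/\ adj x y, x \notin A :|: C, y \notin A :|: C & [disjoint A & C]],
      #|A| = j /\ #|C| = j.+1,
      [/\ stable (x |: A), stable (y |: A) & stable C],
      (forall S, S != set0 -> S \subset A -> (#|S| < #|nbr S C|)%N) &
      (forall S, S \proper A -> (#|S|.+1 < #|nbr (S :|: [set x; y]) C|)%N)].

Lemma split_elementary_sym j x y A C :
  split_elementary j x y A C -> split_elementary j y x A C.
Proof.
move=> [[xy xAC yAC AC] cAC [sx sy sC] E1 E2]; split=> //.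
  by rewrite adj_sym.
by move=> S SA; rewrite [[set y; x]]setUC; apply: E2.
Qed.

Lemma disjointI A B : (forall u, u \in A -> u \notin B) -> [disjoint A & B].
Proof. by move=> AB; rewrite disjoints_subset; apply/subsetP=> u /AB; rewrite inE. Qed.

Lemma stableU A B : stable A -> stable B -> {in A & B, forall u v, ~~ adj u v} ->
  stable (A :|: B).
Proof.
move=> sA sB nAB u v /setUP[uA|uB] /setUP[vA|vB]; [exact: sA | exact: nAB | | exact: sB].
by rewrite adj_sym; apply: nAB.
Qed.

Definition isolated Z T : Prop :=
  [/\ [disjoint T & Z], stable Z & {in T & Z, forall t z, ~~ adj t z}].

Lemma stable_isolated A Z T : isolated Z T -> A \subset T -> stable A -> stable (A :|: Z).
Proof.
move=> [_ sZ nTZ] AT sA; apply: stableU => // u z uA zZ.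
by apply: nTZ => //; apply: (subsetP AT).
Qed.

(** Take a minimal subset [S] of [x |: A] that contains [x] and has at most
    [#|S|] neighbours.  If [S] has at least two elements, then [S] and its
    neighbours form an elementary bipartite graph, and the remaining vertices of
    [C] are isolated from it and join [Z]. *)
Lemma nbr1_le1 q j x y A C Z :
    (1 <= j <= q)%N -> elementary_free q G -> split_elementary j x y A C ->
    isolated Z (x |: (y |: (A :|: C))) -> #|Z| = (q - j)%N ->
  (#|nbr [set x] C| <= 1)%N.
Proof.
move=> jq free [[xy xAC yAC AC] [cA cC] [sx sy sC] E1 E2] iZ cZ.
rewrite leqNgt; apply/negP=> cx.
have xA : x \notin A by apply: contra xAC; apply: (subsetP (subsetUl _ _)).
pose P (S : {set G}) := [&& x \in S, S \subset x |: A & (#|nbr S C| <= #|S|)%N].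
have PT : P (x |: A).
  rewrite /P setU11 subxx cardsU1 xA /=.
  by have := subset_leq_card (nbr_sub (x |: A) C); lia.
have [S /minsetP[/and3P[xS SA cS] minS] _] := minset_exists PT.
have cSx := cardsD1 x S; rewrite xS in cSx.
have SxA : S :\ x \subset A by rewrite subDset.
have Sx0 : S :\ x != set0.
  apply: contraL cS => /eqP Sx; have -> : S = [set x] by rewrite -(setD1K xS) Sx setU0.
  by rewrite -ltnNge cards1.
have cNS : #|nbr S C| = #|S|.
  apply/eqP; rewrite eqn_leq cS.
  have := E1 _ Sx0 SxA; have := subset_leq_card (nbrS C (subsetDl S [set x])); lia.
pose N := nbr S C.
have NC : N \subset C := nbr_sub _ _.
have cCN := cardsID N C; rewrite (setIidPr NC) in cCN.
have S1 : (0 < #|S :\ x|)%N by rewrite card_gt0.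
have SAj : (#|S :\ x| <= #|A|)%N := subset_leq_card SxA.
pose T := x |: (y |: (A :|: C)).
have CT : C \subset T by do 2!apply: subset_trans (subsetUr _ _); apply: subsetUr.
have ST : S \subset T.
  apply: subset_trans SA _; apply: setUS.
  by apply: subset_trans (subsetUl _ _) (subsetUr _ _).
have [dTZ sZ nTZ] := iZ.
have SC : [disjoint S & C].
  apply: disjointI => u /(subsetP SA); rewrite in_setU1 => /orP[/eqP->|uA].
    by apply: contra xAC; apply: (subsetP (subsetUr _ _)).
  by rewrite (disjointFr AC).
have sCNZ : stable (C :|: Z) by apply: stable_isolated iZ _ _.
have NZC : N :|: (Z :|: (C :\: N)) \subset C :|: Z.
  by rewrite !subUset subsetUr (subset_trans NC) ?subsetUl // (subset_trans (subsetDl _ _)) ?subsetUl.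
apply: (free #|S :\ x| S N (Z :|: (C :\: N))); first by rewrite S1 (leq_trans SAj) // cA; case/andP: jq.
- by rewrite cSx.
- by rewrite /N cNS cSx.
- rewrite cardsU disjoint_setI0 ?cards0; last first.
    rewrite disjoint_sym; apply: disjointWl dTZ.
    exact: subset_trans (subsetDl _ _) CT.
  by move: cCN SAj jq cSx cA cC cZ; rewrite /N cNS; clear; lia.
- exact: disjointWr NC SC.
- apply: disjointI => u uS; rewrite !inE negb_or (disjointFr dTZ (subsetP ST u uS)).
  by rewrite (disjointFr SC uS) andbF.
- apply: disjointI => u uN; rewrite in_setU in_setD uN /=.
  by rewrite (disjointFr dTZ) // (subsetP CT) // (subsetP NC).
- apply: stableU; first exact: stableS SA sx.
    exact: stableS (subset_trans (subsetUr _ _) NZC) sCNZ.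
  move=> u v uS; rewrite in_setU in_setD => /orP[vZ | /andP[vN vC]].
    by apply: nTZ => //; apply: (subsetP ST).
  by apply: contra vN => uv; apply/nbrP; split=> //; exists u.
- exact: stableS NZC sCNZ.
move=> S' S'0 S'S; have /properP[S'sub _] := S'S.
have -> : nbr S' N = nbr S' C.
  apply/setP=> w; apply/nbrP/nbrP => -[wN [u uS uw]]; split; try by exists u.
    exact: (subsetP NC).
  by apply/nbrP; split=> //; exists u => //; apply: (subsetP S'sub).
have [xS' | xS'] := boolP (x \in S').
  rewrite ltnNge; apply: contraTN S'S => cS'; rewrite properEneq negb_and negbK.
  by rewrite (minS S') ?eqxx // /P xS' cS' (subset_trans S'sub SA).
apply: E1 => //; apply/subsetP=> u uS'.
have := subsetP SA u (subsetP S'sub u uS'); rewrite in_setU1 => /orP[/eqP ux|//].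
by rewrite -ux uS' in xS'.
Qed.

Lemma nbr1P x C w : reflect (w \in C /\ adj x w) (w \in nbr [set x] C).
Proof.
apply: (iffP (nbrP _ _ _)) => [[wC [u + uw]]|[wC xw]].
  by rewrite inE => /eqP <-.
by split=> //; exists x; rewrite ?inE.
Qed.

Lemma split_nbr q j x y A C Z :
    (1 <= j <= q)%N -> elementary_free q G -> split_elementary j x y A C ->
    isolated Z (x |: (y |: (A :|: C))) -> #|Z| = (q - j)%N ->
  exists w1 w2, [/\ nbr [set x] C = [set w1], nbr [set y] C = [set w2] & w1 != w2].
Proof.
move=> jq free sp iZ cZ; have cx := nbr1_le1 jq free sp iZ cZ.
have cy : (#|nbr [set y] C| <= 1)%N.
  by apply: nbr1_le1 jq free (split_elementary_sym sp) _ cZ; rewrite setUCA.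
have [_ [cA _] _ _ E2] := sp.
have := E2 set0; rewrite proper0 -card_gt0 cA set0U nbrU cards0; case/andP: jq => -> _ /(_ isT).
rewrite cardsU => cxy.
have /cards1P[w1 w1E] : #|nbr [set x] C| == 1%N by clear -cx cy cxy; lia.
have /cards1P[w2 w2E] : #|nbr [set y] C| == 1%N by clear -cx cy cxy; lia.
exists w1, w2; split=> //; apply: contraTneq cxy => w12.
by rewrite w1E w2E w12 setIid cards1.
Qed.

Lemma nbr_compl S R X C : R \subset X :\: nbr S X -> nbr R C \subset C :\: S.
Proof.
move=> RX; apply/subsetP=> w /nbrP[wC [u uR uw]]; rewrite inE wC andbT.
have := subsetP RX u uR; rewrite inE => /andP[uN uX]; apply: contra uN => wS.
by apply/nbrP; split=> //; exists w; rewrite // adj_sym.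
Qed.

(** The path through [x] and [y] continues to [w2], and contracting the next
    edge gives the same graph up to isomorphism.  The sides exchange their roles,
    so the expansion conditions are again obtained by complementation. *)
Lemma split_next j x y A C w1 w2 : (1 <= j)%N -> split_elementary j x y A C ->
    nbr [set x] C = [set w1] -> nbr [set y] C = [set w2] -> w1 != w2 ->
  split_elementary j y w2 (C :\ w2) (x |: A).
Proof.
move=> j1 [[xy xAC yAC AC] [cA cC] [sx sy sC] E1 E2] xw yw w12.
have /nbr1P[w2C yw2] : w2 \in nbr [set y] C by rewrite yw set11.
move: xAC yAC; rewrite !inE !negb_or => /andP[xA xC] /andP[yA yC].
have yx : y != x by apply: contraTneq xy => ->; rewrite adj_irr.
have cX : #|x |: A| = j.+1 by rewrite cardsU1 xA cA.
have cCw : #|C :\ w2| = j by move: (cardsD1 w2 C); rewrite w2C cC add1n => -[<-].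
have cR S : (#|(x |: A) :\: nbr S (x |: A)| + #|nbr S (x |: A)| = j.+1)%N.
  by rewrite -cX -[RHS](cardsID (nbr S (x |: A))) (setIidPr (nbr_sub _ _)) addnC.
have cCS S : S \subset C -> (#|C :\: S| + #|S| = j.+1)%N.
  by move=> SC; rewrite -cC -[RHS](cardsID S) (setIidPr SC) addnC.
split.
- split=> //.
  + by rewrite in_setU in_setD1 in_setU1 (negPf yC) (negPf yx) (negPf yA) andbF.
  + rewrite in_setU setD11 in_setU1 (disjointFl AC w2C) orbF.
    by apply: contraNneq xC => <-.
  apply: disjointI => u; rewrite in_setD1 in_setU1 => /andP[_ uC].
  by rewrite (disjointFl AC uC) orbF; apply: contraNneq xC => <-.
- by [].
- split; [apply: stableU | by rewrite setD1K | exact: sx].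
  + by move=> u v; rewrite !inE => /eqP-> /eqP->; rewrite adj_irr.
  + exact: stableS (subsetDl _ _) sC.
  move=> u v; rewrite !inE => /eqP-> /andP[vw vC]; apply: contra vw => yv.
  by rewrite -in_set1 -yw; apply/nbr1P.
- move=> S S0; rewrite subsetD1 => /andP[SC w2S]; rewrite ltnNge; apply/negP=> cN.
  (* The set [R] is large because [N] is small, but its neighbours avoid [S]. *)
  set N := nbr S (x |: A) in cN; pose R := (x |: A) :\: N.
  have cRN := cR S; rewrite -/N -/R in cRN.
  have cCS' := cCS S SC.
  have NR : nbr R C \subset C :\: S by apply: nbr_compl (subxx _).
  have cNR := subset_leq_card NR.
  rewrite -card_gt0 in S0.
  have cSw : (#|S| <= j)%N by rewrite -cCw subset_leq_card // subsetD1 SC.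
  have [xR | xR] := boolP (x \in R); last first.
    have RA : R \subset A.
      apply/subsetP=> u uR; move: (uR); rewrite inE => /andP[_]; rewrite in_setU1.
      by case: eqP => // ux; rewrite -ux uR in xR.
    have := E1 R; rewrite -card_gt0 RA => /(_ _ isT).
    clear -cRN cCS' cNR S0 cSw cN; lia.
  have R0A : R :\ x \subset A by rewrite subDset subsetDl.
  have cRx := cardsD1 x R; rewrite xR in cRx.
  have [R0E | R0E] := eqVneq (R :\ x) A.
    have := E1 A; rewrite -card_gt0 cA j1 => /(_ isT (subxx _)).
    have := subset_leq_card (subset_trans (nbrS C (subsetDl R [set x])) NR).
    by rewrite R0E; clear -cCS' S0; lia.
  have := E2 (R :\ x); rewrite properEneq R0E R0A => /(_ isT).
  have sub : nbr (R :\ x :|: [set x; y]) C \subset C :\: S.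
    rewrite setUA [_ :|: [set x]]setUC setD1K // nbrU yw subUset NR sub1set.
    by rewrite inE w2S.
  have := subset_leq_card sub; clear -cRN cCS' cRx cN; lia.
move=> S /properP[SC [c cC' cS]]; rewrite ltnNge; apply/negP=> cN.
move: SC; rewrite subsetD1 => /andP[SC w2S].
have cSj : (#|S| < j)%N.
  rewrite -cCw; apply: proper_card; apply/properP; split; last by exists c.
  by rewrite subsetD1 SC.
set N := nbr _ _ in cN; pose R := (x |: A) :\: N.
have xN : x \in N.
  by apply/nbrP; rewrite setU11; split=> //; exists y; rewrite ?inE ?eqxx ?orbT // adj_sym.
have RA : R \subset A.
  apply/subsetP=> u; rewrite inE in_setU1 => /andP[uN /orP[/eqP ux|//]].
  by rewrite ux xN in uN.
have cRN := cR (S :|: [set y; w2]); rewrite -/N -/R in cRN.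
have := E1 R; rewrite -card_gt0 RA => /(_ _ isT).
have SC' : w2 |: S \subset C by rewrite subUset sub1set w2C.
have NR : nbr R C \subset C :\: (w2 |: S).
  have NR0 : nbr R C \subset C :\: (S :|: [set y; w2]) by apply: nbr_compl (subxx _).
  apply: subset_trans NR0 _; apply: setDS.
  by rewrite subUset sub1set !inE eqxx !orbT subsetUl.
have := subset_leq_card NR; have := cCS _ SC'; rewrite cardsU1 w2S.
clear -cRN cN cSj; lia.
Qed.

Lemma card_split j x y A C : split_elementary j x y A C ->
  #|x |: (y |: (A :|: C))| = (2 * j + 3)%N.
Proof.
move=> [[xy xAC yAC AC] [cA cC] _ _ _].
have xy' : x != y by apply: contraTneq xy => ->; rewrite adj_irr.
rewrite cardsU1 in_setU1 (negPf xy') xAC cardsU1 yAC cardsU disjoint_setI0 //.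
by rewrite cards0 cA cC; lia.
Qed.

(** The set [y |: A] still expands weakly after the removal of [x], so adding
    vertices of [C] to a part of it never gains. *)
Lemma stable_split_aux j x y A C I w1 : (1 <= j)%N -> split_elementary j x y A C ->
    nbr [set x] C = [set w1] -> I \subset x |: (y |: (A :|: C)) ->
    stable I -> x \notin I ->
  (#|I| <= j.+1)%N.
Proof.
move=> j1 [[xy xAC yAC AC] [cA cC] [sx sy sC] E1 E2] xw IT sI xI.
pose S := I :&: (y |: A).
have SN : (#|S| <= #|nbr S C|)%N.
  have [yS | yS] := boolP (y \in S); last first.
    have [->|S0] := eqVneq S set0; first by rewrite cards0.
    apply/ltnW/E1 => //; apply/subsetP=> u uS; move: (uS); rewrite inE in_setU1.
    by case/andP=> _; case: eqP => // uy; rewrite -uy uS in yS.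
  have cSy := cardsD1 y S; rewrite yS in cSy.
  have SA : S :\ y \subset A by rewrite subDset subsetIr.
  have [SE | SE] := eqVneq (S :\ y) A.
    have := E1 A; rewrite -card_gt0 cA j1 => /(_ isT (subxx _)).
    have := subset_leq_card (nbrS C (subsetDl S [set y])); rewrite SE in cSy *.
    by clear -cA cSy; lia.
  have := E2 (S :\ y); rewrite properEneq SE SA => /(_ isT).
  rewrite [[set x; y]]setUC setUA [_ :|: [set y]]setUC setD1K //.
  rewrite nbrU xw => cN; have := leq_trans cN (leq_of_leqif (leq_card_setU _ _)).
  by rewrite cards1; clear -cSy; lia.
have IE : I \subset S :|: (C :\: nbr S C).
  apply/subsetP=> u uI; have := subsetP IT u uI; rewrite !in_setU1 in_setU => uT.
  rewrite in_setU in_setD; case/or4P: uT => [/eqP ux | uy | uA | uC]; first by rewrite -ux uI in xI.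
  - by rewrite inE uI in_setU1 uy.
  - by rewrite inE uI in_setU1 uA orbT.
  rewrite uC andbT; apply/orP; right; apply/negP=> /nbrP[_ [v]].
  by rewrite inE => /andP[vI _]; apply/negP/sI.
have := leq_trans (subset_leq_card IE) (leq_of_leqif (leq_card_setU _ _)).
have := cardsID (nbr S C) C; rewrite (setIidPr (nbr_sub _ _)) cC.
by move: SN; clear; lia.
Qed.

Lemma stable_split q j x y A C Z I :
    (1 <= j <= q)%N -> elementary_free q G -> split_elementary j x y A C ->
    isolated Z (x |: (y |: (A :|: C))) -> #|Z| = (q - j)%N ->
    I \subset x |: (y |: (A :|: C)) -> stable I ->
  (#|I| <= j.+1)%N.
Proof.
move=> jq free sp iZ cZ IT sI; have [w1 [w2 [xw yw w12]]] := split_nbr jq free sp iZ cZ.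
have /andP[j1 _] := jq; have [xI | xI] := boolP (x \in I); last first.
  exact: stable_split_aux j1 sp xw IT sI xI.
apply: (stable_split_aux j1 (split_elementary_sym sp) yw _ sI); first by rewrite setUCA.
have [[xy _ _ _] _ _ _ _] := sp; apply/negP=> yI.
by have := sI x y xI yI; rewrite xy.
Qed.

Lemma clique_split q j x y A C Z K :
    (1 <= j <= q)%N -> elementary_free q G -> split_elementary j x y A C ->
    isolated Z (x |: (y |: (A :|: C))) -> #|Z| = (q - j)%N -> clique K ->
  (#|K :&: (x |: (y |: (A :|: C)))| <= 2)%N.
Proof.
move=> jq free sp iZ cZ cK; have [w1 [w2 [xw yw w12]]] := split_nbr jq free sp iZ cZ.
have [[xy xAC yAC AC] _ [sx sy sC] _ _] := sp.
have bound B : stable B -> K :&: (x |: (y |: (A :|: C))) \subset (K :&: B) :|: (K :&: C) ->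
    (#|K :&: (x |: (y |: (A :|: C)))| <= 2)%N.
  move=> sB sub; apply: leq_trans (subset_leq_card sub) _.
  apply: leq_trans (leq_of_leqif (leq_card_setU _ _)) _.
  have := card_clique_stable cK sB; have := card_clique_stable cK sC.
  by clear; lia.
have [xK | xK] := boolP (x \in K); last first.
  apply: (bound _ sy); apply/subsetP=> u; rewrite !inE => /andP[uK].
  have [ux|_] := eqVneq u x; first by rewrite -ux uK in xK.
  by rewrite uK /= orbA.
have [yK | yK] := boolP (y \in K); last first.
  apply: (bound _ sx); apply/subsetP=> u; rewrite !inE => /andP[uK].
  have [uy|_] := eqVneq u y; first by rewrite -uy uK in yK.
  by rewrite uK /= orbA.
have sub : K :&: (x |: (y |: (A :|: C))) \subset [set x; y].
  apply/subsetP=> u; rewrite !inE => /andP[uK].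
  case: (eqVneq u x) => //= ux; case: (eqVneq u y) => //= uy /orP[uA | uC].
    have := sx x u; rewrite !in_setU1 eqxx uA orbT => /(_ isT isT)/negP[].
    by apply: cK; rewrite // eq_sym.
  have uw1 : u \in nbr [set x] C by apply/nbr1P; split=> //; apply: cK; rewrite // eq_sym.
  have uw2 : u \in nbr [set y] C by apply/nbr1P; split=> //; apply: cK; rewrite // eq_sym.
  move: uw1 uw2 w12; rewrite xw yw !inE => /eqP<- /eqP<-.
  by rewrite eqxx.
by apply: leq_trans (subset_leq_card sub) _; rewrite cards2; case: (_ == _).
Qed.

(** Dropping one isolated vertex leaves a set without stable subsets of size
    [q + 1].  Give weight 1 to the [2j + 3] vertices of [T] and weight 2 to the
    isolated ones: a clique has weight at most 2, and the total weight is
    [2q + 1], so [q] cliques are not enough. *)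
Lemma split_lt q j x y A C Z :
    (1 <= j < q)%N -> weakly_perfect q G -> elementary_free q G ->
    split_elementary j x y A C ->
    isolated Z (x |: (y |: (A :|: C))) -> #|Z| = (q - j)%N ->
  False.
Proof.
move=> /andP[j1 jq] wp free sp iZ cZ.
have jq' : (1 <= j <= q)%N by rewrite j1 ltnW.
pose T := x |: (y |: (A :|: C)).
have [z zZ] : exists z, z \in Z by apply/set0Pn; rewrite -card_gt0 cZ subn_gt0.
pose Z' := Z :\ z; have cZ' := cardsD1 z Z; rewrite zZ cZ -/Z' in cZ'.
have [TZ sZ nTZ] := iZ; have Z'Z : Z' \subset Z := subsetDl _ _.
have TZ' : [disjoint T & Z'] := disjointWr Z'Z TZ.
have card_TZ B : B \subset T :|: Z' -> #|B| = (#|B :&: T| + #|B :&: Z'|)%N.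
  move=> BTZ; have dj : [disjoint B :&: T & B :&: Z'].
    by apply: disjointI => u /setIP[_ uT]; rewrite in_setI (disjointFr TZ' uT) andbF.
  by rewrite -{1}(setIidPl BTZ) setIUr cardsU (disjoint_setI0 dj) cards0 subn0.
have [C' [cC' XE]] : union_of_cliques q (T :|: Z').
  apply: wp => I IX sI; rewrite (card_TZ I IX).
  have := subset_leq_card (subsetIr I Z').
  have := stable_split jq' free sp iZ cZ (subsetIr I T) (stableS (subsetIl _ _) sI).
  by move: cZ'; clear -jq; lia.
pose wt B := (#|B :&: T| + 2 * #|B :&: Z'|)%N.
have wtX : wt (T :|: Z') = (2 * q + 1)%N.
  have := card_split sp; rewrite /wt (setIidPr (subsetUl T Z')) (setIidPr (subsetUr T Z')) -/T.
  by move: cZ'; clear -jq; lia.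
have wtU B B' : (wt (B :|: B') <= wt B + wt B')%N.
  rewrite /wt !setIUl.
  have := leq_of_leqif (leq_card_setU (B :&: T) (B' :&: T)).
  have := leq_of_leqif (leq_card_setU (B :&: Z') (B' :&: Z')).
  by clear; lia.
have wtC i : (wt (C' i) <= 2)%N.
  have [CZ | /set0Pn[v]] := eqVneq (C' i :&: Z') set0.
    by rewrite /wt CZ cards0 addn0; apply: (clique_split jq' free sp iZ cZ).
  rewrite inE => /andP[vC vZ]; rewrite /wt [C' i :&: T](_ : _ = set0); last first.
    apply/setP=> t; rewrite inE in_set0; apply/negP=> /andP[tC tT].
    have := nTZ t v tT (subsetP Z'Z v vZ); rewrite (cC' i) //.
    by apply: contraTneq vZ => <-; rewrite (disjointFr TZ').
  rewrite cards0; have := card_clique_stable (cC' i) (stableS Z'Z sZ).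
  by clear; lia.
have : (wt (\bigcup_(i < q) C' i) <= \sum_(i < q) 2)%N.
  elim/big_ind2: _ => [|B m B' m' Bm Bm'|i _]; last exact: wtC.
    by rewrite /wt !set0I cards0.
  exact: leq_trans (wtU _ _) (leq_add Bm Bm').
by rewrite -XE wtX sum_nat_const card_ord; clear; lia.
Qed.

(** Otherwise the expansion conditions, applied to the parts of [A] inside and
    outside of [K], would force more vertices into [C] than there are. *)
Lemma split_connected j x y A C K : (1 <= j)%N -> split_elementary j x y A C ->
    x \in K -> y \in K ->
    (forall u v, u \in K -> v \in x |: (y |: (A :|: C)) -> adj u v -> v \in K) ->
  x |: (y |: (A :|: C)) \subset K.
Proof.
move=> j1 [[xy xAC yAC AC] [cA cC] [sx sy sC] E1 E2] xK yK clK.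
have AT : A \subset x |: (y |: (A :|: C)).
  exact: subset_trans (subsetUl _ _) (subset_trans (subsetUr _ _) (subsetUr _ _)).
have CT : C \subset x |: (y |: (A :|: C)).
  exact: subset_trans (subsetUr _ _) (subset_trans (subsetUr _ _) (subsetUr _ _)).
have N1 : nbr ((A :&: K) :|: [set x; y]) C \subset C :&: K.
  apply/subsetP=> w /nbrP[wC [u uK uw]]; rewrite inE wC /=; apply: (clK u) => //.
    by move: uK; rewrite !inE => /orP[/andP[]//|/orP[]/eqP->].
  exact: (subsetP CT).
have [A0 | A0] := eqVneq (A :\: K) set0.
  have AK : A \subset K by rewrite -setD_eq0 A0.
  have CK : C :&: K = C.
    apply/eqP; rewrite eqEcard subsetIl cC; apply: leq_trans (subset_leq_card N1).
    rewrite (setIidPl AK); have := E1 A; rewrite -card_gt0 cA j1 => /(_ isT (subxx _)) cNA.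
    by apply: leq_trans cNA _; apply/subset_leq_card/nbrS/subsetUl.
  by rewrite !subUset !sub1set xK yK AK -CK subsetIr.
have N2 : nbr (A :\: K) C \subset C :\: K.
  apply/subsetP=> w /nbrP[wC [u]]; rewrite !inE wC andbT => /andP[uK uA] uw.
  apply: contra uK => wK; apply: (clK w) => //; last by rewrite adj_sym.
  exact: (subsetP AT).
have AKp : A :&: K \proper A.
  rewrite properEneq subsetIl andbT; apply: contra A0 => /eqP/setIidPl.
  by rewrite -setD_eq0.
have := leq_trans (E1 _ A0 (subsetDl _ _)) (subset_leq_card N2).
have := leq_trans (E2 _ AKp) (subset_leq_card N1).
have := cardsID K A; have := cardsID K C; rewrite cA cC.
by clear; lia.
Qed.

End Expansion.

(** * Walking around a cycle *)

(** At the first repetition the walk returns to its start, since any earlier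
    vertex of the walk has both of its neighbours accounted for. *)
Lemma walk_cycle (G : sgraph) (T : {set G}) (s : nat -> G) :
    (forall i, s i \in T) -> (forall i, s i.+2 != s i) ->
    (forall i t, t \in T -> adj (s i.+1) t = (t == s i) || (t == s i.+2)) ->
  exists m, [/\ (2 < m)%N, cycle_seq m s &
    forall i t, (i < m)%N -> t \in T -> adj (s i) t -> exists2 k, (k < m)%N & t = s k].
Proof.
move=> sT s2 adjE.
have adjS i : adj (s i) (s i.+1) by rewrite adj_sym adjE // eqxx.
have neS i : s i.+1 != s i by apply: contraTneq (adjS i) => ->; rewrite adj_irr.
pose P m := [exists l : 'I_m, s l == s m].
have exP : exists m, P m.
  have [/existsP[k Pk] | /existsPn noP] := boolP [exists k : 'I_#|G|.+1, P k]; first by exists k.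
  have lt_ne (i k : 'I_#|G|.+1) : (i < k)%N -> s i != s k.
    by move=> ik; have /existsPn/(_ (Ordinal ik)) := noP k.
  have /leq_card : injective (fun i : 'I_#|G|.+1 => s i).
    move=> i k sik; case: (ltngtP i k) => ik; last exact: val_inj.
      by have := lt_ne _ _ ik; rewrite sik eqxx.
    by have := lt_ne _ _ ik; rewrite sik eqxx.
  by rewrite card_ord ltnn.
case: (ex_minnP exP) => m /existsP[[l lm] /= /eqP slm] minP.
have inj i k : (i < k)%N -> (k < m)%N -> s i != s k.
  move=> ik km; apply: contraL km => sik; rewrite -leqNgt; apply: minP.
  by apply/existsP; exists (Ordinal ik).
have inj_eqs i k : (i < m)%N -> (k < m)%N -> (s i == s k) = (i == k).
  move=> im km; case: (ltngtP i k) => [ik|ki|->]; last exact: eqxx.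
    by apply: negbTE; apply: inj.
  by rewrite eq_sym; apply: negbTE; apply: inj.
have m0 : (0 < m)%N by apply: leq_ltn_trans lm.
have mE : m = m.-1.+1 by rewrite prednK.
have m3 : (2 < m)%N.
  rewrite ltnNge; apply/negP=> m2; have : (m == 1) || (m == 2) by lia.
  case/orP=> /eqP m_; subst m.
    by case: l lm slm => // _ E; have := neS 0; rewrite E eqxx.
  by case: l lm slm => [|[|//]] _ E; [have := s2 0 | have := neS 1]; rewrite E eqxx.
have l0 : l = 0%N.
  case: l lm slm => [//|l] lm slm.
  have : adj (s l.+1) (s m.-1) by rewrite slm adj_sym mE /= adjS.
  rewrite adjE // inj_eqs ?prednK //; try lia.
  case/orP=> [/eqP|sl2]; first lia.
  have [lm2|lm2] := ltnP l.+2 m.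
    move: sl2; rewrite inj_eqs //; last by lia.
    move/eqP=> ml2; have := s2 l.+1; rewrite slm; have -> : l.+3 = m by lia.
    by rewrite eqxx.
  have ml2 : l.+2 = m by lia.
  have := neS m.-1; rewrite -mE eq_sym; move: sl2; rewrite ml2 => ->.
  by [].
subst l; move: slm => s0m.
have s1m : s m.+1 = s 1.
  have : adj (s m) (s 1) by rewrite -s0m adjS.
  rewrite {1}mE adjE // inj_eqs; try lia.
  by case/orP=> /eqP; [lia | rewrite -mE => ->].
have adj0 t : t \in T -> adj (s 0) t = (t == s m.-1) || (t == s 1).
  by move=> tT; rewrite s0m {1}mE adjE // -mE s1m.
exists m; split=> //; first split=> [i k /andP[ik km]|i k /andP[ik km]].
- exact: inj.
- case: i ik => [|i] ik.
    by rewrite adj0 // !inj_eqs //; lia.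
  by rewrite adjE // !inj_eqs //; lia.
move=> [|i] t im tT.
  by rewrite adj0 // => /orP[]/eqP->; [exists m.-1 | exists 1] => //; lia.
rewrite adjE // => /orP[]/eqP->; first by exists i => //; lia.
have [im2 | im2] := ltnP i.+2 m; first by exists i.+2.
by exists 0 => //; rewrite s0m; congr s; lia.
Qed.

(** The property of being split is handed on from edge to edge, so every vertex
    on the walk has degree two; the closed walk is everything by connectedness. *)
Lemma split_cycle (G : sgraph) q (x y : G) (A C : {set G}) :
    (1 <= q)%N -> elementary_free q G -> split_elementary q x y A C ->
  exists t : nat -> G, cycle_seq (2 * q + 3) t.
Proof.
move=> q1 free sp0; pose T := x |: (y |: (A :|: C)).
pose good (u v : G) := exists A C : {set G},
  split_elementary q u v A C /\ u |: (v |: (A :|: C)) = T.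
have step u v : good u v -> exists w, [/\ good v w, w != u &
    forall t, t \in T -> adj v t = (t == u) || (t == w)].
  move=> [A' [C' [sp TE]]].
  have iZ : isolated set0 (u |: (v |: (A' :|: C'))).
    by split; [rewrite -setI_eq0 setI0 | move=> a b; rewrite inE | move=> a b _; rewrite inE].
  have [w1 [w2 [xw yw w12]]] : exists w1 w2, [/\ nbr [set u] C' = [set w1],
      nbr [set v] C' = [set w2] & w1 != w2].
    by apply: split_nbr free sp iZ _; rewrite ?cards0 ?subnn // q1 leqnn.
  have [[uv uAC vAC AC] _ [_ sv _] _ _] := sp.
  have /nbr1P[w2C vw2] : w2 \in nbr [set v] C' by rewrite yw set11.
  have uw2 : w2 != u by apply: contraNneq uAC => <-; rewrite inE w2C orbT.
  exists w2; split=> //.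
    exists (C' :\ w2), (u |: A'); split; first exact: split_next q1 sp xw yw w12.
    rewrite -TE; apply/setP=> t; rewrite !inE; case: (t =P w2) => [->|_].
      by rewrite w2C !orbT.
    case: (t == v); case: (t == u); case: (t \in C'); case: (t \in A') => //.
  move=> t; rewrite -TE !inE => /or4P[/eqP-> | /eqP-> | tA | tC].
  - by rewrite adj_sym uv eqxx.
  - rewrite adj_irr; apply/esym/negbTE; rewrite negb_or; apply/andP; split.
      by apply: contraTneq uv => ->; rewrite adj_irr.
    by apply: contraNneq vAC => ->; rewrite inE w2C orbT.
  - rewrite (negbTE (sv v t _ _)) ?in_setU1 ?eqxx ?tA ?orbT //.
    apply/esym/negbTE; rewrite negb_or; apply/andP; split.
      by apply: contraNneq uAC => <-; rewrite inE tA.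
    by apply: contraTneq tA => ->; rewrite (disjointFl AC w2C).
  have -> : (t == u) = false by apply: contraNF uAC => /eqP <-; rewrite inE tC orbT.
  by rewrite -[t == w2]in_set1 -yw /= inE tC /=; apply/idP/exists_inP => [vt|[a]];
    [exists v; rewrite ?inE | rewrite inE => /eqP->].
have [||f [f0 fE]] := @dependent_choice (fun _ => (G * G)%type) (fun _ p => good p.1 p.2)
  (fun _ p p' => [/\ p'.1 = p.2, good p.1 p.2, p'.2 != p.1 &
     forall t, t \in T -> adj p.2 t = (t == p.1) || (t == p'.2)]) (x, y).
- by exists A, C.
- move=> _ [u v] /= uv; have [w [vw wu adjv]] := step u v uv.
  by exists (v, w); split.
pose s i := (f i).1.
have sS i : s i.+1 = (f i).2 by case: (fE i).
have sT i : s i \in T.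
  by case: (fE i) => _ [A' [C' [_ <-]]] _ _; rewrite setU11.
have [||m [m3 cyc clos]] := @walk_cycle G T s sT.
- by move=> i; rewrite !sS; have [_ _] := fE i; rewrite -sS /s; case: (fE i.+1) => ->.
- by move=> i t tT; rewrite !sS; case: (fE i) => _ _ _ /(_ t tT).
suff <- : m = (2 * q + 3)%N by exists s.
rewrite -(card_split sp0) -/T; pose K := [set s (i : 'I_m) | i : 'I_m].
have -> : m = #|K|.
  rewrite card_imset ?card_ord // => i k; have [inj _] := cyc.
  case: (ltngtP i k) => ik E; last exact: val_inj.
    by have := inj i k; rewrite ik ltn_ord E eqxx => /(_ isT).
  by have := inj k i; rewrite ik ltn_ord E eqxx => /(_ isT).
congr #|pred_of_set _|; apply/eqP; rewrite eqEsubset; apply/andP; split.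
  by apply/subsetP=> _ /imsetP[i _ ->].
have inK i : (i < m)%N -> s i \in K by move=> im; apply/imsetP; exists (Ordinal im).
apply: split_connected q1 sp0 _ _ _.
- by have := inK 0%N; rewrite /s f0; apply; lia.
- by have := inK 1%N; rewrite sS f0; apply; lia.
move=> u v /imsetP[i _ ->] vT iv; have [k km ->] := clos i v (ltn_ord i) vT iv.
exact: inK.
Qed.

(** * Lifting vertex sets from a contracted graph *)

Section GraphContraction.
Variables (G : sgraph) (a b : G).
Hypothesis ab : adj a b.
Local Notation e := [set a; b].
Local Notation H := (gcontract [set a; b]).
Local Notation p := (@cproj G [set a; b] : G -> H).

Lemma ab_neq : a != b.
Proof. by apply: contraTneq ab => ->; rewrite adj_irr. Qed.

Lemma cproj_a : p a = None.
Proof. by apply/eqP; rewrite cproj_None set21. Qed.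

Lemma cproj_b : p b = None.
Proof. by apply/eqP; rewrite cproj_None set22. Qed.

Lemma adj_cproj u v : u \notin e -> v \notin e -> adj (p u) (p v) = adj u v.
Proof.
move=> ue ve.
have /= -> := cproj_Some (exist (fun x => x \notin e) u ue).
by have /= -> := cproj_Some (exist (fun x => x \notin e) v ve).
Qed.

Lemma adj_cproj_None u : u \notin e -> adj (p u) (None : H) = adj u a || adj u b.
Proof.
move=> ue; have /= -> := cproj_Some (exist (fun x => x \notin e) u ue).
rewrite /=; apply/exists_inP/orP => [[c]|].
  by rewrite !inE => /orP[]/eqP->; [left | right].
by case; [exists a | exists b]; rewrite ?set21 ?set22.
Qed.

Lemma cproj_e u : u \in e -> p u = None.
Proof. by move=> ue; apply/eqP; rewrite cproj_None. Qed.

Lemma cproj_adj u v : adj u v -> ~~ ((u \in e) && (v \in e)) -> adj (p u) (p v).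
Proof.
have half w w' : adj w w' -> w \notin e -> w' \in e -> adj (p w) (None : H).
  move=> ww we; rewrite !inE adj_cproj_None // => /orP[]/eqP<-; rewrite ww //.
  by rewrite orbT.
move=> uv; have [ue | ue] := boolP (u \in e); have [ve | ve] := boolP (v \in e) => nuv.
- by case/negP: nuv.
- by rewrite (cproj_e ue) adj_sym; apply: half ve ue; rewrite adj_sym.
- by rewrite (cproj_e ve); apply: half ue ve.
- by rewrite adj_cproj.
Qed.

Lemma stable_cproj (X : {set H}) (B : {set G}) :
  stable X -> (forall v, v \in B -> p v \in X) -> ~~ (e \subset B) -> stable B.
Proof.
move=> sX BX eB u v uB vB; apply/negP=> uv.
have := sX _ _ (BX u uB) (BX v vB); rewrite cproj_adj //.
apply: contra eB; rewrite !inE subUset !sub1set.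
have uv' : u != v by apply: contraTneq uv => ->; rewrite adj_irr.
case/andP=> /orP[]/eqP Eu /orP[]/eqP Ev; subst u v; rewrite ?uB ?vB //.
  by rewrite eqxx in uv'.
by rewrite eqxx in uv'.
Qed.

Definition clift (X : {set H}) : {set G} := [set v | (v \notin e) && (p v \in X)].

Lemma clift_sub (X : {set H}) v : v \in clift X -> p v \in X.
Proof. by rewrite inE => /andP[]. Qed.

Lemma clift_e (X : {set H}) : e :&: clift X = set0.
Proof. by apply/setP=> v; rewrite !inE; case: (_ || _). Qed.

Lemma clift_a (X : {set H}) : a \notin clift X.
Proof. by rewrite !inE eqxx. Qed.

Lemma clift_b (X : {set H}) : b \notin clift X.
Proof. by rewrite !inE eqxx orbT. Qed.

Lemma imset_clift (X : {set H}) : p @: clift X = X :\ None.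
Proof.
apply/setP=> y; rewrite in_setD1; apply/imsetP/andP => [[v + ->]|].
  by rewrite inE => /andP[ve vX]; rewrite cproj_None.
case: y => [x|] [// _ xX]; exists (val x); last by rewrite cproj_Some.
by rewrite inE cproj_Some xX (valP x).
Qed.

Lemma cproj_inj_out (B : {set G}) : e :&: B = set0 -> {in B &, injective p}.
Proof.
move=> eB u v uB vB /eqP; rewrite cproj_eq => [/eqP //|].
by apply/negP=> ue; have /setP/(_ u) := eB; rewrite in_setI in_set0 ue uB.
Qed.

Lemma card_clift (X : {set H}) : #|clift X| = #|X :\ None|.
Proof. by rewrite -imset_clift card_in_imset //; apply/cproj_inj_out/clift_e. Qed.

Lemma card_clift_notin (X : {set H}) : None \notin X -> #|clift X| = #|X|.
Proof.
move=> nX; rewrite card_clift; congr #|pred_of_set _|.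
by apply/setDidPl; rewrite disjoint_sym disjoints1.
Qed.

(** A vertex outside [e] is adjacent to the new vertex as soon as it is adjacent
    to one endpoint, hence the condition that [S] contains both or neither. *)
Lemma card_nbr_cproj (S : {set G}) (W : {set H}) : None \notin W ->
    (e :&: S = set0 \/ e \subset S) ->
  #|nbr S (clift W)| = #|nbr (p @: S) W|.
Proof.
move=> nW eS; rewrite -(card_in_imset (f := p)); last first.
  apply: cproj_inj_out; apply/setP=> v; rewrite in_setI in_set0; apply/negP=> /andP[ve].
  by move/nbrP=> [+ _]; rewrite inE ve.
congr #|pred_of_set _|; apply/setP=> y; apply/imsetP/nbrP => [[w]|[yW [_ /imsetP[u uS ->] uy]]].
  case/nbrP; rewrite inE => /andP[we wW] [u uS uw] ->; split=> //.
  by exists (p u); rewrite ?imset_f // cproj_adj // (negPf we) andbF.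
case: y yW uy => [x|] xW; last by rewrite xW in nW.
have xe := valP x; rewrite -(cproj_Some x) => ux; exists (val x) => //; apply/nbrP.
split; first by rewrite inE xe cproj_Some.
have [ue | ue] := boolP (u \in e); last by exists u; rewrite // -adj_cproj.
case: eS => [/setP/(_ u)|]; first by rewrite in_setI in_set0 ue uS.
rewrite subUset !sub1set => /andP[aS bS].
move: ux; rewrite (cproj_e ue) adj_sym adj_cproj_None // => /orP[] xc;
  by [exists a; rewrite // adj_sym | exists b; rewrite // adj_sym].
Qed.

Lemma disjoint_clift (X Y : {set H}) : [disjoint X & Y] -> [disjoint clift X & clift Y].
Proof.
move=> XY; apply: disjointI => v; rewrite !inE => /andP[ve vX].
by rewrite ve (disjointFr XY vX).
Qed.

Lemma cover_clique_contract q (F : {set G}) :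
  union_of_cliques q F -> union_of_cliques q (p @: F).
Proof.
move=> [C [cC ->]]; exists (fun i => p @: C i); split.
  move=> i _ _ /imsetP[u uC ->] /imsetP[v vC ->] puv; apply: cproj_adj.
    by apply: (cC i) => //; apply: contraNneq puv => ->.
  by apply: contra puv => /andP[ue ve]; rewrite !cproj_e.
apply/setP=> y; apply/imsetP/bigcupP => [[x /bigcupP[i _ xC] ->]|[i _]].
  by exists i => //; apply: imset_f.
by case/imsetP=> x xC ->; exists x => //; apply/bigcupP; exists i.
Qed.

End GraphContraction.

(** * Clique covers of a contracted graph *)

Section ContractCover.
Variables (q : nat) (G : sgraph) (a b : G).
Hypothesis ab : adj a b.
Hypothesis wp : weakly_perfect q G.
Hypothesis free : elementary_free q G.
Local Notation e := [set a; b].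
Local Notation H := (gcontract [set a; b]).
Local Notation p := (@cproj G [set a; b] : G -> H).

(** The vertices of [Xa] lie in every stable set of size above [q] in [a |: B],
    and likewise for [b].  If the differences were larger, they would form an
    elementary bipartite graph: a nonexpanding set [S] yields another large
    stable set [J], which misses a compulsory vertex on one of the two sides. *)
Lemma tight_pair (B Xa Xb I1 I2 : {set G}) :
    a \notin B -> b \notin B ->
    (forall x, x \in B -> x \in Xa \/ x \in Xb) ->
    (forall I : {set G}, I \subset a |: B -> stable I -> (q < #|I|)%N -> a |: Xa \subset I) ->
    (forall I : {set G}, I \subset b |: B -> stable I -> (q < #|I|)%N -> b |: Xb \subset I) ->
    I1 \subset a |: B -> stable I1 -> #|I1| = q.+1 ->
    I2 \subset b |: B -> stable I2 -> #|I2| = q.+1 ->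
  I1 :\: I2 = [set a] /\ I2 :\: I1 = [set b].
Proof.
move=> aB bB Bab Ta Tb I1B sI1 cI1 I2B sI2 cI2.
have anb := ab_neq ab.
have := Ta I1 I1B sI1; rewrite cI1 ltnSn subUset sub1set => /(_ isT)/andP[aI1 XaI1].
have := Tb I2 I2B sI2; rewrite cI2 ltnSn subUset sub1set => /(_ isT)/andP[bI2 XbI2].
have aI2 : a \notin I2.
  by apply: contra aB => /(subsetP I2B); rewrite in_setU1 (negPf anb).
have bI1 : b \notin I1.
  by apply: contra bB => /(subsetP I1B); rewrite in_setU1 eq_sym (negPf anb).
pose U := I1 :\: I2; pose W := I2 :\: I1; pose Z := I1 :&: I2.
have cU : (#|Z| + #|U|)%N = q.+1 by rewrite cardsID.
have cW : (#|Z| + #|W|)%N = q.+1 by rewrite /Z setIC cardsID.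
have aU : a \in U by rewrite inE aI1 aI2.
have bW : b \in W by rewrite inE bI2 bI1.
have UXa : U \subset a |: Xa.
  apply/subsetP=> x; rewrite !inE => /andP[xI2 xI1].
  have := subsetP I1B x xI1; rewrite !in_setU1 => /orP[->//|/Bab[->|xb]]; rewrite ?orbT //.
  by rewrite (subsetP XbI2) in xI2.
have WXb : W \subset b |: Xb.
  apply/subsetP=> x; rewrite !inE => /andP[xI1 xI2].
  have := subsetP I2B x xI2; rewrite !in_setU1 => /orP[->//|/Bab[xa|->]]; rewrite ?orbT //.
  by rewrite (subsetP XaI1) in xI1.
have UZ : U :|: Z = I1 by rewrite setUC setID.
have WZ : W :|: Z = I2 by rewrite /Z setUC setIC setID.
have U1 : (0 < #|U|)%N by rewrite card_gt0; apply/set0Pn; exists a.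
suff cU1 : #|U| = 1%N.
  have cW1 : #|W| = 1%N by move: cU cW cU1; clear; lia.
  split; apply/esym/eqP.
    by rewrite eqEcard sub1set aU cards1 cU1.
  by rewrite eqEcard sub1set bW cards1 cW1.
apply/eqP; rewrite eqn_leq U1 andbT leqNgt; apply/negP=> U2.
have UW : [disjoint U & W].
  by apply: disjointI => x; rewrite !inE negb_and negbK => /andP[_ ->].
apply: (free (j := #|U|.-1) (U := U) (W := W) (Z := Z)).
- by move: cU U2; clear; lia.
- by rewrite prednK.
- by rewrite prednK //; move: cU cW; clear; lia.
- by move: cU U2; clear; lia.
- exact: UW.
- by apply: disjointI => x; rewrite !inE => /andP[/negPf->]; rewrite andbF.
- by apply: disjointI => x; rewrite !inE => /andP[/negPf->].
- by rewrite UZ.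
- by rewrite WZ.
move=> S S0 /properP[SU [s sU sS]]; rewrite ltnNge; apply/negP=> cN.
have S1 : (0 < #|S|)%N by rewrite card_gt0.
(* Trading the neighbours of [S] for [S] does not make [I2] smaller. *)
pose J := S :|: ((W :\: nbr S W) :|: Z).
have sJ : stable J.
  apply: stableU.
  - by apply: stableS sI1; rewrite (subset_trans SU) ?subsetDl.
  - apply: stableS sI2; rewrite subUset subsetIr andbT.
    exact: subset_trans (subsetDl _ _) (subsetDl _ _).
  move=> u v uS /setUP[|vZ].
    rewrite inE => /andP[vN vW]; apply: contra vN => uv.
    by apply/nbrP; split=> //; exists u.
  apply: sI1; last by case/setIP: vZ.
  by have := subsetP SU u uS; rewrite inE => /andP[].
have cNW := cardsID (nbr S W) W; rewrite (setIidPr (nbr_sub _ _)) in cNW.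
have cJ : (#|J| = #|S| + (#|W :\: nbr S W| + #|Z|))%N.
  have d1 : [disjoint W :\: nbr S W & Z].
    by apply: disjointI => x; rewrite !inE => /and3P[_ /negPf->].
  have d2 : [disjoint S & (W :\: nbr S W) :|: Z].
    apply: disjointI => x /(subsetP SU) xU; rewrite in_setU in_setD (disjointFr UW xU) andbF.
    by move: xU; rewrite !inE => /andP[/negPf->]; rewrite andbF.
  by rewrite cardsU (disjoint_setI0 d2) cards0 subn0 cardsU (disjoint_setI0 d1) cards0 subn0.
have cJq : (q < #|J|)%N by move: cJ cNW cU cW cN; clear; lia.
have I1B' x : x \in I1 -> x != a -> x \in B.
  by move=> /(subsetP I1B); rewrite in_setU1 => /orP[->|//].
have I2B' x : x \in I2 -> x != b -> x \in B.
  by move=> /(subsetP I2B); rewrite in_setU1 => /orP[->|//].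
have ZB : Z \subset B.
  apply/subsetP=> x /setIP[xI1 xI2]; apply: I1B' => //.
  by apply: contraNneq aI2 => <-.
have [aS | aS] := boolP (a \in S).
  have JB : J \subset a |: B.
    rewrite !subUset (subset_trans ZB (subsetUr _ _)) andbT; apply/andP; split.
      by apply: subset_trans SU (subset_trans (subsetDl _ _) I1B).
    apply/subsetP=> x; rewrite in_setD in_setU1 => /andP[xN xW].
    rewrite I2B' ?orbT //; first by move: xW; rewrite inE => /andP[].
    apply: contraNneq xN => ->; apply/nbrP; split=> //.
    by exists a.
  have := subsetP (subset_trans UXa (Ta J JB sJ cJq)) s sU.
  rewrite in_setU (negPf sS) in_setU in_setD (disjointFr UW sU) andbF /=.
  by move: sU; rewrite !inE => /andP[/negPf->]; rewrite andbF.
have JB : J \subset b |: B.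
  rewrite !subUset (subset_trans ZB (subsetUr _ _)) andbT; apply/andP; split.
    apply/subsetP=> x xS; rewrite in_setU1 I1B' ?orbT //.
      by have := subsetP SU x xS; rewrite inE => /andP[].
    by apply: contraNneq aS => <-.
  exact: subset_trans (subsetDl _ _) (subset_trans (subsetDl _ _) I2B).
have WJ := subset_trans WXb (Tb J JB sJ cJq).
have N0 : nbr S W = set0.
  apply/setP=> w; rewrite in_set0; apply/negP=> wN.
  have wW := subsetP (nbr_sub _ _) w wN; have := subsetP WJ w wW.
  rewrite in_setU in_setU in_setD wN /= => /orP[wS|wZ].
    by rewrite (disjointFr UW (subsetP SU w wS)) in wW.
  by move: wW wZ; rewrite !inE => /andP[/negPf->].
have cJb := cardsD1 b J; rewrite (subsetP WJ b bW) in cJb.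
have cJb' : (q < #|J :\ b|)%N.
  by move: cJ cNW cW cJb S1; rewrite N0 cards0; clear; lia.
have := Tb (J :\ b) (subset_trans (subsetDl _ _) JB) (stableS (subsetDl _ _) sJ) cJb'.
by rewrite subUset sub1set setD11.
Qed.

(** Covered sets of [G/e] include the images of covered sets of [G], so it is
    enough to study a minimal set [M] that is not such an image.  Minimality says
    that every vertex of [B] can be dropped from [a |: B] or from [b |: B] to make
    it covered, hence lies in all large stable sets of one of the two. *)
Lemma weakly_perfect_contract : weakly_perfect q H.
Proof.
move=> A alphaA; apply/union_of_cliquesP/negPn/negP => /union_of_cliquesP nA.
pose D := secant q (clique_complex G).
have Dsub (F F' : {set G}) : F \in D -> F' \subset F -> F' \in D.
  move=> /union_of_cliquesP[C [cC ->]] F'C; apply/union_of_cliquesP.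
  exists (fun i => C i :&: F'); split.
    by move=> i x y /setIP[xC _] /setIP[yC _]; apply: (cC i).
  by rewrite -big_distrl /=; apply/esym/setIidPr.
pose P (M : {set H}) := [forall F in D, p @: F != M].
have PA : P A.
  apply/forall_inP=> F /union_of_cliquesP FD; apply/eqP=> FA; apply: nA.
  by rewrite -FA; apply: cover_clique_contract.
have [M /minsetP[PM minM] MA] := minset_exists PA.
have alpha (I : {set H}) : I \subset M -> stable I -> (#|I| <= q)%N.
  by move=> IM; apply: alphaA; apply: subset_trans MA.
have nD (F : {set G}) : p @: F = M -> F \notin D.
  by move=> FM; apply/negP=> FD; have /forall_inP/(_ F FD) := PM; rewrite FM eqxx.
have minD y : y \in M -> exists2 F : {set G}, F \in D & p @: F = M :\ y.
  move=> yM; have [/existsP[F /andP[FD /eqP FE]]|] := boolP [exists F : {set G}, (F \in D) && (p @: F == M :\ y)].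
    by exists F.
  move=> noF; have /setP/(_ y) : M :\ y = M.
    apply: minM (subsetDl _ _); apply/forall_inP=> F FD; apply: contra noF => FE.
    by apply/existsP; exists F; rewrite FD.
  by rewrite setD11 yM.
have stable_im (I : {set G}) : e :&: I = set0 -> stable I -> stable (p @: I).
  move=> eI sI _ _ /imsetP[u uI ->] /imsetP[v vI ->].
  have out w : w \in I -> w \notin e.
    by move=> wI; apply/negP=> we; have /setP/(_ w) := eI; rewrite in_setI in_set0 we wI.
  by rewrite adj_cproj ?out //; apply: sI.
have get_stable (F : {set G}) : F \notin D -> exists I : {set G}, [/\ I \subset F, stable I & #|I| = q.+1].
  by move=> FD; apply: not_stableW wp _; move/union_of_cliquesP; apply/negP.
pose B := clift M.
have eB : e :&: B = set0 := clift_e M.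
have pB : p @: B = M :\ None := imset_clift M.
have [NM | NM] := boolP (None \in M); last first.
  have pBM : p @: B = M by rewrite pB; apply/setDidPl; rewrite disjoint_sym disjoints1.
  have [I [IB sI cI]] := get_stable B (nD B pBM).
  have eI : e :&: I = set0.
    by apply/eqP; rewrite -subset0 -eB; apply: setIS.
  have := alpha (p @: I); rewrite -{1}pBM imsetS // => /(_ isT (stable_im I eI sI)).
  by rewrite card_in_imset ?cI ?ltnn //; apply: cproj_inj_out.
have pcB c : c \in e -> p @: (c |: B) = M.
  by move=> ce; rewrite imsetU1 pB (cproj_e ce) setD1K.
have sub_im (F : {set G}) y : p @: F = M :\ y -> forall v, v \in B -> p v != y -> v \in F.
  move=> FE v vB vy; have ve : v \notin e by move: vB; rewrite inE => /andP[].
  by rewrite -(mem_cproj F ve) FE in_setD1 vy (clift_sub vB).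
have BD : B \in D.
  have [F FD FE] := minD None NM; apply: Dsub FD _; apply/subsetP=> v vB.
  apply: (sub_im F None) => //; rewrite cproj_None.
  by move: vB; rewrite inE => /andP[].
pose X c := [set x in B | c |: (B :\ x) \in D].
have Bab x : x \in B -> x \in X a \/ x \in X b.
  move=> xB; have xe : x \notin e by move: xB; rewrite inE => /andP[].
  have [F FD FE] := minD (p x) (clift_sub xB).
  have BxF : B :\ x \subset F.
    apply/subsetP=> v /setD1P[vx vB]; apply: (sub_im F (p x)) => //.
    by rewrite eq_sym cproj_eq // eq_sym.
  have : None \in p @: F by rewrite FE in_setD1 NM andbT eq_sym cproj_None.
  rewrite None_cproj => /set0Pn[c /setIP[cF ce]].
  have cD : c |: B :\ x \in D by apply: Dsub FD _; rewrite subUset sub1set cF.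
  have xXc : x \in X c by rewrite inE xB.
  by move: ce; rewrite !(in_setU1, in_set1) => /orP[]/eqP cE; move: xXc; rewrite cE; [left | right].
have tight c : c \in e -> forall I : {set G}, I \subset c |: B -> stable I -> (q < #|I|)%N -> c |: X c \subset I.
  move=> ce I IcB sI cI; have cov (F : {set G}) : F \in D -> ~~ (I \subset F).
    move=> /union_of_cliquesP FD; apply/negP=> IF.
    by have := stable_union_of_cliques FD IF sI; rewrite leqNgt cI.
  apply/subsetP=> x; rewrite in_setU1 inE => xX; apply: contraT => xI.
  case/orP: xX => [/eqP xc|/andP[xB xD]].
    case/negP: (cov B BD); apply/subsetP=> v vI; have := subsetP IcB v vI.
    by rewrite in_setU1 => /orP[/eqP vc|//]; rewrite xc -vc vI in xI.
  case/negP: (cov _ xD); apply/subsetP=> v vI; have := subsetP IcB v vI.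
  rewrite !in_setU1 in_setD1 => /orP[->//|->]; rewrite andbT.
  by apply/orP; right; apply: contraNneq xI => <-.
have [I1 [I1B sI1 cI1]] := get_stable _ (nD _ (pcB a (set21 a b))).
have [I2 [I2B sI2 cI2]] := get_stable _ (nD _ (pcB b (set22 a b))).
have [UE WE] := tight_pair (clift_a M) (clift_b M) Bab (tight a (set21 a b))
  (tight b (set22 a b)) I1B sI1 cI1 I2B sI2 cI2.
have aI1 : a \in I1 by have := set11 a; rewrite -UE inE => /andP[].
have bI2 : b \in I2 by have := set11 b; rewrite -WE inE => /andP[].
have X1 : a |: X a \subset I1 by apply: tight; rewrite ?set21 ?cI1.
have X2 : b |: X b \subset I2 by apply: tight; rewrite ?set22 ?cI2.
have BI1 : B \subset I1 :&: I2.
  apply/subsetP=> x xB; have xe : x \notin e by move: xB; rewrite inE => /andP[].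
  move: xe; rewrite !inE negb_or => /andP[xa xb].
  case: (Bab x xB) => xX.
    have xI1 : x \in I1 by apply: (subsetP X1); rewrite in_setU1 xX orbT.
    rewrite xI1 /=; apply: contraNT xa => xI2.
    by rewrite -in_set1 -UE inE xI1 xI2.
  have xI2 : x \in I2 by apply: (subsetP X2); rewrite in_setU1 xX orbT.
  rewrite xI2 andbT; apply: contraNT xb => xI1.
  by rewrite -in_set1 -WE inE xI1 xI2.
(* [B] lies in both [I1] and [I2], so its vertices are adjacent neither to [a]
   nor to [b], and [M] is stable. *)
have : (#|M| <= q)%N.
  apply: alpha => // y z yM zM.
  have nNone w : w \in B -> ~~ adj (p w) (None : H).
    move=> wB; have we : w \notin e by move: wB; rewrite inE => /andP[].
    have /setIP[w1 w2] := subsetP BI1 w wB.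
    by rewrite adj_cproj_None // negb_or sI1 //= sI2.
  have MB w : w \in M -> w != None -> exists2 v, v \in B & w = p v.
    move=> wM wN; have : w \in p @: B by rewrite pB in_setD1 wN.
    by case/imsetP=> v; exists v.
  have [-> | yN] := eqVneq y None; have [-> | zN] := eqVneq z None.
  - by rewrite adj_irr.
  - by have [v vB ->] := MB z zM zN; rewrite adj_sym nNone.
  - by have [v vB ->] := MB y yM yN; rewrite nNone.
  have [u uB ->] := MB y yM yN; have [v vB ->] := MB z zM zN.
  apply: stable_im eB _ _ _ (imset_f _ uB) (imset_f _ vB).
  exact: stableS (subset_trans BI1 (subsetIl _ _)) sI1.
have -> : #|M| = #|I1|.
  have -> : I1 = a |: B.
    apply/eqP; rewrite eqEsubset I1B subUset sub1set aI1.
    exact: subset_trans BI1 (subsetIl _ _).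
  by rewrite cardsU1 (clift_a M) (cardsD1 None M) NM -pB card_in_imset //; apply: cproj_inj_out.
by rewrite cI1 ltnn.
Qed.

End ContractCover.

(** * Elementary bipartite subgraphs of a contracted graph *)

Lemma elementary_transfer q (G H : sgraph) (s : H -> G) j (U W Z : {set H}) :
    injective s -> elementary_free q G ->
    {in U :|: W :|: Z &, forall x y, adj (s x) (s y) = adj x y} ->
    (1 <= j <= q)%N -> #|U| = j.+1 -> #|W| = j.+1 -> #|Z| = (q - j)%N ->
    [disjoint U & W] -> [disjoint U & Z] -> [disjoint W & Z] ->
    stable (U :|: Z) -> stable (W :|: Z) -> ~ expands U W.
Proof.
move=> sinj free sadj jq cU cW cZ UW UZ WZ sUZ sWZ expU.
have cs (X : {set H}) : #|s @: X| = #|X| by apply: card_imset.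
have dis (X Y : {set H}) : [disjoint X & Y] -> [disjoint s @: X & s @: Y].
  move=> XY; apply: disjointI => _ /imsetP[x xX ->].
  by rewrite mem_imset // (disjointFr XY xX).
have st (X Y : {set H}) : X :|: Y \subset U :|: W :|: Z -> stable (X :|: Y) -> stable (s @: X :|: s @: Y).
  move=> /subsetP sub sX; rewrite -imsetU => _ _ /imsetP[x xX ->] /imsetP[y yX ->].
  by rewrite sadj ?sub //; apply: sX.
apply: (free j (s @: U) (s @: W) (s @: Z)); rewrite ?cs ?dis //.
- by apply: st => //; apply/setSU/subsetUl.
- by apply: st => //; apply/setSU/subsetUr.
move=> S S0 /properP[SU [_ /imsetP[u uU ->] uS]].
pose S' := s @^-1: S; have SE : S = s @: S'.
  apply/setP=> y; apply/idP/imsetP => [yS|[x]]; last by rewrite inE => xS ->.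
  by have /imsetP[x xU yE] := subsetP SU y yS; exists x; rewrite // inE -yE.
have S'U : S' \subset U.
  by apply/subsetP=> x; rewrite inE => /(subsetP SU); rewrite mem_imset.
have NE : s @: nbr S' W \subset nbr S (s @: W).
  apply/subsetP=> _ /imsetP[w /nbrP[wW [x xS xw]] ->].
  apply/nbrP; split; first exact: imset_f.
  exists (s x); first by rewrite inE in xS.
  by rewrite sadj // !inE ?wW ?(subsetP S'U x xS) ?orbT.
rewrite [X in (X < _)%N](_ : _ = #|S'|); last by rewrite SE cs.
apply: leq_trans (subset_leq_card NE); rewrite cs; apply: expU.
  by rewrite -card_gt0 -cs -SE card_gt0.
by apply/properP; split=> //; exists u; rewrite // inE.
Qed.

Section ContractElementary.
Variables (q : nat) (G : sgraph) (a b : G).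
Hypothesis ab : adj a b.
Hypothesis wp : weakly_perfect q G.
Hypothesis free : elementary_free q G.
Hypothesis nocyc : forall t : nat -> G, ~ cycle_seq (2 * q + 3) t.
Local Notation e := [set a; b].
Local Notation H := (gcontract [set a; b]).
Local Notation p := (@cproj G [set a; b] : G -> H).

(** A section of the quotient map that represents the new vertex by [c]. *)
Definition csec (c : G) (y : H) : G := if y is Some x then val x else c.

Lemma cproj_csec c y : c \in e -> p (csec c y) = y.
Proof. by move=> ce; case: y => [x|] /=; [apply: cproj_Some | apply: cproj_e]. Qed.

Lemma csec_inj c : c \in e -> injective (csec c).
Proof. by move=> ce x y xy; rewrite -(cproj_csec x ce) -(cproj_csec y ce) xy. Qed.

Lemma adj_csec_out c (x y : H) : x != None -> y != None -> adj (csec c x) (csec c y) = adj x y.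
Proof. by case: x y => [x|] [y|]. Qed.

(** Here the new vertex lies in [U]; its preimage is the edge [ab]. *)
Lemma contract_split (j : nat) (U W Z : {set H}) :
    (1 <= j <= q)%N -> #|U| = j.+1 -> #|W| = j.+1 -> #|Z| = (q - j)%N ->
    [disjoint U & W] -> [disjoint U & Z] -> [disjoint W & Z] ->
    stable (U :|: Z) -> stable (W :|: Z) -> None \in U -> ~ expands U W.
Proof.
move=> jq cU cW cZ UW UZ WZ sUZ sWZ NU expU; have anb := ab_neq ab.
have NW : None \notin W by rewrite (disjointFr UW NU).
have NZ : None \notin Z by rewrite (disjointFr UZ NU).
pose A := clift U; pose C := clift W; pose Y := clift Z.
have cA : #|A| = j by rewrite card_clift; move: (cardsD1 None U); rewrite NU cU add1n => -[].
have cC : #|C| = j.+1 by rewrite card_clift_notin.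
have cY : #|Y| = (q - j)%N by rewrite card_clift_notin.
have eA : e :&: A = set0 := clift_e U.
have neS (c : G) B : c \in e -> e :&: B = set0 -> ~~ (e \subset c |: B).
  move=> ce eB; have nB v : v \in e -> v \notin B.
    by move=> ve; apply/negP=> vB; have /setP/(_ v) := eB; rewrite in_setI in_set0 ve vB.
  rewrite subUset !sub1set !in_setU1 !(negPf (nB _ _)) ?set21 ?set22 // !orbF.
  by apply/negP=> /andP[/eqP <- /eqP E]; rewrite E eqxx in anb.
have inA v : v \in A -> p v \in U := @clift_sub _ _ _ U v.
have sAc c : c \in e -> stable (c |: A).
  move=> ce; apply: (stable_cproj (stableS (subsetUl U Z) sUZ)) (neS c A ce eA).
  by move=> v /setU1P[-> | /inA //]; rewrite cproj_e.
have sC : stable C.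
  apply: (stable_cproj (stableS (subsetUl W Z) sWZ) (@clift_sub _ _ _ W)).
  by rewrite subUset sub1set (negPf (clift_a W)).
have sY : stable Y.
  apply: (stable_cproj (stableS (subsetUr W Z) sWZ) (@clift_sub _ _ _ Z)).
  by rewrite subUset sub1set (negPf (clift_a Z)).
have pS (S : {set G}) : S \subset A -> p @: S \subset U :\ None.
  by move=> SA; have := imsetS p SA; rewrite imset_clift.
have eS (S : {set G}) : S \subset A -> e :&: S = set0.
  by move=> SA; apply/eqP; rewrite -subset0 -eA setIS.
have pSP (S : {set G}) : S \subset A -> p @: S \proper U.
  move=> SA; apply/properP; split; first exact: subset_trans (pS S SA) (subsetDl _ _).
  by exists None; rewrite // None_cproj setIC (eS S SA) eqxx.
have sp : split_elementary j a b A C.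
  split.
  - split; [exact: ab | by rewrite in_setU negb_or !clift_a
           | by rewrite in_setU negb_or !clift_b | exact: disjoint_clift].
  - by [].
  - by split=> //; apply: sAc; rewrite ?set21 ?set22.
  - move=> S S0 SA; rewrite card_nbr_cproj //; last by left; apply: eS.
    rewrite -(card_in_imset (cproj_inj_out (eS S SA))); apply: expU (pSP S SA).
    by rewrite -card_gt0 card_in_imset ?card_gt0 //; apply/cproj_inj_out/eS.
  move=> S /properP[SA [v vA vS]]; rewrite card_nbr_cproj ?subsetUr //; last by right.
  have pE : p @: (S :|: e) = None |: p @: S.
    by rewrite imsetU imsetU1 imset_set1 cproj_a cproj_b setUid [LHS]setUC.
  rewrite pE; have NS : None \notin p @: S by rewrite None_cproj setIC (eS S SA) eqxx.
  have -> : #|S|.+1 = #|None |: p @: S|.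
    by rewrite cardsU1 NS card_in_imset //; apply/cproj_inj_out/eS.
  apply: expU; first by apply/set0Pn; exists None; rewrite setU11.
  have ve : v \notin e by move: vA; rewrite inE => /andP[].
  apply/properP; split.
    by rewrite subUset sub1set NU (subset_trans (pS S SA)) ?subsetDl.
  exists (p v); first exact: inA.
  by rewrite in_setU1 mem_cproj // negb_or cproj_None ve.
have iY : isolated Y (a |: (b |: (A :|: C))).
  have pT v : v \in a |: (b |: (A :|: C)) -> p v \in U \/ p v \in W.
    case/setU1P=> [->|/setU1P[->|/setUP[vA|vC]]]; rewrite ?cproj_a ?cproj_b; auto.
    by right; apply: clift_sub.
  split=> //.
    apply: disjointI => v /pT pv; rewrite inE negb_and; apply/orP; right.
    by case: pv => [vU|vW]; rewrite ?(disjointFr UZ vU) ?(disjointFr WZ vW).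
  move=> t y /pT pt yY; have ye : y \notin e by move: yY; rewrite inE => /andP[].
  apply/negP=> ty; have : adj (p t) (p y) by apply: cproj_adj => //; rewrite (negPf ye) andbF.
  have yZ : p y \in Z := clift_sub yY.
  apply/negP; case: pt => [tU|tW]; [apply: sUZ | apply: sWZ]; by rewrite inE ?tU ?tW ?yZ ?orbT.
have /andP[j1 jleq] := jq; have [jltq | qj] := ltnP j q.
  by apply: (split_lt _ wp free sp iY cY); rewrite j1.
have jE : j = q by apply/eqP; rewrite eqn_leq jleq.
rewrite jE in sp j1; have [t] := split_cycle j1 free sp.
exact: nocyc.
Qed.

(** Away from the new vertex the graph lifts to [G]; if the new vertex is one of
    the isolated ones, then [a] can stand for it. *)
Lemma elementary_free_contract : elementary_free q H.
Proof.
move=> j U W Z jq cU cW cZ UW UZ WZ sUZ sWZ expU.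
have [NU | NU] := boolP (None \in U).
  exact: (contract_split jq cU cW cZ UW UZ WZ sUZ sWZ NU expU).
have [NW | NW] := boolP (None \in W).
  apply: (contract_split jq cW cU cZ _ WZ UZ sWZ sUZ NW); first by rewrite disjoint_sym.
  by apply: expands_swap expU; rewrite ?cU ?cW //; case/andP: jq.
apply: (elementary_transfer (csec_inj (set21 a b)) free _ jq cU cW cZ UW UZ WZ sUZ sWZ expU).
have isoN (x : H) : x \in U :|: W :|: Z -> None \in Z -> ~~ adj x (None : H).
  by rewrite !inE => /orP[/orP[]|] xX NZ; [apply: sUZ | apply: sWZ | apply: sUZ];
    rewrite inE ?xX ?NZ ?orbT.
have isoa (x : H) : x \in U :|: W :|: Z -> None \in Z -> ~~ adj (csec a x) a.
  move=> xX NZ; have := isoN x xX NZ; apply: contra.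
  case: x {xX} => [x|] /= xa; last by rewrite adj_irr in xa.
  by apply/exists_inP; exists a; rewrite ?set21.
move=> x y xX yX; have NX (z : H) : z \in U :|: W :|: Z -> z = None -> None \in Z.
  by move=> + zN; rewrite zN !inE (negPf NU) (negPf NW).
have [xN | xN] := eqVneq x None.
  have NZ := NX x xX xN; rewrite adj_sym [RHS]adj_sym {2}xN (negPf (isoN y yX NZ)).
  by rewrite xN; apply/negbTE/isoa.
have [yN | yN] := eqVneq y None; last exact: adj_csec_out.
have NZ := NX y yX yN; rewrite {2}yN (negPf (isoN x xX NZ)) yN.
exact/negbTE/isoa.
Qed.

End ContractElementary.

(** * Cycles of a contracted graph, and the theorem *)

(** A cycle through the new vertex opens up at it: either one endpoint of the
    edge sees both neighbours, or the edge itself extends the cycle. *)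
Lemma cycle_contract n (G : sgraph) (a b : G) (g : cycle_graph n -> gcontract [set a; b]) :
    (3 < n)%N -> adj a b -> (forall t : nat -> G, ~ cycle_seq n t) ->
    (forall t : nat -> G, ~ cycle_seq n.+1 t) ->
  ~ embedding g.
Proof.
move=> n3 ab noC noC1 gE; have n2 : (2 < n)%N by apply: ltnW.
have n0 : (0 < n)%N by apply: leq_trans n2.
have [i0 i0E] : exists i0, (exists i, g i = None) -> g i0 = None.
  have [/existsP[i /eqP iN]|noN] := boolP [exists i, g i == None]; first by exists i.
  by exists (Ordinal n0) => -[i iN]; case/existsP: noN; exists i; rewrite iN.
have [t [tC t0 tg]] := embedding_cycle_seq i0 n2 gE.
have [tinj tadj] := tC.
have csecC c : c \in [set a; b] ->
    (forall i, (0 < i < n)%N -> adj (csec c (t 0)) (csec c (t i)) = adj (t 0) (t i)) ->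
    (forall i, (0 < i < n)%N -> t i != None) -> False.
  move=> ce adj0 tN; apply: (noC (fun i => csec c (t i))); split=> i k ik.
    by apply: contra (tinj i k ik) => /eqP/(csec_inj ce)->.
  rewrite -tadj //; case: i ik => [|i] ik; first exact: adj0.
  by apply: adj_csec_out; apply: tN; case/andP: ik => ik kn; rewrite ?(ltn_trans ik) // (leq_trans _ ik).
have [tN0 | tN0] := eqVneq (t 0) None; last first.
  have tN i : t i != None.
    apply: contra tN0 => /eqP tiN; rewrite t0; apply/eqP/i0E.
    by have [k tk] := tg i; exists k; rewrite -tk.
  by apply: (csecC a) => [|i _|i _]; rewrite ?set21 ?adj_csec_out ?tN.
have tN i : (0 < i < n)%N -> t i != None.
  by move=> ik; rewrite -tN0 eq_sym; apply: tinj.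
have adjN i : (0 < i < n)%N ->
    adj (None : gcontract [set a; b]) (t i) = (i == 1) || (i.+1 == n).
  by move=> ik; rewrite -tN0 tadj //= andTb.
pose v i := csec a (t i).
have vE c i : (0 < i < n)%N -> csec c (t i) = v i.
  by move=> /tN; rewrite /v; case: (t i).
have pv i : cproj [set a; b] (v i) = t i by apply: cproj_csec; apply: set21.
have vout i : (0 < i < n)%N -> v i \notin [set a; b].
  by move=> ik; rewrite -cproj_None pv; apply: tN.
have adj_v c i : c \in [set a; b] -> (0 < i < n)%N -> adj c (v i) -> (i == 1) || (i.+1 == n).
  move=> ce ik cv; rewrite -adjN // -pv -(cproj_e ce); apply: cproj_adj => //.
  by rewrite (negPf (vout i ik)) andbF.
have adj_ab i : (0 < i < n)%N -> (i == 1) || (i.+1 == n) -> adj a (v i) || adj b (v i).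
  move=> ik; rewrite -adjN // adj_sym -pv adj_cproj_None ?vout //.
  by rewrite adj_sym [adj _ b]adj_sym.
have n1 : (0 < n.-1 < n)%N by clear -n3; lia.
have both c : c \in [set a; b] -> adj c (v 1) -> ~~ adj c (v n.-1).
  move=> ce c1; apply/negP=> cn; apply: (csecC c ce) tN => i ik.
  rewrite tN0 adjN //= vE //; apply/idP/idP => [/(adj_v c i ce ik) //|].
  case/orP=> /eqP iE; first by rewrite iE.
  by rewrite (_ : i = n.-1) // -iE.
(* The longer cycle runs through [x], [v 1], ..., [v n.-1] and [y]. *)
have extend x y : x \in [set a; b] -> y \in [set a; b] -> adj x y ->
    adj x (v 1) -> ~~ adj x (v n.-1) -> adj y (v n.-1) -> ~~ adj y (v 1) -> False.
  move=> xe ye xy x1 xn yn y1.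
  have neq c i : c \in [set a; b] -> (0 < i < n)%N -> c != v i.
    by move=> ce ik; apply: contraTneq ce => ->; apply: vout.
  apply: (noC1 (fun i => if i == n then y else if i == 0 then x else v i)).
  split=> i k /andP[ik kn].
    have [kE|kE] := eqVneq k n.
      rewrite ifN; last by clear -ik kE; lia.
      case: (posnP i) => [_|i0']; first by apply: contraTneq xy => ->; rewrite adj_irr.
      rewrite eq_sym neq //; first by clear -i0' ik kE; lia.
    have kn' : (k < n)%N by clear -kn kE; lia.
    have -> : (i == n) = false by clear -ik kn'; lia.
    have -> : (k == 0) = false by clear -ik; lia.
    case: (posnP i) => [i0'|i0']; first by rewrite neq //; clear -ik kn'; lia.
    have := tinj i k; rewrite ik kn' => /(_ isT); apply: contra => /eqP vik.
    by rewrite -!pv vik.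
  have [kE|kE] := eqVneq k n.
    rewrite ifN; last by clear -ik kE; lia.
    rewrite kE eqxx andbT; case: (posnP i) => [i0'|i0']; first by rewrite xy orbT.
    have iin : (0 < i < n)%N by clear -i0' ik kE; lia.
    rewrite orbF adj_sym; have [iE|iE] := eqVneq n i.+1.
      by rewrite (_ : i = n.-1) // iE.
    apply/negbTE/negP=> yi; have := adj_v y i ye iin yi; rewrite (eq_sym i.+1) (negPf iE) orbF.
    by move/eqP=> i1; rewrite i1 (negPf y1) in yi.
  have kn' : (k < n)%N by clear -kn kE; lia.
  have -> : (i == n) = false by clear -ik kn'; lia.
  have -> : (k == 0) = false by clear -ik; lia.
  rewrite eqSS (negPf kE) andbF orbF.
  case: (posnP i) => [i0'|i0'].
    have kin : (0 < k < n)%N by rewrite kn' andbT -i0'.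
    rewrite i0'; apply/idP/eqP => [xk|->]; last exact: x1.
    have := adj_v x k xe kin xk => /orP[/eqP //|/eqP kE'].
    by case/negP: xn; rewrite (_ : n.-1 = k) // -kE'.
  have iin : (0 < i < n)%N by rewrite i0' (ltn_trans ik kn').
  have kin : (0 < k < n)%N by rewrite (ltn_trans i0' ik) kn'.
  rewrite -(@adj_cproj G a b) ?vout // !pv tadj ?ik //.
  by rewrite (_ : (i == 0) = false) ?orbF //; clear -i0'; lia.
have one : (0 < 1 < n)%N by clear -n3; lia.
have := adj_ab 1 one isT; have := adj_ab n.-1 n1.
rewrite prednK // eqxx orbT => /(_ isT).
have ae := set21 a b; have be := set22 a b.
have [a1|a1] := boolP (adj a (v 1)).
  have an := both a ae a1; rewrite (negPf an) /= => bn _.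
  apply: (extend a b) => //; apply/negP=> b1.
  by have := both b be b1; rewrite bn.
rewrite /= => anbn b1; have bn := both b be b1; rewrite (negPf bn) orbF in anbn.
by apply: (extend b a) => //; rewrite adj_sym.
Qed.

Lemma no_cycle_seq n (G : sgraph) : (2 < n)%N ->
  graph_free (cycle_graph n) G -> forall t : nat -> G, ~ cycle_seq n t.
Proof. by move=> n2 /graph_freeP free t /(cycle_embedding n2); apply: free. Qed.

Lemma secant_chordal_contract q (G : sgraph) (e : {set G}) : (1 <= q)%N ->
  graph_edge e -> secant_chordal q G -> secant_chordal q (gcontract e).
Proof.
move=> q1 [a [b [ab ->]]] [/family1_freeP wp /family2_freeP free cyc].
have nocyc p : (3 <= p)%N -> forall t : nat -> G, ~ cycle_seq (2 * q + p) t.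
  by move=> p3; apply: no_cycle_seq (cyc p p3); lia.
split.
- by apply/family1_freeP; apply: weakly_perfect_contract.
- by apply/family2_freeP; apply: elementary_free_contract => //; apply: nocyc.
move=> p p3; apply/graph_freeP => g; apply: cycle_contract => //; first by lia.
  exact: nocyc.
by rewrite -addnS; apply: nocyc; apply: ltnW.
Qed.

Theorem corollary1p5 (q : nat) (hq : (1 <= q)%N) :
  (forall (G : sgraph) (e : {set G}),
      graph_edge e -> secant_chordal q G -> secant_chordal q (gcontract e)) /\
  (forall (k : fieldType) (V : finType) (D : {set {set V}}) (p : nat),
      simplicial_complex D -> (1 <= p)%N ->
      property_N q.+1 p (@SR_ideal k V (secant q D)) ->
      forall e : {set V}, complex_edge D e ->
        property_N q.+1 p.-1
          (@SR_ideal k (contr_vertex e) (secant q (contract D e)))).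
Proof.
split=> [G e | k V D p Dc p1 ND e De]; first exact: secant_chordal_contract.
exact: property_N_contract.
Qed.
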